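(* Let $\mathcal{Q}$ be a class of probability distributions over a space $\mathcal{X}$. Suppose that there are constants $0\le c_1<c_2\le1$ and a map $f:\mathcal{X}\to\{0,1\}$ such that for all $c\in[c_1,c_2]$ there exists $Q_c\in\mathcal{Q}$ with $f_\#Q_c=\mathsf{Bern}(c)$. Then $$\mathrm{Risk}(\mathcal{P}^{\mathsf{HMM}}_n(k,\mathcal{Q}))\gtrsim\frac{k^2\log n}{n}+\frac kn\mathrm{Red}\big(\mathcal{Q}^{\otimes\lfloor n/k\rfloor}\big)$$ as long as $k\ge C$ and $n\ge k^D$, where $C,D$ are absolute constants.
   Context: Here $c_1,c_2$ are regarded as fixed constants (so that $C$, $D$ and the implied multiplicative constant in $\gtrsim$ do not depend on $n$, $k$, $\mathcal{X}$, $\mathcal{Q}$, $f$, but may depend on $c_1,c_2$). $f_\#Q$ is the pushforward of $Q$ under $f$; $\mathsf{Bern}(c)$ is the Bernoulli law with mean $c$. $\mathcal{P}^{\mathsf{HMM}}_n(k,\mathcal{Q})$ is the collection of joint laws of $X^{n+1}=(X_1,\dots,X_{n+1})$ of stationary HMMs with hidden states in $[k]=\{1,\dots,k\}$ and emissions in $\mathcal{Q}$: $\{Z_t\}$ is a stationary Markov chain on $[k]$ (arbitrary transition matrix) and, given $Z^{n+1}$, the $X_t\in\mathcal{X}$ are independent with $X_t\sim P_{X|Z}(\cdot|Z_t)$, where $P_{X|Z}(\cdot|z)\in\mathcal{Q}$ for every $z\in[k]$. For a class $\mathcal{P}$ of distributions, $\mathrm{Red}(\mathcal{P})=\inf_{Q}\sup_{P\in\mathcal{P}}\mathrm{KL}(P\|Q)$,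 the infimum being over all probability distributions $Q$ on the same space; $\mathcal{Q}^{\otimes t}=\{Q^{\otimes t}:Q\in\mathcal{Q}\}$. For a class $\mathcal{P}_{n+1}$ of laws of $X^{n+1}$, $$\mathrm{Risk}(\mathcal{P}_{n+1})=\inf_{Q_{X_{n+1}|X^n}}\sup_{P\in\mathcal{P}_{n+1}}\mathbb{E}_P[\mathrm{KL}(P_{X_{n+1}|X^n}\|Q_{X_{n+1}|X^n})].$$ *)

(* Defs.v *)
From HB Require Import structures.
From mathcomp Require Import all_boot all_order all_algebra.
From mathcomp Require Import all_classical all_reals all_analysis.

Set Implicit Arguments.
Unset Strict Implicit.
Unset Printing Implicit Defensive.

Import Order.TTheory GRing.Theory Num.Theory.
Import numFieldNormedType.Exports.

Local Open Scope classical_set_scope.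
Local Open Scope ring_scope.
Local Open Scope ereal_scope.
Local Open Scope charge_scope.

(* Natural logarithm.  'd P '/d Q can be nonpositive (where [lne] is -oo) only
   on a P-null set, and the negative part of the integrand is P-integrable. *)
Definition KL {d : measure_display} {T : measurableType d} {R : realType}
    (P Q : probability T R) : \bar R :=
  if `[< P `<< Q >]
  then \int[P]_x lne (('d (charge_of_finite_measure P) '/d Q) x)
  else +oo.

Definition Red {d : measure_display} {T : measurableType d} {R : realType}
    (C : set (probability T R)) : \bar R :=
  ereal_inf [set ereal_sup [set KL P Q | P in C] | Q in [set: probability T R]].

Definition rectangle {T : Type} {m : nat} (A : 'I_m -> set T) :
    set (m.-tuple T) :=
  [set x | forall i, A i (tnth x i)].

(* A law on [m.-tuple T] is determined by its values on measurable
   rectangles. *)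
Definition prod_class {d : measure_display} {T : measurableType d}
    {R : realType} (C : set (probability T R)) (m : nat) :
    set (probability (m.-tuple T) R) :=
  [set P : probability (m.-tuple T) R | exists2 Q : probability T R, C Q &
     forall A : 'I_m -> set T, (forall i, measurable (A i)) ->
       P (rectangle A) = \prod_(i < m) Q (A i)].
Arguments prod_class {d T R} C m.

Definition row_stochastic {R : realType} {k : nat} (M : 'M[R]_k) : Prop :=
  (forall i j, (0 <= M i j)%R) /\ (forall i, (\sum_j M i j)%R = 1%R).

Definition stationary_distribution {R : realType} {k : nat} (M : 'M[R]_k)
    (p : 'I_k -> R) : Prop :=
  [/\ forall i, (0 <= p i)%R, (\sum_i p i)%R = 1%R &
      forall j, (\sum_i p i * M i j)%R = p j].

(* Probability of the trajectory z_1, ..., z_{n+1} of the hidden chain. *)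
Definition chain_weight {R : realType} {k n : nat} (p : 'I_k -> R)
    (M : 'M[R]_k) (z : {ffun 'I_n.+1 -> 'I_k}) : R :=
  (p (z ord0) *
   \prod_(t < n) M (z (widen_ord (leqnSn n) t)) (z (lift ord0 t)))%R.

(* The laws of X^{n+1}; conditionally on the hidden trajectory z the
   coordinates are independent, the t-th one having law [E (z t)]. *)
Definition HMM {d : measure_display} {T : measurableType d} {R : realType}
    (n k : nat) (C : set (probability T R)) :
    set (probability (n.+1.-tuple T) R) :=
  [set P : probability (n.+1.-tuple T) R |
    exists (p : 'I_k -> R) (M : 'M[R]_k) (E : 'I_k -> probability T R),
    [/\ row_stochastic M, stationary_distribution M p, forall z, C (E z) &
      forall A : 'I_n.+1 -> set T, (forall t, measurable (A t)) ->
        P (rectangle A) =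
          \sum_(z : {ffun 'I_n.+1 -> 'I_k})
             (chain_weight p M z)%:E * \prod_(t < n.+1) E (z t) (A t)]].
Arguments HMM {d T R} n k C.

Definition past {T : Type} {n : nat} (x : n.+1.-tuple T) : n.-tuple T :=
  [tuple tnth x (widen_ord (leqnSn n) i) | i < n].

Definition present {T : Type} {n : nat} (x : n.+1.-tuple T) : T :=
  tnth x ord_max.

Definition kernel_at {d d' : measure_display} {S : measurableType d}
    {T : measurableType d'} {R : realType} (K : R.-pker S ~> T) (y : S) :
    set T -> \bar R := K y.

HB.instance Definition _ (d d' : measure_display) (S : measurableType d)
    (T : measurableType d') (R : realType) (K : R.-pker S ~> T) (y : S) :=
  Measure.on (kernel_at K y).

HB.instance Definition _ (d d' : measure_display) (S : measurableType d)
    (T : measurableType d') (R : realType) (K : R.-pker S ~> T) (y : S) :=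
  Measure_isProbability.Build d' T R (kernel_at K y) (@prob_kernel _ _ _ _ _ K y).

(* [K] is a version of the conditional law of X_{n+1} given X^n under [P]. *)
Definition is_cond_law {d : measure_display} {T : measurableType d}
    {R : realType} {n : nat} (P : probability (n.+1.-tuple T) R)
    (K : R.-pker (n.-tuple T) ~> T) : Prop :=
  forall (A : set (n.-tuple T)) (B : set T), measurable A -> measurable B ->
    P ((past @^-1` A) `&` (present @^-1` B)) =
      \int[P]_(x in past @^-1` A) K (past x) B.

(* E_P[KL(P_{X_{n+1}|X^n} || Q_{X_{n+1}|X^n})].  The space T is an arbitrary
   measurable space, so P_{X_{n+1}|X^n} need not be unique P-a.e. as a measure;
   the infimum ranges over all its versions (on a countably generated T the
   integral does not depend on the version).  Laws in [HMM n k C] always have a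
   version, the posterior mixture of the emission laws.  If the integrand is not
   measurable, the library integral of this nonnegative function is its lower
   integral. *)
Definition cond_KL {d : measure_display} {T : measurableType d} {R : realType}
    {n : nat} (P : probability (n.+1.-tuple T) R)
    (Q : R.-pker (n.-tuple T) ~> T) : \bar R :=
  ereal_inf [set \int[P]_x KL (kernel_at K (past x)) (kernel_at Q (past x)) |
             K in [set K : R.-pker (n.-tuple T) ~> T | is_cond_law P K]].

Definition Risk {d : measure_display} {T : measurableType d} {R : realType}
    {n : nat} (C : set (probability (n.+1.-tuple T) R)) : \bar R :=
  ereal_inf [set ereal_sup [set cond_KL P Q | P in C] |
             Q in [set: R.-pker (n.-tuple T) ~> T]].

(* Main.v *)
Require Import Defs.
From HB Require Import structures.
From mathcomp Require Import all_boot all_order all_algebra.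
From mathcomp Require Import all_classical all_reals all_analysis.
From mathcomp Require Import measurable_realfun.
From mathcomp Require Import ring lra zify.

(** Let [K] be a one-step predictor whose risk over the hidden Markov class is
at most [rho].  Iterating [K] turns [n] past observations into a law on the next
[m <= n] ones, and averaging over a past of [n] independent symbols drawn from
one fixed emission law [E0] gives a single law on [X^m], the forecast.  The main
step says that the forecast is nearly universal for chains with one state less:
every law on [X^m] of a [k-1]-state chain with emissions in the class, started
from a fixed state, has divergence [O(n rho + log n)] from it
([forecast_regret]).

To see this, add to such an active chain a waiting state that emits [E0], and
let the chain enter and leave that state with probability about [1/n] at each
step.  The stationary version of this [k]-state chain is in the class.  The risk
of [K] concerns time [n+1] only, but by stationarity [K] can be applied to any
window of length [n]; what is lost at a later time is the difference of two
entropy increments of the process.  Summed over [2n] steps these differences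
telescope to the information that consecutive blocks share through one hidden
state, which is at most [log (1/min pi)] ([prediction_transport],
[neg_entropy_memory]).  With constant probability the first [3n] steps contain
[n] waiting steps followed by [m] active ones.  The instant of the switch is
unknown, but a uniform mixture over the possible instants costs only [log n]
([nonneg_regret_le]).

Two families of active chains then bound the regret of the forecast from below.
A deterministic cycle through [k-1] states interleaves [k-1] independent samples
of size [n/k], whose laws can be chosen one after the other, each against the
forecast conditioned on the preceding choices.  Hence the regret is at least
[(k-1) Red] ([red_le_regret]).  On the other hand, if the states emit only
[Q_c1] and [Q_c2], then [f] provides a noisy bit of the hidden state, and a
sparse chain with [r^2] free transition probabilities, [r] of order [k], can be
decoded from averages of products of at most six such bits.  A grid of [L]
values for each probability, with [L] of order [n^(1/4)], gives [L^(r^2)] chains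
that are told apart by disjoint events, so the forecast gives one of these
events probability at most [L^(-r^2)], and the regret is at least of order [k^2
log n] ([bits_regret]).  As [k] is large, the second bound absorbs the [log n]
terms of the regret, so [n rho] dominates both.

Divergences are handled through the Donsker-Varadhan formula: the divergence of
[P] from [W] is the supremum of [E_P g - log E_W (exp g)] over bounded measurable
[g] ([KL_ge], [KL_gt_test]).  So every inequality above is one between
expectations of bounded functions, and holds on an arbitrary measurable space. *)

Set Implicit Arguments.
Unset Strict Implicit.
Unset Printing Implicit Defensive.

Import Order.TTheory GRing.Theory Num.Theory.
Import numFieldNormedType.Exports.

Local Open Scope classical_set_scope.
Local Open Scope ring_scope.

(** * Bounded measurable functions and their means *)

Definition bm {d} {T : measurableType d} {R : realType} (f : T -> R) : Prop :=
  measurable_fun [set: T] f /\ exists B, forall x, `|f x| <= B.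

Definition mean {d} {T : measurableType d} {R : realType}
  (mu : probability T R) (f : T -> R) : R := \int[mu]_x f x.

Section bm_closure.
Context {d} {T : measurableType d} {R : realType}.
Implicit Types f g : T -> R.

Lemma bm_cst (c : R) : bm (fun _ : T => c).
Proof. by split => //; exists `|c|. Qed.

Lemma bmD f g : bm f -> bm g -> bm (fun x => f x + g x).
Proof.
move=> [mf [B Bf]] [mg [C Cg]]; split; first exact: measurable_funD.
by exists (B + C) => x; rewrite (le_trans (ler_normD _ _))// lerD.
Qed.

Lemma bmN f : bm f -> bm (fun x => - f x).
Proof.
move=> [mf [B Bf]]; split; first exact: measurableT_comp.
by exists B => x; rewrite normrN.
Qed.

Lemma bmB f g : bm f -> bm g -> bm (fun x => f x - g x).
Proof. by move=> bf bg; apply: (bmD bf (bmN bg)). Qed.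

Lemma bmM f g : bm f -> bm g -> bm (fun x => f x * g x).
Proof.
move=> [mf [B Bf]] [mg [C Cg]]; split; first exact: measurable_funM.
by exists (B * C) => x; rewrite normrM ler_pM.
Qed.

Lemma bm_sum I (r : seq I) (P : pred I) (F : I -> T -> R) :
  (forall i, P i -> bm (F i)) -> bm (fun x => \sum_(i <- r | P i) F i x).
Proof.
move=> bF; elim: r => [|j r IH].
  by under eq_fun do rewrite big_nil; exact: bm_cst.
under eq_fun do rewrite big_cons.
by case Pj: (P j) => //; apply: bmD => //; exact: bF.
Qed.

Lemma bm_prod I (r : seq I) (P : pred I) (F : I -> T -> R) :
  (forall i, P i -> bm (F i)) -> bm (fun x => \prod_(i <- r | P i) F i x).
Proof.
move=> bF; elim: r => [|j r IH].
  by under eq_fun do rewrite big_nil; exact: bm_cst.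
under eq_fun do rewrite big_cons.
by case Pj: (P j) => //; apply: bmM => //; exact: bF.
Qed.

Lemma bm_indic (A : set T) : measurable A -> bm (\1_A : T -> R).
Proof.
move=> mA; split; first exact: measurable_indic.
by exists 1 => x; rewrite indicE; case: (_ \in _); rewrite ?normr1 ?normr0.
Qed.

Lemma bm_expR f : bm f -> bm (fun x => expR (f x)).
Proof.
move=> [mf [B Bf]]; split; first exact: measurableT_comp.
exists (expR B) => x; rewrite ger0_norm ?expR_ge0// ler_expR.
exact: le_trans (ler_norm _) (Bf x).
Qed.

Lemma measurable_inv_fun f : measurable_fun setT f -> (forall x, 0 <= f x) ->
  measurable_fun setT (fun x => (f x)^-1).
Proof.
move=> mf f0; under eq_fun do rewrite -powR_inv1//.
exact: (measurableT_comp (@measurable_powR R (-1)) mf).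
Qed.

Lemma bm_inv f (c : R) : 0 < c -> (forall x, c <= f x) -> bm f ->
  bm (fun x => (f x)^-1).
Proof.
move=> c0 cf [mf _]; split.
  by apply: measurable_inv_fun => // x; rewrite ltW// (lt_le_trans c0).
exists c^-1 => x; have fx0 : 0 < f x by exact: lt_le_trans (cf x).
rewrite ger0_norm; last by rewrite invr_ge0 ltW.
by rewrite lef_pV2 ?posrE.
Qed.

Lemma bm_ln f (c : R) : 0 < c -> (forall x, c <= f x) -> bm f ->
  bm (fun x => ln (f x)).
Proof.
move=> c0 cf [mf [B Bf]]; split; first exact: measurableT_comp.
exists (`|ln c| + `|ln B|) => x; have fx0 : 0 < f x by exact: lt_le_trans (cf x).
have fB : f x <= B by exact: le_trans (ler_norm _) (Bf x).
have h1 : ln c <= ln (f x) by rewrite ler_ln ?posrE.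
have h2 : ln (f x) <= ln B by rewrite ler_ln ?posrE// (lt_le_trans fx0).
rewrite ler_norml; apply/andP; split.
  by move: (ler_norm (- ln c)) (normr_ge0 (ln B)); rewrite normrN; lra.
by move: (ler_norm (ln B)) (normr_ge0 (ln c)); lra.
Qed.

Lemma bm_comp {d'} {S : measurableType d'} (u : S -> T) f :
  measurable_fun setT u -> bm f -> bm (f \o u).
Proof.
move=> mu [mf [B Bf]]; split; first exact: measurableT_comp.
by exists B => x /=.
Qed.

Lemma bm_ext f g : f =1 g -> bm f -> bm g.
Proof. by move=> /funext ->. Qed.

End bm_closure.

Section mean_theory.
Context {d} {T : measurableType d} {R : realType}.
Variable mu : probability T R.
Implicit Types f g : T -> R.

Lemma bm_integrable f : bm f -> mu.-integrable setT (EFin \o f).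
Proof.
move=> [mf [B Bf]]; apply: measurable_bounded_integrable => //=.
  by rewrite probability_setT ltry.
exists `|B|; split; first by rewrite num_real.
move=> M BM x _; apply: (le_trans (Bf x)); apply: (le_trans (ler_norm _)).
exact: ltW.
Qed.

Lemma meanE f : bm f -> (\int[mu]_x (f x)%:E = (mean mu f)%:E)%E.
Proof.
move=> bf; rewrite /mean /Rintegral fineK//.
exact: (integrable_fin_num measurableT (bm_integrable bf)).
Qed.

Lemma mean_cst (c : R) : mean mu (fun=> c) = c.
Proof.
rewrite /mean Rintegral_cst//.
by have /= -> := @probability_setT _ _ _ mu; rewrite mulr1.
Qed.

Lemma meanD f g : bm f -> bm g -> mean mu (fun x => f x + g x) = mean mu f + mean mu g.
Proof. by move=> bf bg; apply: RintegralD => //; apply: bm_integrable. Qed.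

Lemma meanZl c f : bm f -> mean mu (fun x => c * f x) = c * mean mu f.
Proof. by move=> bf; apply: RintegralZl => //; apply: bm_integrable. Qed.

Lemma meanZr c f : bm f -> mean mu (fun x => f x * c) = mean mu f * c.
Proof. by move=> bf; apply: RintegralZr => //; apply: bm_integrable. Qed.

Lemma meanN f : bm f -> mean mu (fun x => - f x) = - mean mu f.
Proof.
by move=> bf; under eq_fun do rewrite -mulN1r; rewrite meanZl// mulN1r.
Qed.

Lemma meanB f g : bm f -> bm g -> mean mu (fun x => f x - g x) = mean mu f - mean mu g.
Proof. by move=> bf bg; rewrite meanD ?meanN//; apply: bmN. Qed.

Lemma mean_le f g : bm f -> bm g -> (forall x, f x <= g x) -> mean mu f <= mean mu g.
Proof. by move=> bf bg fg; apply: le_Rintegral => //; apply: bm_integrable. Qed.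

Lemma mean_ge0 f : (forall x, 0 <= f x) -> 0 <= mean mu f.
Proof. by move=> f0; apply: Rintegral_ge0. Qed.

Lemma mean_sum I (r : seq I) (P : pred I) (F : I -> T -> R) :
  (forall i, P i -> bm (F i)) ->
  mean mu (fun x => \sum_(i <- r | P i) F i x) = \sum_(i <- r | P i) mean mu (F i).
Proof.
move=> bF; elim: r => [|j r IH].
  by rewrite big_nil; under eq_fun do rewrite big_nil; exact: mean_cst.
rewrite big_cons; under eq_fun do rewrite big_cons.
case Pj: (P j) => //; rewrite meanD ?IH//; first exact: bF.
exact: bm_sum.
Qed.

Lemma mean_bound f (B : R) : bm f -> (forall x, `|f x| <= B) -> `|mean mu f| <= B.
Proof.
move=> bf Bf; rewrite ler_norml -(mean_cst (- B)) -[X in _ && (_ <= X)](mean_cst B).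
by apply/andP; split; apply: mean_le => //; try exact: bm_cst;
  move=> x; move: (Bf x); rewrite ler_norml => /andP[].
Qed.

Lemma mean_indic (A : set T) : measurable A -> (mean mu \1_A)%:E = mu A.
Proof.
move=> mA; rewrite -meanE; last exact: bm_indic.
by rewrite integral_indic// setIT.
Qed.

Lemma mean_dct (f : (T -> R)^nat) (g : T -> R) (B : R) :
  (forall i, measurable_fun setT (f i)) -> (forall i x, `|f i x| <= B) ->
  (forall x, f i x @[i --> \oo] --> g x) ->
  mean mu (f i) @[i --> \oo] --> mean mu g.
Proof.
move=> mf Bf fg.
have mg : measurable_fun setT g.
  by apply: (measurable_fun_cvg mf) => x _; exact: fg.
have Bg x : `|g x| <= B.
  have h : `|f i x| @[i --> \oo] --> `|g x| by exact: cvg_norm (fg x).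
  rewrite -(cvg_lim _ h)//; apply: limr_le; first by apply/cvg_ex; exists `|g x|.
  exact: nearW.
have bg : bm g by split => //; exists B.
have bf i : bm (f i) by split => //; exists B => x; exact: Bf.
have fgE x : (f i x)%:E @[i --> \oo] --> (g x)%:E.
  by apply: cvg_EFin; [exact: nearW|exact: fg].
have [_ _] := @dominated_convergence _ T R mu setT measurableT
    (fun i => EFin \o f i) (EFin \o g) (cst B%:E)
    (fun i => measurableT_comp (@EFin_measurable R setT) (mf i))
    (measurableT_comp (@EFin_measurable R setT) mg)
    (aeW _ (fun x _ => fgE x))
    (bm_integrable (bm_cst B)) (aeW _ (fun x i _ => Bf i x)).
by rewrite meanE//; move/fine_cvg.
Qed.

End mean_theory.

Section kernel_mean.
Context {d d'} {T : measurableType d} {Y : measurableType d'} {R : realType}.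

Lemma bm_section (f : T * Y -> R) (t : T) : bm f -> bm (fun y => f (t, y)).
Proof. exact: (@bm_comp _ _ _ _ _ (pair t)). Qed.

Lemma bm_section2 (f : T * Y -> R) (y : Y) : bm f -> bm (fun t => f (t, y)).
Proof. exact: (@bm_comp _ _ _ _ _ (fun t => (t, y))). Qed.

Lemma bm_mean_kernel (k : R.-pker T ~> Y) (f : T * Y -> R) : bm f ->
  bm (fun t => mean (kernel_at k t) (fun y => f (t, y))).
Proof.
move=> bf; have [mf [B Bf]] := bf; split; last first.
  by exists B => t; apply: mean_bound; [exact: bm_section|move=> y; exact: Bf].
pose g z := f z + B.
have bg : bm g by apply: bmD => //; exact: bm_cst.
have g0 z : 0 <= g z by move: (Bf z); rewrite /g ler_norml => /andP[]; lra.
rewrite (_ : (fun t => _) = fun t =>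
   fine (\int[k t]_y (g (t, y))%:E)%E - B); last first.
  apply/funext => t.
  rewrite -[LHS](addrK B) -[X in _ + X - _](mean_cst (kernel_at k t) B).
  rewrite -meanD//; [exact: bm_section|exact: bm_cst].
apply: measurable_funB => //; apply: measurableT_comp => //.
apply: (@measurable_fun_integral_finite_kernel _ _ _ _ _ (EFin \o g) k).
  by move=> z; rewrite /= lee_fin.
by apply/measurable_EFinP; case: bg.
Qed.

Lemma mean_swap (mu : probability T R) (nu : probability Y R) (f : T * Y -> R) :
  bm f -> mean mu (fun x => mean nu (fun y => f (x, y))) =
          mean nu (fun y => mean mu (fun x => f (x, y))) /\
  bm (fun x => mean nu (fun y => f (x, y))) /\
  bm (fun y => mean mu (fun x => f (x, y))).
Proof.
move=> bf; have [mf [B Bf]] := bf.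
pose g z := f z + B.
have bg : bm g by apply: bmD => //; exact: bm_cst.
have g0 z : (0 <= (EFin \o g) z)%E.
  by move: (Bf z); rewrite /g /= lee_fin ler_norml => /andP[]; lra.
have mg : measurable_fun setT (EFin \o g) by apply/measurable_EFinP; case: bg.
have E1 x : mean nu (fun y => f (x, y)) = mean nu (fun y => g (x, y)) - B.
  rewrite -[LHS](addrK B) -[X in _ + X - _](mean_cst nu B).
  by rewrite -meanD//; [exact: bm_section|exact: bm_cst].
have E2 y : mean mu (fun x => f (x, y)) = mean mu (fun x => g (x, y)) - B.
  rewrite -[LHS](addrK B) -[X in _ + X - _](mean_cst mu B).
  by rewrite -meanD//; [exact: bm_section2|exact: bm_cst].
have b1 : bm (fun x => mean nu (fun y => f (x, y))).
  split; last first.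
    by exists B => x; apply: mean_bound; [exact: bm_section|move=> y; exact: Bf].
  under eq_fun do rewrite E1.
  apply: measurable_funB => //; apply: measurableT_comp => //.
  exact: (@measurable_fun_fubini_tonelli_F _ _ T Y R nu (EFin \o g) mg g0).
have b2 : bm (fun y => mean mu (fun x => f (x, y))).
  split; last first.
    by exists B => y; apply: mean_bound; [exact: bm_section2|move=> x; exact: Bf].
  under eq_fun do rewrite E2.
  apply: measurable_funB => //; apply: measurableT_comp => //.
  exact: (@measurable_fun_fubini_tonelli_G _ _ T Y R mu (EFin \o g) mg g0).
split=> //.
have -> : (fun x => mean nu (fun y => f (x, y))) =
  (fun x => mean nu (fun y => g (x, y)) - B) by exact/funext.
have -> : (fun y => mean mu (fun x => f (x, y))) =
  (fun y => mean mu (fun x => g (x, y)) - B) by exact/funext.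
have b1' : bm (fun x => mean nu (fun y => g (x, y))).
  by apply: bm_ext (bmD b1 (bm_cst B)) => x; rewrite E1 subrK.
have b2' : bm (fun y => mean mu (fun x => g (x, y))).
  by apply: bm_ext (bmD b2 (bm_cst B)) => y; rewrite E2 subrK.
rewrite !meanB ?mean_cst//; try exact: bm_cst; congr (_ - _).
apply: EFin_inj; rewrite -!meanE//.
rewrite (eq_integral (fun x => \int[nu]_y (g (x, y))%:E)%E); last first.
  by move=> x _; rewrite -meanE//; exact: bm_section.
rewrite [RHS](eq_integral (fun y => \int[mu]_x (g (x, y))%:E)%E); last first.
  by move=> x _; rewrite -meanE//; exact: bm_section2.
exact: (@sfinite_Fubini _ _ _ _ _ mu nu (EFin \o g) g0 mg).
Qed.

End kernel_mean.

(** * Probability laws from expectation functionals *)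

(** The data from which the Daniell construction builds a probability measure,
on bounded functions only: expectations are combined below as averages,
compositions and tiltings, which is simpler for functionals than for measures. *)
Record mean_functional {d} (T : measurableType d) (R : realType) := Expectation {
  expec :> (T -> R) -> R ;
  expecD : forall f g, bm f -> bm g ->
    expec (fun x => f x + g x) = expec f + expec g ;
  expecZ : forall c f, bm f -> expec (fun x => c * f x) = c * expec f ;
  expec_ge0 : forall f, bm f -> (forall x, 0 <= f x) -> 0 <= expec f ;
  expec1 : expec (fun=> 1) = 1 ;
  expec_dct : forall (f : (T -> R)^nat) g B, (forall i, bm (f i)) -> bm g ->
    (forall i x, `|f i x| <= B) -> (forall x, f i x @[i --> \oo] --> g x) ->
    expec (f i) @[i --> \oo] --> expec g }.

Import HBNNSimple.

Section expectation_measure.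
Context {d} {T : measurableType d} {R : realType}.
Variable L : mean_functional T R.

Lemma expec0 : L (fun=> 0) = 0.
Proof.
rewrite -[RHS](mul0r (L (fun=> 0))) -expecZ; last exact: bm_cst.
by congr (expec L _); apply/funext => x; rewrite mul0r.
Qed.

Lemma expec_sum I (r : seq I) (P : pred I) (F : I -> T -> R) :
  (forall i, P i -> bm (F i)) ->
  L (fun x => \sum_(i <- r | P i) F i x) = \sum_(i <- r | P i) L (F i).
Proof.
move=> bF; elim: r => [|j r IH].
  by rewrite big_nil; under eq_fun do rewrite big_nil; exact: expec0.
rewrite big_cons; under eq_fun do rewrite big_cons.
case Pj: (P j) => //; rewrite expecD ?IH//; first exact: bF.
exact: bm_sum.
Qed.

Definition expec_set (A : set T) : \bar R :=
  if `[< measurable A >] then (L \1_A)%:E else 0%E.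

Let expec_set0 : expec_set set0 = 0%E.
Proof.
rewrite /expec_set; case: asboolP => // _; rewrite indic0; congr EFin.
exact: expec0.
Qed.

Let expec_set_ge0 A : (0 <= expec_set A)%E.
Proof.
rewrite /expec_set; case: asboolP => // mA; rewrite lee_fin.
by apply: expec_ge0 => [|x]; [exact: bm_indic|rewrite indicE].
Qed.

Lemma sum_indic_trivIset (F : (set T)^nat) (x : T) : trivIset setT F ->
  (\sum_(0 <= i < n) \1_(F i) x : R) @[n --> \oo] --> (\1_(\bigcup_n F n) x : R).
Proof.
move=> tF; rewrite [X in _ --> X]indicE.
have [|xF] := boolP (x \in \bigcup_n F n); last first.
  rewrite (_ : (fun n => _) = fun=> 0); first exact: cvg_cst.
  apply/funext => n; rewrite big1// => i _; rewrite indicE memNset// => Fx.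
  by move/negP: xF; apply; rewrite inE; exists i.
rewrite inE => -[j _ Fjx].
have E n : \sum_(0 <= i < n) (\1_(F i) x : R) = (j < n)%N%:R.
  elim: n => [|n IH]; first by rewrite big_nil.
  rewrite big_nat_recr//= IH indicE ltnS [(j <= n)%N]leq_eqVlt.
  have [jn|jn] := eqVneq j n; first by rewrite -jn ltnn add0r mem_set.
  rewrite memNset ?addr0// => Fnx; move/eqP: jn; apply.
  by apply: (tF _ _ I I); exists x.
apply: cvg_near_cst; near=> n; rewrite E.
by have -> : (j < n)%N by near: n; exact: nbhs_infty_gt.
Unshelve. all: end_near. Qed.

Let expec_set_sigma : semi_sigma_additive expec_set.
Proof.
move=> F mF tF mUF.
rewrite (_ : (fun n => _) = fun n =>
    (L (fun x => \sum_(0 <= i < n) \1_(F i) x))%:E); last first.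
  apply/funext => n; rewrite /expec_set.
  transitivity (\sum_(0 <= i < n) (L \1_(F i))%:E)%E.
    by apply: eq_bigr => i _; case: asboolP => // /(_ (mF i)).
  by rewrite sumEFin; congr EFin; rewrite -expec_sum// => i _; exact: bm_indic.
rewrite /expec_set; case: asboolP => // _.
apply: cvg_EFin; first exact: nearW.
apply: (@expec_dct _ _ _ L _ _ 1).
- by move=> i; apply: bm_sum => j _; exact: bm_indic.
- exact: bm_indic.
- move=> n x; rewrite ger0_norm; last by apply: sumr_ge0 => i _; rewrite indicE.
  have h := @sum_indic_trivIset F x tF.
  have nd : nondecreasing_seq (fun n => \sum_(0 <= i < n) \1_(F i) x : R).
    by apply/nondecreasing_seqP => m; rewrite big_nat_recr//= lerDl indicE.
  have := nondecreasing_cvgn_le nd _ n; rewrite (cvg_lim _ h)// => H.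
  apply: le_trans (H h) _.
  by rewrite indicE; case: (_ \in _).
- by move=> x; exact: sum_indic_trivIset.
Qed.

HB.instance Definition _ := isMeasure.Build d T R expec_set
  expec_set0 expec_set_ge0 expec_set_sigma.

Let expec_setT : expec_set setT = 1%E.
Proof.
rewrite /expec_set; case: asboolP => // _; congr EFin; rewrite -(expec1 L).
by congr (expec L _); apply/funext => x; rewrite indicT.
Qed.

HB.instance Definition _ :=
  Measure_isProbability.Build d T R expec_set expec_setT.

Definition expec_prob : probability T R := expec_set.

(** Both sides agree on simple functions, which approximate a nonnegative bounded
function from below, and both pass to the limit; a bounded function becomes
nonnegative after adding a constant. *)
Lemma mean_expec_prob f : bm f -> mean expec_prob f = L f.
Proof.
suff H f' : bm f' -> (forall x, 0 <= f' x) -> mean expec_prob f' = L f'.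
  move=> bf; have [mf [B Bf]] := bf.
  have bB := bm_cst B : @bm _ T R (fun=> B).
  have LB : L (fun=> B) = B.
    rewrite -[RHS]mulr1 -(expec1 L) -expecZ; last exact: bm_cst.
    by congr (expec L _); apply/funext => x; rewrite mulr1.
  have := H (fun x => f x + B) (bmD bf bB).
  rewrite meanD// expecD// mean_cst LB => /(_ _)/addIr; apply.
  by move=> x; move: (Bf x); rewrite ler_norml => /andP[]; lra.
move=> {f} bf f0; have [mf [B Bf]] := bf.
have mEf : measurable_fun setT (EFin \o f') by apply/measurable_EFinP.
pose g := nnsfun_approx measurableT mEf.
have g0 n x : 0 <= g n x by exact: fun_ge0.
have gn x : g n x @[n --> \oo] --> f' x.
  have := @cvg_nnsfun_approx _ _ _ _ measurableT _ mEf (fun x _ => f0 x) x I.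
  by move/fine_cvg.
have gf n x : g n x <= f' x.
  have nd : nondecreasing_seq (fun n => g n x).
    by move=> a b ab; exact/lefP/nd_nnsfun_approx.
  have := nondecreasing_cvgn_le nd _ n; rewrite (cvg_lim _ (gn x))//; apply.
  exact: gn.
have bg n : bm (g n).
  split => //; exists B => x; rewrite ger0_norm// (le_trans (gf n x))//.
  by rewrite (le_trans (ler_norm _)).
have gE n : mean expec_prob (g n) = L (g n).
  have bI (c r : R) : bm (fun x => c * \1_(g n @^-1` [set r]) x).
    by apply: bmM; [exact: bm_cst|exact: bm_indic].
  have [m [c cE]] : exists m (c : 'I_m -> R), forall x,
      g n x = \sum_(i < m) c i * \1_(g n @^-1` [set c i]) x.
    by eexists; eexists => x; rewrite {1}fimfunEord.
  pose h x := \sum_(i < m) c i * \1_(g n @^-1` [set c i]) x.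
  have -> : (g n : T -> R) = h by apply/funext => x; exact: cE.
  rewrite mean_sum// expec_sum//; apply: eq_bigr => i _; set A := _ @^-1` _.
  have mA : measurable A by rewrite -[A]setTI; apply: (bg n).1.
  rewrite meanZl ?expecZ//; try exact: bm_indic.
  congr (_ * _); apply: EFin_inj; rewrite mean_indic// /expec_prob /= /expec_set.
  by case: asboolP.
have Bg n x : `|g n x| <= B.
  rewrite ger0_norm// (le_trans (gf n x))//.
  by rewrite (le_trans (ler_norm _)).
have h1 := @mean_dct _ _ _ expec_prob (fun n => g n) f' B (fun n => (bg n).1) Bg gn.
have h2 := @expec_dct _ _ _ L (fun n => g n) f' B bg bf Bg gn.
rewrite -(cvg_lim _ h1)// -(cvg_lim _ h2)//; congr (limn _).
by apply/funext => n; exact: gE.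
Qed.

End expectation_measure.

Lemma mean_eq_pi_system {d} {T : measurableType d} {R : realType} (G : set (set T))
    (P1 P2 : probability T R) :
  @measurable _ T = <<s G >> -> setI_closed G -> G setT ->
  (forall A, G A -> P1 A = P2 A) -> forall f, mean P1 f = mean P2 f.
Proof.
move=> mG IG GT P12 f; rewrite /mean /Rintegral; congr fine.
apply: eq_measure_integral => A mA _.
have sG : G `<=` measurable by rewrite mG; exact: sub_gen_smallest.
apply: (@g_sigma_algebra_measure_unique _ _ _ G sG (fun=> setT)) => //.
- by rewrite bigcup_const.
- by move=> _ /=; rewrite (probability_setT P1) ltry.
- by rewrite -mG.
Qed.

(** * The Donsker-Varadhan formula *)

Section kl_variational.
Context {d} {T : measurableType d} {R : realType}.
Local Open Scope ereal_scope.
Local Open Scope charge_scope.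

Lemma measurable_lne (f : T -> \bar R) : measurable_fun setT f ->
  measurable_fun setT (fun x => lne (f x)).
Proof.
move=> mf; rewrite (_ : (fun x => _) = fun x => if f x <= 0 then -oo else
   if f x == +oo then +oo else (ln (fine (f x)))%:E); last first.
  by apply/funext => x; case: (f x) => [r| |] //=; rewrite ?lee_fin ?leNye.
apply: measurable_fun_ifT => //.
  exact: measurable_fun_lee.
apply: measurable_fun_ifT => //.
  by apply: measurable_fun_eqe.
apply/measurable_EFinP; apply: measurableT_comp => //.
exact: measurableT_comp.
Qed.

Lemma integral_prob_cst (P : probability T R) (c : R) : \int[P]_x c%:E = c%:E.
Proof. by rewrite meanE ?mean_cst//; exact: bm_cst. Qed.

Variables (P Q : probability T R).

(** A finite-valued version of the density, so that it can be cut off and divided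
by; the divergence is the integral of its logarithm. *)
Lemma RN_real : P `<< Q -> exists r : T -> R,
  [/\ measurable_fun setT r, forall x, (0 <= r x)%R,
   forall h : T -> \bar R, (forall x, 0 <= h x) -> measurable_fun setT h ->
     \int[Q]_x (h x * (r x)%:E) = \int[P]_x h x &
   KL P Q = \int[P]_x lne (r x)%:E ].
Proof.
move=> PQ.
pose f := Radon_Nikodym_SigmaFinite.f P Q.
have fE x : (fine (f x))%:E = f x.
  by rewrite fineK//; exact: Radon_Nikodym_SigmaFinite.f_fin_num.
have mf : measurable_fun setT f.
  exact: (measurable_int _ (Radon_Nikodym_SigmaFinite.f_integrable PQ)).
exists (fine \o f); split.
- exact: measurableT_comp.
- by move=> x; rewrite /= fine_ge0//; exact: Radon_Nikodym_SigmaFinite.f_ge0.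
- move=> h h0 mh; under eq_integral do rewrite /= fE.
  exact: Radon_Nikodym_SigmaFinite.change_of_variables.
- rewrite /KL asboolT//; apply: ae_eq_integral => //.
  + by apply: measurable_lne; apply: measurable_int; exact: Radon_Nikodym_integrable.
  + rewrite (_ : (fun x => _) = fun x => lne (f x)); first exact: measurable_lne.
    by apply/funext => x; congr lne; exact: fE.
  + have := ae_eq_Radon_Nikodym_SigmaFinite PQ measurableT.
    move/(null_dominates_ae_eq measurableT PQ) => [N [mN N0 NE]]; exists N; split => //.
    move=> x /= Hx; apply: NE => /= H; apply: Hx => _.
    by rewrite -(H I) -/f -[in LHS]fE.
Qed.

(** The integral of [u] may be infinite, so only the positive and negative parts
can be compared. *)
Lemma le_integral_minorant (u : T -> \bar R) (v : T -> \bar R) :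
  measurable_fun setT u -> P.-integrable setT v ->
  {ae P, forall x, v x <= u x} -> \int[P]_x v x <= \int[P]_x u x.
Proof.
move=> mu iv vu; rewrite [X in X <= _]integralE [X in _ <= X]integralE.
have mv := measurable_int _ iv.
apply: leeB.
- apply: ae_ge0_le_integral => //; try exact: measurable_funepos.
  case: vu => N [mN N0 NE]; exists N; split => //.
  move=> x /= Hx; apply: NE => /= H; apply: Hx => _; by rewrite !funeposE ge_max !le_max H // lexx orbT.
- apply: ae_ge0_le_integral => //; try exact: measurable_funeneg.
  case: vu => N [mN N0 NE]; exists N; split => //.
  move=> x /= Hx; apply: NE => /= H; apply: Hx => _; by rewrite !funenegE ge_max !le_max leeN2 H // lexx orbT.
Qed.

(** With [c = log E_Q (exp g)] and [r] the density of [P], the concavity bound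
[log r >= g - c + 1 - exp (g - c) / r] holds, and the last term has [P]-mean at
most [1]. *)
Lemma KL_ge (g : T -> R) : bm g ->
  (mean P g - ln (mean Q (fun x => expR (g x))))%:E <= KL P Q.
Proof.
move=> bg; have [PQ|nPQ] := pselect (P `<< Q); last first.
  by rewrite /KL asboolF// leey.
have [r [mr r0 rE ->]] := RN_real PQ.
set c := ln _.
have beg := bm_expR bg.
have c0 : (0 < mean Q (fun x => expR (g x)))%R.
  have [_ [B Bg]] := bg.
  apply: lt_le_trans (_ : (expR (- B) <= _)%R); first exact: expR_gt0.
  rewrite -[leLHS](mean_cst Q); apply: mean_le => //; first exact: bm_cst.
  by move=> x; rewrite ler_expR; move: (Bg x); rewrite ler_norml => /andP[].
pose w x : R := (expR (g x - c) / r x)%R.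
have w0 x : (0 <= w x)%R by rewrite /w divr_ge0// expR_ge0.
have mw : measurable_fun setT w.
  apply: measurable_funM; last exact: measurable_inv_fun.
  apply: measurableT_comp => //; apply: measurable_funB => //.
  by case: bg.
have w1 : \int[P]_x (w x)%:E <= 1.
  rewrite -rE//; last exact/measurable_EFinP.
  apply: (@le_trans _ _ (\int[Q]_x (expR (g x - c))%:E)).
    apply: ge0_le_integral => //.
    - by move=> x _; rewrite mule_ge0// lee_fin.
    - by apply/measurable_EFinP; apply: measurable_funM.
    - apply/measurable_EFinP; apply: measurableT_comp => //.
      by apply: measurable_funB => //; case: bg.
    - move=> x _; rewrite -EFinM lee_fin /w.
      have [->|rx] := eqVneq (r x) 0%R; first by rewrite mulr0 expR_ge0.
      by rewrite divfK.
  rewrite meanE; last by apply: bm_expR; apply: bmB => //; exact: bm_cst.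
  under [X in mean _ X]eq_fun do rewrite expRD.
  by rewrite meanZr// /c expRN lnK ?posrE// divff// gt_eqF.
have iw : P.-integrable setT (EFin \o w).
  apply/integrableP; split; first exact/measurable_EFinP.
  under eq_integral do rewrite /= ger0_norm//.
  by rewrite (le_lt_trans w1)// ltry.
pose v x : R := (g x - c + 1 - w x)%R.
have b1 : bm (fun x => g x - c + 1)%R.
  by apply: bmD; [apply: bmB => //; exact: bm_cst|exact: bm_cst].
have iv : P.-integrable setT (EFin \o v).
  rewrite (_ : EFin \o v = (EFin \o (fun x => g x - c + 1)%R) \- (EFin \o w)).
    by apply: integrableB => //; exact: bm_integrable.
  by [].
apply: (@le_trans _ _ (\int[P]_x (v x)%:E)).
  under eq_integral do rewrite EFinB.
  rewrite integralB//; [|exact: bm_integrable].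
  rewrite meanE// meanD//; [|apply: bmB => //; exact: bm_cst|exact: bm_cst].
  rewrite meanB//; [|exact: bm_cst]; rewrite !mean_cst.
  have W1 := fineK (integrable_fin_num measurableT iw).
  move: w1; rewrite -W1 lee_fin => w1.
  by rewrite -W1 -EFinB lee_fin; lra.
apply: le_integral_minorant => //.
  by apply: measurable_lne; exact/measurable_EFinP.
pose N := [set x | r x = 0%R].
have mN : measurable N.
  by rewrite (_ : N = r @^-1` [set 0%R])// -[X in measurable X]setTI; exact: mr.
exists N; split => //.
  have := rE (EFin \o \1_N); rewrite integral_indic// setIT => <- //.
  - by rewrite integral0_eq// => x _; rewrite /= -EFinM indicE; case: (boolP (x \in N));
      rewrite ?mul0r// inE => ->; rewrite mulr0.
  - by move=> x; rewrite lee_fin indicE.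
  - exact/measurable_EFinP/measurable_indic.
move=> x /= Hx; apply: contrapT => rx; apply: Hx.
have {}rx : (0 < r x)%R by rewrite lt_neqAle r0 andbT eq_sym; exact/eqP.
rewrite [(r x <= 0)%R]leNgt rx /= lee_fin /v.
have := expR_ge1Dx (g x - c - ln (r x)).
by rewrite [expR _]expRB lnK ?posrE// -/(w x); lra.
Qed.

Lemma KL_ge0 : 0 <= KL P Q.
Proof.
have := KL_ge (bm_cst 0); rewrite mean_cst.
by under [X in mean _ X]eq_fun do rewrite expR0; rewrite mean_cst ln1 subr0.
Qed.

(** Without absolute continuity, large multiples of the indicator of a [Q]-null
set do.  Otherwise let the density [r] be cut off at [1/B] and [B].  Its logarithm
has [P]-mean close to the divergence, since the positive part increases to that
of [log r] and the negative part is below that of [log r], while its [Q]-mean is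
at most [1 + 1/B]. *)
Lemma KL_gt_test (a : R) : a%:E < KL P Q ->
  exists2 g : T -> R, bm g & (a < mean P g - ln (mean Q (fun x => expR (g x))))%R.
Proof.
have [PQ|nPQ] := pselect (P `<< Q); last first.
  move=> _.
  have [A [mA QA PA]] : exists A, [/\ measurable A, Q A = 0 & P A != 0].
    apply: contrapT => H; apply: nPQ; apply/null_content_dominatesP => A mA QA.
    by apply: contrapT => /eqP PA; apply: H; exists A.
  pose p := mean P \1_A.
  have p0 : (0 < p)%R.
    rewrite lt_neqAle mean_ge0 ?andbT; last by move=> x; rewrite indicE.
    by apply: contra PA => /eqP E; rewrite -mean_indic// -/p -E.
  exists (fun x => (`|a| + 1) / p * \1_A x)%R.
    by apply: bmM; [exact: bm_cst|exact: bm_indic].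
  rewrite meanZl; last exact: bm_indic.
  rewrite -/p divfK ?gt_eqF//.
  rewrite (_ : (fun x => expR _) =
    (fun x => 1 + (expR ((`|a| + 1) / p) - 1) * \1_A x)%R); last first.
    apply/funext => x; rewrite indicE; case: (x \in A).
      by rewrite !mulr1 addrCA subrr addr0.
    by rewrite !mulr0 expR0 addr0.
  rewrite meanD; [|exact: bm_cst|by apply: bmM; [exact: bm_cst|exact: bm_indic]].
  rewrite meanZl; last exact: bm_indic.
  have -> : mean Q \1_A = 0%R by apply: EFin_inj; rewrite mean_indic.
  rewrite mulr0 addr0 mean_cst ln1 subr0.
  by rewrite (le_lt_trans (ler_norm _))// ltrDl.
have [r [mr r0 rE ->]] := RN_real PQ.
set u := fun x => lne (r x)%:E.
have mu : measurable_fun setT u by apply: measurable_lne; exact/measurable_EFinP.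
rewrite integralE => H.
(* the difference of the two parts exceeds [a], so the second is finite *)
have neg_fin : \int[P]_x u^\- x \is a fin_num.
  rewrite ge0_fin_numE; last exact: integral_ge0.
  rewrite ltNge leye_eq; apply/negP => /eqP E; move: H; rewrite E /=.
  by rewrite addeNy.
pose v := fine (\int[P]_x u^\- x).
have [e e0 He] : exists2 e : R, (0 < e)%R & (a + v + e)%:E < \int[P]_x u^\+ x.
  move: H; rewrite -(fineK neg_fin) -/v lteBrDr// -EFinD.
  case E : (\int[P]_x u^\+ x) => [z| |] //.
    rewrite lte_fin => h; exists ((z - (a + v)) / 2)%R; first by lra.
    by rewrite lte_fin; lra.
  by move=> _; exists 1%R => //; rewrite ltry.
pose B (n : nat) : R := n.+1%:R.
have B1 n : (1 <= B n)%R by rewrite /B ler1n.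
have B0 n : (0 < B n)%R by rewrite /B ltr0n.
pose cl n x : R := Num.max (B n)^-1%R (Num.min (r x) (B n)).
have clB n x : ((B n)^-1 <= cl n x)%R by rewrite /cl le_max lexx.
have clU n x : (cl n x <= B n)%R.
  by rewrite /cl ge_max ge_min lexx orbT andbT (le_trans _ (B1 n))// invf_le1.
have clr n x : (cl n x <= r x + (B n)^-1)%R.
  rewrite /cl ge_max lerDr r0/= ge_min; apply/orP; left.
  by rewrite lerDl invr_ge0 ltW.
have bcl n : bm (cl n).
  split; first by apply: measurable_maxr => //; exact: measurable_minr.
  exists (B n) => x; rewrite ger0_norm// (le_trans _ (clB n x))// invr_ge0 ltW//.
pose g n x := ln (cl n x).
have bg n : bm (g n).
  by apply: (@bm_ln _ _ _ _ (B n)^-1%R) => //; rewrite invr_gt0.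
have cl0 n x : (0 < cl n x)%R by apply: lt_le_trans (clB n x); rewrite invr_gt0.
have mQ n : (ln (mean Q (fun x => expR (g n x))) <= (B n)^-1)%R.
  under [X in mean _ X]eq_fun do rewrite lnK ?posrE//.
  have m1 : (mean Q (cl n) <= 1 + (B n)^-1)%R.
    rewrite -lee_fin -meanE//.
    apply: (@le_trans _ _ (\int[Q]_x ((r x)%:E + ((B n)^-1)%R%:E))).
      apply: ge0_le_integral => //.
      - by move=> x _; rewrite lee_fin ltW.
      - by apply/measurable_EFinP; case: (bcl n).
      - by apply: emeasurable_funD => //; exact/measurable_EFinP.
      - by move=> x _; rewrite -EFinD lee_fin.
    rewrite ge0_integralD//.
    - rewrite EFinD integral_prob_cst leeD2r//.
      suff -> : \int[Q]_x (r x)%:E = 1 by [].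
      rewrite -(integral_prob_cst P 1) -(rE (fun=> 1%:E)) => [|x|]; last first.
      - exact: measurable_cst.
      - by rewrite lee_fin.
      by apply: eq_integral => x _; rewrite mul1e.
    - by move=> x _; rewrite lee_fin.
    - exact/measurable_EFinP.
    - by move=> x _; rewrite lee_fin invr_ge0 ltW.
  apply: (@le_trans _ _ (ln (1 + (B n)^-1))).
    rewrite ler_ln ?posrE//; last by rewrite addr_gt0// invr_gt0.
    apply: lt_le_trans (_ : ((B n)^-1 <= _)%R); first by rewrite invr_gt0.
    rewrite -(mean_cst Q (B n)^-1%R); apply: mean_le => //; exact: bm_cst.
  by apply: le_ln1Dx; rewrite (lt_trans (ltrN10 _))// invr_gt0.
have BS n : (B n <= B n.+1)%R by rewrite /B ler_nat.
have iB1 n : ((B n)^-1 <= 1)%R by rewrite invf_le1.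
have nd x : nondecreasing_seq (fun n => Num.max (g n x) 0%R).
  apply/nondecreasing_seqP => n; rewrite ge_max !le_max lexx orbT andbT.
  apply/orP; have [c1|c1] := leP (cl n x) 1%R; [right|left].
    by rewrite ln_le0.
  rewrite ler_ln ?posrE//; move: c1; rewrite /cl lt_max ltNge iB1/= => c1.
  rewrite ge_max !le_max; apply/andP; split.
    apply/orP; right; rewrite (le_trans (iB1 n))// (le_trans (ltW c1))//.
    by rewrite le_min !ge_min lexx BS orbT.
  by apply/orP; right; rewrite le_min !ge_min lexx BS orbT.
have upos x : (r x <= 1)%R -> u^\+ x = 0.
  move=> rx; rewrite funeposE; apply/max_idPr; rewrite /u lne_le0.
  by rewrite lee_fin.
have cv x : (Num.max (g n x) 0)%:E @[n --> \oo] --> u^\+ x.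
  have [rx|rx] := leP (r x) 1%R.
    rewrite upos//; rewrite (_ : (fun n => _) = fun=> 0); first exact: cvg_cst.
    apply/funext => n; congr EFin; apply/max_idPr; apply: ln_le0.
    by rewrite /cl ge_max iB1 ge_min rx.
  apply: cvg_near_cst; near=> n.
  have rB : (r x <= B n)%R.
    rewrite (@le_trans _ _ n%:R)//; last by rewrite ler_nat.
    by near: n; exact: nbhs_infty_ger.
  have -> : g n x = ln (r x).
    congr ln; rewrite /cl (min_idPl rB); apply/max_idPr.
    by rewrite (le_trans (iB1 n))// ltW.
  rewrite funeposE /u lne_EFin ?(lt_trans _ rx)//.
  by rewrite -EFin_max.
have mg n : measurable_fun setT (fun x => Num.max (g n x) 0%R).
  by apply: measurable_maxr => //; case: (bg n).
have cvI : \int[P]_x (Num.max (g n x) 0)%:E @[n --> \oo] --> \int[P]_x u^\+ x.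
  rewrite (_ : \int[P]_x u^\+ x = \int[P]_x limn (fun n => (Num.max (g n x) 0)%:E)); last first.
    by apply: eq_integral => x _; apply/esym/cvg_lim => //; exact: cv.
  apply: (@cvg_monotone_convergence _ _ _ P setT measurableT
    (fun n x => (Num.max (g n x) 0)%:E)).
  - by move=> n; exact/measurable_EFinP.
  - by move=> n x _; rewrite lee_fin le_max lexx orbT.
  - by move=> x _ m n mn; rewrite lee_fin; exact: nd.
have gneg n x : (Num.max (- g n x) 0)%:E <= u^\- x.
  have u0 : 0 <= u^\- x by rewrite funenegE le_max lexx orbT.
  have [c1|c1] := leP 1%R (cl n x).
    by rewrite (max_idPr _)// oppr_le0 ln_ge0.
  have rc : (r x <= cl n x)%R.
    move: c1; rewrite /cl gt_max => /andP[_ c1].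
    rewrite le_max le_min lexx/=; apply/orP; right.
    move: c1; rewrite gt_min => /orP[c1|]; last by rewrite ltNge B1.
    by rewrite (le_trans (ltW c1)).
  rewrite funenegE /u le_max; apply/orP; left.
  have [rx|rx] := eqVneq (r x) 0%R.
    by rewrite le0_lneNy ?rx// leey.
  have rx0 : (0 < r x)%R by rewrite lt_neqAle eq_sym rx r0.
  rewrite lne_EFin// -EFinN lee_fin ge_max lerN2 ler_ln ?posrE// rc/=.
  by rewrite oppr_ge0 ln_le0// (le_trans rc)// ltW.
have [n [Hn1 Hn2]] : exists n, (a + v + e)%:E < \int[P]_x (Num.max (g n x) 0)%:E /\
    ((B n)^-1 < e)%R.
  near \oo => n; exists n; split.
    near: n; exact: cvI (open_ereal_gt' He).
  near: n; exact: near_infty_natSinv_lt (PosNum e0).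
exists (g n) => //.
have bp : bm (fun x => Num.max (g n x) 0%R).
  split => //; have [_ [M Mg]] := bg n; exists M => x.
  rewrite ger0_norm ?le_max ?lexx ?orbT// ge_max (le_trans (ler_norm _) (Mg x))/=.
  by rewrite (le_trans _ (Mg x)).
have bn : bm (fun x => Num.max (- g n x)%R 0%R).
  split; first by apply: measurable_maxr => //; apply: measurableT_comp => //; case: (bg n).
  have [_ [M Mg]] := bg n; exists M => x.
  rewrite ger0_norm ?le_max ?lexx ?orbT// ge_max (le_trans (ler_norm _) _)/= ?normrN ?Mg//.
  by rewrite (le_trans _ (Mg x)).
have E : mean P (g n) = (mean P (fun x => Num.max (g n x) 0%R) - mean P (fun x => Num.max (- g n x)%R 0%R))%R.
  rewrite -meanB//; congr mean; apply/funext => x.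
  have [h|h] := leP 0%R (g n x); rewrite ?(max_idPl h).
    by rewrite (max_idPr _) ?subr0// oppr_le0.
  by rewrite (max_idPl _) ?sub0r ?opprK// oppr_ge0 ltW.
have h1 : (mean P (fun x => Num.max (- g n x)%R 0%R) <= v)%R.
  rewrite -lee_fin -meanE// /v fineK//; apply: ge0_le_integral => //.
  - by move=> x _; rewrite lee_fin le_max lexx orbT.
  - by apply/measurable_EFinP; case: bn.
  - exact: measurable_funeneg.
move: Hn1; rewrite meanE// lte_fin => Hn1.
rewrite E; move: h1 Hn1 Hn2 (mQ n); clear.
move: (mean P _) (mean P _) (ln _) ((B n)^-1)%R => x1 x2 x3 x4.
lra.
Unshelve. all: end_near. Qed.

End kl_variational.

(** * Test functions of sequences and prediction operators *)

Section kernel_pullback.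
Context {d1 d2 d3} {S : measurableType d1} {T : measurableType d2}
  {Y : measurableType d3} {R : realType}.
Variables (k : R.-pker T ~> Y) (u : S -> T).

Definition kernel_pullback (mu : measurable_fun [set: S] u) (x : S) :
  {measure set Y -> \bar R} := k (u x).

Hypothesis mu : measurable_fun [set: S] u.

Let measurable_kernel_pullback U : measurable U ->
  measurable_fun [set: S] (kernel_pullback mu ^~ U).
Proof.
by move=> mU; apply: (measurableT_comp (measurable_kernel k U mU) mu).
Qed.

HB.instance Definition _ := isKernel.Build _ _ _ _ _ (kernel_pullback mu)
  measurable_kernel_pullback.

Let kernel_pullback_prob x : kernel_pullback mu x [set: Y] = 1%E.
Proof. exact: prob_kernel. Qed.

HB.instance Definition _ := Kernel_isProbability.Build _ _ _ _ _
  (kernel_pullback mu) kernel_pullback_prob.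

Lemma bm_mean_pullback (f : S * Y -> R) : bm f ->
  bm (fun s => mean (kernel_at k (u s)) (fun y => f (s, y))).
Proof. exact: (@bm_mean_kernel _ _ _ _ _ (kernel_pullback mu)). Qed.

End kernel_pullback.

Section tuple_measurability.
Context {d d'} {T : measurableType d} {X : measurableType d'}.

Lemma measurable_rcons (f : T -> X) n (g : T -> n.-tuple X) :
  measurable_fun [set: T] f -> measurable_fun [set: T] g ->
  measurable_fun [set: T] (fun x => [tuple of rcons (g x) (f x)]).
Proof.
move=> mf mg; apply/measurable_fun_tnthP => i.
have [i_n|n_i] := ltnP i n.
  rewrite (_ : _ \o _ = fun x => tnth (g x) (Ordinal i_n)).
    apply: (@measurableT_comp _ _ _ _ _ _ (fun x => tnth x (Ordinal i_n))) => //.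
    exact: measurable_tnth.
  apply/funext => x /=; rewrite (tnth_nth (f x)) /= nth_rcons size_tuple i_n.
  by rewrite (tnth_nth (f x)).
rewrite (_ : _ \o _ = f)//; apply/funext => x /=.
rewrite (tnth_nth (f x)) /= nth_rcons size_tuple ltnNge n_i /=.
by case: ifP.
Qed.

Lemma measurable_reindex L m (s : 'I_m -> 'I_L) :
  measurable_fun [set: L.-tuple X] (fun t => [tuple tnth t (s i) | i < m]).
Proof.
apply/measurable_fun_tnthP => i.
rewrite (_ : _ \o _ = fun t => tnth t (s i)); first exact: measurable_tnth.
by apply/funext => t /=; rewrite tnth_mktuple.
Qed.

End tuple_measurability.

Section nice.
Context {d} {X : measurableType d} {R : realType}.
Implicit Types f g : seq X -> R.

(** A function of sequences stands for its restrictions to all powers of the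
space at once, so that prepending and appending observations needs no cast
between tuple types; the bound may depend on the length. *)
Definition nice f := forall L, bm (fun t : L.-tuple X => f t).

Lemma nice_cst c : nice (fun=> c). Proof. by move=> L; exact: bm_cst. Qed.
Lemma niceD f g : nice f -> nice g -> nice (fun s => f s + g s).
Proof. by move=> nf ng L; exact: bmD. Qed.
Lemma niceN f : nice f -> nice (fun s => - f s).
Proof. by move=> nf L; exact: bmN. Qed.
Lemma niceB f g : nice f -> nice g -> nice (fun s => f s - g s).
Proof. by move=> nf ng L; exact: bmB. Qed.
Lemma niceM f g : nice f -> nice g -> nice (fun s => f s * g s).
Proof. by move=> nf ng L; exact: bmM. Qed.
Lemma nice_sum I (r : seq I) (P : pred I) (F : I -> seq X -> R) :
  (forall i, P i -> nice (F i)) -> nice (fun x => \sum_(i <- r | P i) F i x).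
Proof. by move=> nF L; apply: bm_sum => i Pi; exact: nF. Qed.
Lemma nice_expR f : nice f -> nice (fun s => expR (f s)).
Proof. by move=> nf L; exact: bm_expR. Qed.

(** Sequence operations that pick entries at places fixed by the length; they are
measurable on each power. *)
Definition selector (phi : seq X -> seq X) := forall L,
  exists m (s : 'I_m -> 'I_L), forall t : L.-tuple X,
    phi t = [tuple tnth t (s i) | i < m].

Lemma nice_selector f phi : selector phi -> nice f -> nice (fun s => f (phi s)).
Proof.
move=> H nf L; have [m [s ps]] := H L.
apply: bm_ext (bm_comp (measurable_reindex s) (nf m)) => t /=.
by rewrite ps.
Qed.

Lemma selector_drop j : selector (drop j).
Proof.
move=> L.
have H (i : 'I_(L - j)) : (j + i < L)%N by have := ltn_ord i; lia.
exists (L - j)%N, (fun i => Ordinal (H i)) => t.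
case: L H t => [|L] H t.
  by apply: etrans (size0nil _) (esym (size0nil _)); rewrite ?size_drop size_tuple.
have x0 := thead t.
apply: (@eq_from_nth _ x0); first by rewrite size_drop !size_tuple.
move=> i; rewrite size_drop size_tuple => iL.
rewrite nth_drop -[i]/(nat_of_ord (Ordinal iL)) -!tnth_nth tnth_mktuple.
by rewrite (tnth_nth x0).
Qed.

Lemma selector_take j : selector (take j).
Proof.
move=> L.
have H (i : 'I_(minn j L)) : (i < L)%N by have := ltn_ord i; lia.
exists (minn j L), (fun i => Ordinal (H i)) => t.
case: L H t => [|L] H t.
  by apply: etrans (size0nil _) (esym (size0nil _));
    rewrite ?size_take_min size_tuple minn0.
have x0 := thead t.
have sz : size (take j t) = minn j L.+1 by rewrite size_take_min size_tuple.
apply: (@eq_from_nth _ x0); first by rewrite sz size_tuple.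
move=> i; rewrite sz => iL.
rewrite nth_take; last by move: iL; rewrite leq_min => /andP[].
rewrite -[i in RHS]/(nat_of_ord (Ordinal iL)) -!tnth_nth tnth_mktuple.
by rewrite (tnth_nth x0).
Qed.

Lemma nice_drop f j : nice f -> nice (fun s => f (drop j s)).
Proof. by apply: nice_selector; exact: selector_drop. Qed.

Lemma nice_take f j : nice f -> nice (fun s => f (take j s)).
Proof. by apply: nice_selector; exact: selector_take. Qed.

Definition drop_last (s : seq X) := take (size s).-1 s.

Lemma drop_last_rcons s x : drop_last (rcons s x) = s.
Proof. by rewrite /drop_last size_rcons /= -cats1 take_size_cat. Qed.

Lemma nice_drop_last f : nice f -> nice (fun s => f (drop_last s)).
Proof.
apply: nice_selector => L; have [m [s sE]] := selector_take L.-1 L.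
by exists m, s => t; rewrite /drop_last size_tuple sE.
Qed.

Lemma nice_ext f g : (forall s, f s = g s) -> nice f -> nice g.
Proof. by move=> fg nf L; apply: bm_ext (nf L) => t. Qed.

Lemma nice_if_size f g (p : nat -> bool) : nice f -> nice g ->
  nice (fun s => if p (size s) then f s else g s).
Proof.
move=> nf ng L; case pL: (p L); [apply: bm_ext (nf L)|apply: bm_ext (ng L)];
  by move=> t; rewrite size_tuple pL.
Qed.

Lemma nice_inv f (c : nat -> R) : (forall L, 0 < c L) ->
  (forall s, c (size s) <= f s) -> nice f -> nice (fun s => (f s)^-1).
Proof.
move=> c0 cf nf L; apply: (bm_inv (c0 L)) => // t.
by have := cf t; rewrite size_tuple.
Qed.

Lemma nice_ln f (c : nat -> R) : (forall L, 0 < c L) ->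
  (forall s, c (size s) <= f s) -> nice f -> nice (fun s => ln (f s)).
Proof.
move=> c0 cf nf L; apply: (bm_ln (c0 L)) => // t.
by have := cf t; rewrite size_tuple.
Qed.

Lemma bm_cons_joint f L : nice f ->
  bm (fun p : X * L.-tuple X => f (p.1 :: p.2)).
Proof.
move=> nf; apply: (@bm_comp _ _ _ _ _ (fun p : X * L.-tuple X =>
  [tuple of p.1 :: p.2]) (fun t => f t)) => //.
exact: measurable_cons.
Qed.

Lemma bm_rcons_joint f L : nice f ->
  bm (fun p : L.-tuple X * X => f (rcons p.1 p.2)).
Proof.
move=> nf; apply: (@bm_comp _ _ _ _ _ (fun p : L.-tuple X * X =>
  [tuple of rcons p.1 p.2]) (fun t => f t)) => //.
exact: measurable_rcons.
Qed.

Lemma bm_cons_rcons_joint f s : nice f ->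
  bm (fun p : X * X => f (p.1 :: rcons s p.2)).
Proof.
move=> nf; apply: (@bm_comp _ _ _ _ _ (fun p : X * X =>
  [tuple of p.1 :: [tuple of rcons (in_tuple s) p.2]]) (fun t => f t)) => //.
by apply: measurable_cons => //; exact: measurable_rcons.
Qed.

Lemma bm_cons f s : nice f -> bm (fun x => f (x :: s)).
Proof.
by move=> nf; apply: (bm_section2 (in_tuple s) (bm_cons_joint (size s) nf)).
Qed.

Lemma bm_rcons f s : nice f -> bm (fun x => f (rcons s x)).
Proof.
by move=> nf; apply: (bm_section (in_tuple s) (bm_rcons_joint (size s) nf)).
Qed.

Lemma nice_cons f x : nice f -> nice (fun s => f (x :: s)).
Proof. by move=> nf L; exact: (bm_section x (bm_cons_joint L nf)). Qed.

Lemma nice_bounded f L : nice f -> exists2 B : R, 0 < B &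
  forall s, size s = L -> `|f s| <= B.
Proof.
move=> /(_ L) [_ [B Bf]]; exists (`|B| + 1); first by rewrite ltr_wpDl.
move=> s sL; have := Bf (Tuple (introT eqP sL)); rewrite /= => h.
by rewrite (le_trans h)// (le_trans (ler_norm _))// lerDl.
Qed.

End nice.

Lemma bm_mean_const {d d'} {T : measurableType d} {Y : measurableType d'}
  {R : realType} (mu : probability Y R) (f : T * Y -> R) : bm f ->
  bm (fun t => mean mu (fun y => f (t, y))).
Proof.
exact: (@bm_mean_kernel _ _ _ _ _
  (kprobability (measurable_cst (mu : pprobability Y R)))).
Qed.

Section operators.
Context {d} {X : measurableType d} {R : realType}.
Implicit Types f g : seq X -> R.

(** Integrating out the first observation ([prep]) or the last one ([app]), both
distributed as [mu].  The two commute, by Fubini, and so does [prep] with the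
prediction step below. *)
Section prepend_append.
Variable mu : probability X R.

Definition prep f (s : seq X) : R := mean mu (fun x => f (x :: s)).
Definition app f (s : seq X) : R := mean mu (fun x => f (rcons s x)).

Lemma nice_prep f : nice f -> nice (prep f).
Proof.
move=> nf L.
apply: (@bm_mean_const _ _ _ _ _ mu (fun p : L.-tuple X * X => f (p.2 :: p.1))).
apply: (@bm_comp _ _ _ _ _ (fun p : L.-tuple X * X =>
  [tuple of p.2 :: p.1]) (fun t => f t)) => //.
exact: measurable_cons.
Qed.

Lemma nice_app f : nice f -> nice (app f).
Proof. by move=> nf L; apply: (bm_mean_const mu (bm_rcons_joint L nf)). Qed.

Lemma prepD f g s : nice f -> nice g ->
  prep (fun s => f s + g s) s = prep f s + prep g s.
Proof. by move=> nf ng; apply: meanD; exact: bm_cons. Qed.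

Lemma prep_le f g s : nice f -> nice g ->
  (forall x, f (x :: s) <= g (x :: s)) -> prep f s <= prep g s.
Proof. by move=> nf ng fg; apply: mean_le => //; exact: bm_cons. Qed.

Lemma prep_app_comm f s : nice f -> prep (app f) s = app (prep f) s.
Proof.
by move=> nf; have [E _] := mean_swap mu mu (bm_cons_rcons_joint s nf); exact: E.
Qed.

Lemma nice_iter_prep j f : nice f -> nice (iter j prep f).
Proof. by move=> nf; elim: j => //= j; exact: nice_prep. Qed.

Lemma iter_prep_app_nil L f : nice f -> iter L prep f [::] = iter L app f [::].
Proof.
have C M g s : nice g -> iter M prep (app g) s = app (iter M prep g) s.
  elim: M g s => // M IHM g s ng.
  have E : prep (app g) = app (prep g) by apply/funext => t; exact: prep_app_comm.
  by rewrite iterSr [in RHS]iterSr E IHM//; exact: nice_prep.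
elim: L f => // L IH f nf.
transitivity (iter L prep (app f) [::]); first by rewrite C.
by rewrite (IH _ (nice_app nf)) iterSr.
Qed.

End prepend_append.

Section kernel_step.
Variables (n : nat) (K : R.-pker (n.-tuple X) ~> X).

(** The predictor looks at the last [n] entries.  Shorter sequences have no
window; there [step] is the identity, which keeps it monotone and unital. *)
Definition window (s : seq X) : option (n.-tuple X) :=
  insub (drop (size s - n) s).

Definition step f (s : seq X) : R :=
  if window s is Some w then mean (kernel_at K w) (fun y => f (rcons s y)) else f s.

Lemma windowP s : (n <= size s)%N -> exists2 w : n.-tuple X,
  window s = Some w & tval w = drop (size s - n) s.
Proof.
move=> ns; rewrite /window; case: insubP => [w _ <-|]; first by exists w.
by rewrite size_drop subKn// eqxx.
Qed.

Lemma nice_step f : nice f -> nice (step f).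
Proof.
move=> nf L; have [nL|Ln] := leqP n L; last first.
  apply: bm_ext (nf L) => t; rewrite /step.
  by rewrite /window insubF// size_drop size_tuple; apply/negbTE; lia.
have sz (t : L.-tuple X) : size (drop (L - n) t) == n.
  by rewrite size_drop size_tuple subKn.
pose u (t : L.-tuple X) : n.-tuple X := Tuple (sz t).
have mu : measurable_fun setT u.
  apply/measurable_fun_tnthP => i.
  have H : (L - n + i < L)%N by have := ltn_ord i; lia.
  rewrite (_ : _ \o _ = fun t : L.-tuple X => tnth t (Ordinal H)).
    exact: measurable_tnth.
  apply/funext => t /=; have x0 := tnth (u t) i.
  by rewrite !(tnth_nth x0) /= nth_drop.
apply: bm_ext (bm_mean_pullback K mu (bm_rcons_joint L nf)) => t /=.
rewrite /step /window size_tuple; case: insubP => [w _ wE|]; last by rewrite sz.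
by congr mean; congr kernel_at; exact: val_inj.
Qed.

Lemma step_cst c s : step (fun=> c) s = c.
Proof. by rewrite /step; case: (window s) => // w; rewrite mean_cst. Qed.

Lemma step_le f g s : nice f -> nice g -> f s <= g s ->
  (forall y, f (rcons s y) <= g (rcons s y)) -> step f s <= step g s.
Proof.
move=> nf ng fgs fg; rewrite /step; case: (window s) => // w.
by apply: mean_le => //; exact: bm_rcons.
Qed.

Lemma stepD f g s : nice f -> nice g ->
  step (fun s => f s + g s) s = step f s + step g s.
Proof.
move=> nf ng; rewrite /step; case: (window s) => [w|//].
by apply: meanD; exact: bm_rcons.
Qed.

Lemma step_drop_last f g s : nice f -> (n <= size s)%N ->
  step (fun s => g (drop_last s) * f s) s = g s * step f s.
Proof.
move=> nf /windowP[w wE _]; rewrite /step wE.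
by under eq_fun do rewrite drop_last_rcons; rewrite meanZl//; exact: bm_rcons.
Qed.

Lemma step_ext f g s : (n <= size s)%N -> (forall y, f (rcons s y) = g (rcons s y)) ->
  step f s = step g s.
Proof.
move=> /windowP[w wE _] fg; rewrite /step wE.
by congr mean; apply/funext => y.
Qed.

Lemma prep_step (mu : probability X R) f s : nice f -> (n <= size s)%N ->
  prep mu (step f) s = step (prep mu f) s.
Proof.
move=> nf ns; have [w wE _] := windowP ns.
have wE' x : window (x :: s) = Some w.
  rewrite -wE /window /= subSn//=.
rewrite [RHS]/step wE /prep; under eq_fun do rewrite /step wE'.
have [E _] := mean_swap mu (kernel_at K w) (bm_cons_rcons_joint s nf).
exact: E.
Qed.

End kernel_step.
End operators.

(** * Entropy and prediction for mixtures of hidden paths *)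

Section more_nice.
Context {d} {X : measurableType d} {R : realType}.
Implicit Types f g : seq X -> R.

Lemma nice_behead f : nice f -> nice (fun s => f (behead s)).
Proof.
move=> nf; apply: nice_ext (nice_drop 1 nf) => s.
by rewrite drop1.
Qed.

Lemma ln_le_sub1 (x : R) : 0 < x -> ln x <= x - 1.
Proof.
move=> x0; have := @le_ln1Dx R (x - 1); rewrite addrCA subrr addr0; apply.
by rewrite ltrBDr addNr.
Qed.

Lemma measurable_pos_indic {d'} {T : measurableType d'} (b : T -> R) :
  measurable_fun setT b -> measurable_fun setT (fun x => (((0 < b x)%R)%:R : R)).
Proof.
move=> mb; rewrite (_ : (fun x => _) = fun x => if 0 < b x then 1 else 0).
  by apply: measurable_fun_ifT => //; exact: measurable_fun_ltr.
by apply/funext => x; case: ifP.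
Qed.

Lemma nice_ratio f g (c : nat -> R) : nice f -> nice g -> (forall s, 0 <= f s) ->
  (forall s, 0 <= g s) -> (forall s, f s <= c (size s) * g s) ->
  nice (fun s => f s / g s).
Proof.
move=> nf ng f0 g0 fg L; split.
  apply: measurable_funM; first by case: (nf L).
  by apply: measurable_inv_fun => //; case: (ng L).
exists `|c L| => t; rewrite ger0_norm ?divr_ge0//.
have [E|gt] := eqVneq (g t) 0; first by rewrite E invr0 mulr0.
have gt0 : 0 < g t by rewrite lt_neqAle eq_sym gt g0.
rewrite ler_pdivrMr// (le_trans (fg t))// size_tuple.
by rewrite ler_wpM2r// ler_norm.
Qed.

Lemma nice_bound_fun f : nice f -> exists B : nat -> R,
  forall s, 0 < B (size s) /\ `|f s| <= B (size s).
Proof.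
move=> nf.
have H L : exists B : R, 0 < B /\ forall s, size s = L -> `|f s| <= B.
  by have [B B0 HB] := nice_bounded L nf; exists B.
have [B HB] := choice H; exists B => s.
by have [B0 Bs] := HB (size s); split => //; exact: Bs.
Qed.

Lemma nice_pos_indic f : nice f -> nice (fun s => ((0 < f s)%R)%:R : R).
Proof.
move=> nf L; split; first by apply: measurable_pos_indic; case: (nf L).
by exists 1 => t; case: (0 < _); rewrite ?normr1 ?normr0.
Qed.

Lemma mul_ln_bound (p q c B : R) : 0 <= p -> p <= c * q -> 0 <= q -> q <= B -> 0 <= c ->
  `|p * ln q| <= c * (1 + B * B).
Proof.
move=> p0 pq q0 qB c0; have [E|qn0] := eqVneq q 0.
  by rewrite E ln0// mulr0 normr0 mulr_ge0// addr_ge0// mulr_ge0// -E.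
have qp : 0 < q by rewrite lt_neqAle eq_sym qn0.
rewrite normrM (ger0_norm p0).
apply: (@le_trans _ _ (c * q * `|ln q|)); first by rewrite ler_wpM2r.
rewrite -mulrA ler_wpM2l//.
have h1 : ln q < q by exact: ln_sublinear.
have h2 : - ln q <= q^-1 - 1.
  by rewrite -lnV ?posrE// ln_le_sub1// invr_gt0.
have h3 : q * (q^-1 - 1) = 1 - q by rewrite mulrBr mulr1 divff// gt_eqF.
have qB2 : q * q <= B * B by rewrite ler_pM.
rewrite -[X in X * _](ger0_norm q0) -normrM ler_norml; apply/andP; split.
  have : q * - ln q <= q * (q^-1 - 1) by rewrite ler_wpM2l.
  by rewrite h3 mulrN; nra.
by have : q * ln q <= q * q by [rewrite ler_wpM2l// ltW|]; lra.
Qed.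

Lemma nice_mul_ln f g (c : nat -> R) : nice f -> nice g -> (forall s, 0 <= f s) ->
  (forall s, 0 <= g s) -> (forall s, f s <= c (size s) * g s) ->
  nice (fun s => f s * ln (g s)).
Proof.
move=> nf ng f0 g0 fg L; split.
  apply: measurable_funM; first by case: (nf L).
  by apply: measurableT_comp => //; case: (ng L).
have [_ [B Bg]] := ng L.
exists (`|c L| * (1 + B * B)) => t; apply: mul_ln_bound => //.
  by rewrite (le_trans (fg t))// size_tuple ler_wpM2r// ler_norm.
exact: le_trans (ler_norm _) (Bg t).
Qed.

End more_nice.

Section prep_iter.
Context {d} {X : measurableType d} {R : realType}.
Variable mu : probability X R.
Implicit Types f g : seq X -> R.
Notation J := (prep mu).

Lemma iter_prep_le L f g t : nice f -> nice g ->
  (forall u, size u = L -> f (u ++ t) <= g (u ++ t)) -> iter L J f t <= iter L J g t.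
Proof.
elim: L t => [|L IH] t nf ng fg; first exact: (fg [::]).
rewrite !iterS; apply: prep_le; try exact: nice_iter_prep.
move=> x; apply: IH => // u uL.
by have := fg (rcons u x); rewrite size_rcons uL cat_rcons; exact.
Qed.

Lemma iter_prep_ext L f g t : nice f -> nice g ->
  (forall u, size u = L -> f (u ++ t) = g (u ++ t)) -> iter L J f t = iter L J g t.
Proof.
move=> nf ng fg; apply/eqP; rewrite eq_le.
by apply/andP; split; apply: iter_prep_le => // u uL; rewrite fg.
Qed.

Lemma iter_prepD L f g t : nice f -> nice g ->
  iter L J (fun s => f s + g s) t = iter L J f t + iter L J g t.
Proof.
move=> nf ng; elim: L t => // L IH t; rewrite !iterS -prepD; try exact: nice_iter_prep.
by congr (prep mu _ t); apply/funext => s; exact: IH.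
Qed.

Lemma iter_prepZ L f c t : nice f ->
  iter L J (fun s => c * f s) t = c * iter L J f t.
Proof.
move=> nf; elim: L t => // L IH t; rewrite !iterS.
rewrite /prep -meanZl; last by apply: bm_cons; exact: nice_iter_prep.
by congr mean; apply/funext => s; exact: IH.
Qed.

Lemma iter_prepN L f t : nice f ->
  iter L J (fun s => - f s) t = - iter L J f t.
Proof.
move=> nf; rewrite -mulN1r -iter_prepZ//; congr (iter L J _ t).
by apply/funext => s; rewrite mulN1r.
Qed.

Lemma iter_prepB L f g t : nice f -> nice g ->
  iter L J (fun s => f s - g s) t = iter L J f t - iter L J g t.
Proof. by move=> nf ng; rewrite iter_prepD ?iter_prepN//; exact: niceN. Qed.

Lemma iter_prep_drop j f (c : seq X -> R) t : nice f ->
  iter j J (fun s => c (drop (size s - size t) s) * f s) t = c t * iter j J f t.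
Proof.
move=> nf.
suff H i u : size u = i -> iter j J (fun s => c (drop (size s - size t) s) * f s) (u ++ t)
    = c t * iter j J f (u ++ t) by exact: (H 0 [::]).
elim: j i u => [|j IH] i u ui /=.
  by rewrite size_cat addnK drop_size_cat.
rewrite /prep -meanZl; last by apply: (bm_cons (u ++ t)); exact: nice_iter_prep.
by congr mean; apply/funext => x; rewrite -cat_cons (IH i.+1)//= ui.
Qed.

Lemma prep_step_iter n (K : R.-pker (n.-tuple X) ~> X) j f t : nice f ->
  (n <= size t)%N -> iter j J (step K f) t = step K (iter j J f) t.
Proof.
move=> nf; elim: j t => // j IH t nt; rewrite !iterS -prep_step//; last first.
  exact: nice_iter_prep.
by rewrite /prep; congr mean; apply/funext => x; rewrite IH//= leqW.
Qed.

End prep_iter.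

Section density.
Context {d} {X : measurableType d} {R : realType}.
Variables (k : nat) (pi : 'I_k -> R) (M : 'M[R]_k) (e : 'I_k -> X -> R)
  (mu : probability X R) (C : R).
Hypotheses (hM : row_stochastic M) (hpi : stationary_distribution M pi)
  (be : forall z, bm (e z)) (e0 : forall z x, 0 <= e z x)
  (eC : forall z x, e z x <= C) (C0 : 0 < C) (e1 : forall z, mean mu (e z) = 1).

(** [beta s z] is the density of the observations [s] given that the hidden chain
starts at [z], by the backward recursion; [dens] is the density under the
stationary law. *)
Fixpoint beta (s : seq X) (z : 'I_k) : R :=
  if s is x :: s' then e z x * \sum_z' M z z' * beta s' z' else 1.

Definition dens (s : seq X) : R := \sum_z pi z * beta s z.

Local Notation p := dens.

Lemma beta_ge0 s z : 0 <= beta s z.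
Proof.
elim: s z => [|x s IH] z //=; rewrite mulr_ge0// sumr_ge0// => z' _.
by rewrite mulr_ge0//; case: hM.
Qed.

Lemma nice_beta z : nice (beta ^~ z).
Proof.
move=> L; elim: L z => [|L IH] z.
  by apply: bm_ext (bm_cst 1) => t; rewrite [t]tuple0.
apply: (@bm_ext _ _ _ (fun t : L.+1.-tuple X => e z (tnth t ord0) *
    \sum_z' M z z' * beta [tuple of behead t] z')).
  by move=> t; rewrite [in RHS](tuple_eta t).
apply: bmM; first by apply: (bm_comp (measurable_tnth ord0) (be z)).
apply: bm_sum => z' _; apply: bmM; first exact: bm_cst.
apply: (bm_comp (u := fun t : L.+1.-tuple X => [tuple of behead t])
  (f := fun t : L.-tuple X => beta t z') _ (IH z')).
exact: measurable_behead.
Qed.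

Lemma pi_ge0 z : 0 <= pi z. Proof. by case: hpi. Qed.

Lemma dens_ge0 s : 0 <= p s.
Proof. by apply: sumr_ge0 => z _; rewrite mulr_ge0 ?pi_ge0 ?beta_ge0. Qed.

Lemma nice_dens : nice p.
Proof.
by apply: nice_sum => z _; apply: niceM; [exact: nice_cst|exact: nice_beta].
Qed.

Lemma dens_nil : p [::] = 1.
Proof. by rewrite /dens; under eq_bigr do rewrite mulr1; case: hpi. Qed.

(** Stationarity: integrating out the first observation leaves the law of the
others. *)
Lemma prep_dens s : prep mu p s = p s.
Proof.
rewrite /prep /dens /= mean_sum; last first.
  by move=> z _; apply: bmM; [exact: bm_cst|apply: bmM => //; exact: bm_cst].
transitivity (\sum_z pi z * \sum_z' M z z' * beta s z').
  apply: eq_bigr => z _; rewrite meanZl; last by apply: bmM => //; exact: bm_cst.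
  by rewrite meanZr// e1 mul1r.
rewrite (eq_bigr (fun z => \sum_z' pi z * (M z z' * beta s z'))); last first.
  by move=> z _; rewrite mulr_sumr.
rewrite exchange_big /=; apply: eq_bigr => z' _; have [_ _ <-] := hpi; rewrite mulr_suml.
by apply: eq_bigr => z _; rewrite mulrA.
Qed.

Lemma iter_prep_dens j s : iter j (prep mu) p s = p s.
Proof.
elim: j s => // j IH s; rewrite iterS -[RHS]prep_dens.
by rewrite /prep; congr mean; apply/funext => x; exact: IH.
Qed.

Lemma app_beta s z : app mu (beta ^~ z) s = beta s z.
Proof.
elim: s z => [|x s IH] z.
  rewrite -[RHS](e1 z); congr mean; apply/funext => x /=.
  rewrite (eq_bigr (fun z' => M z z')); first by rewrite hM.2 mulr1.
  by move=> z' _; rewrite mulr1.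
rewrite /app /= meanZl; last first.
  apply: bm_sum => z' _; apply: bmM; first exact: bm_cst.
  exact: (bm_rcons s (nice_beta z')).
rewrite mean_sum; last first.
  by move=> z' _; apply: bmM; [exact: bm_cst|exact: (bm_rcons s (nice_beta z'))].
congr (_ * _); apply: eq_bigr => z' _.
by rewrite meanZl ?IH//; [rewrite -(IH z')|exact: (bm_rcons s (nice_beta z'))].
Qed.

Lemma app_dens s : app mu p s = p s.
Proof.
rewrite /app /dens mean_sum; last first.
  by move=> z' _; apply: bmM; [exact: bm_cst|exact: (bm_rcons s (nice_beta z'))].
apply: eq_bigr => z _; rewrite meanZl; last exact: (bm_rcons s (nice_beta z)).
by rewrite -[in RHS]app_beta.
Qed.

Lemma dens_cons_le x s : p (x :: s) <= C * p s.
Proof.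
apply: (@le_trans _ _ (C * \sum_z pi z * \sum_z' M z z' * beta s z')).
  rewrite mulr_sumr; apply: ler_sum => z _ /=.
  rewrite mulrCA ler_wpM2r//.
  by rewrite mulr_ge0 ?pi_ge0// sumr_ge0// => z' _; rewrite mulr_ge0 ?beta_ge0//; case: hM.
rewrite ler_wpM2l//; first exact: ltW.
rewrite (eq_bigr (fun z => \sum_z' pi z * (M z z' * beta s z'))); last first.
  by move=> z _; rewrite mulr_sumr.
rewrite exchange_big /=; rewrite /dens; apply: ler_sum => z' _; have [_ _ <-] := hpi; rewrite mulr_suml.
by apply: ler_sum => z _; rewrite mulrA.
Qed.

Lemma beta_rcons_le s x z : beta (rcons s x) z <= C * beta s z.
Proof.
elim: s z => [|y s IH] z /=.
  under eq_bigr do rewrite mulr1; rewrite hM.2 !mulr1; exact: eC.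
rewrite mulrCA ler_wpM2l// mulr_sumr; apply: ler_sum => z' _.
by rewrite mulrCA ler_wpM2l//; case: hM.
Qed.

Lemma dens_rcons_le s x : p (rcons s x) <= C * p s.
Proof.
rewrite /dens mulr_sumr; apply: ler_sum => z _.
by rewrite mulrCA ler_wpM2l ?pi_ge0// beta_rcons_le.
Qed.

Lemma dens_drop_le j s : p s <= C ^+ j * p (drop j s) \/ (size s < j)%N.
Proof.
elim: j s => [|j IH] s; first by left; rewrite drop0 expr0 mul1r.
case: s => [|x s]; first by right.
have [h|h] := IH s; last by right.
by left; rewrite /= exprS -mulrA (le_trans (dens_cons_le x s))// ler_wpM2l// ltW.
Qed.

Lemma dens_le s : p s <= C ^+ size s.
Proof.
by have [] := dens_drop_le (size s) s; rewrite ?drop_size ?dens_nil ?mulr1 ?ltnn.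
Qed.

Lemma dens_drop_last_le s : p s <= (1 + C) * p (drop_last s).
Proof.
case/lastP: s => [|s x]; first by rewrite dens_nil mulr1 lerDl ltW.
rewrite drop_last_rcons (le_trans (dens_rcons_le s x))//.
by rewrite ler_wpM2r ?dens_ge0// lerDr.
Qed.

Definition dens_mean L (f : seq X -> R) : R := iter L (prep mu) (fun s => p s * f s) [::].

(** Minus the differential entropy, relative to [mu], of [L] consecutive
observations. *)
Definition neg_entropy L : R := dens_mean L (fun s => ln (p s)).

Lemma nice_pln q (c : nat -> R) : nice q -> (forall s, 0 <= q s) ->
  (forall s, p s <= c (size s) * q s) -> nice (fun s => p s * ln (q s)).
Proof. by move=> nq q0 pq; apply: nice_mul_ln pq => //; [exact: nice_dens|exact: dens_ge0]. Qed.

Lemma nice_plnp : nice (fun s => p s * ln (p s)).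
Proof. by apply: (@nice_pln _ (fun=> 1)) => [||s]; [exact: nice_dens|exact: dens_ge0|rewrite mul1r]. Qed.

Lemma nice_pln_drop_last : nice (fun s => p s * ln (p (drop_last s))).
Proof.
apply: (@nice_pln _ (fun=> 1 + C)) => [||s].
- exact: nice_drop_last nice_dens.
- by move=> s; exact: dens_ge0.
- exact: dens_drop_last_le.
Qed.

(** A bound that is valid whether or not [s] has [j] entries to drop. *)
Definition Cdrop j L : R := (1 + C) ^+ j + (1 + C) ^+ L.

Lemma dens_drop_Cdrop j s : p s <= Cdrop j (size s) * p (drop j s).
Proof.
have C1 i : C ^+ i <= (1 + C) ^+ i by rewrite lerXn2r ?nnegrE ?addr_ge0 ?ltW// ltrDr.
have P i : 0 <= (1 + C) ^+ i by rewrite exprn_ge0// addr_ge0// ltW.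
have [h|h] := dens_drop_le j s.
  rewrite (le_trans h)// ler_wpM2r ?dens_ge0// (le_trans (C1 j))//.
  by rewrite /Cdrop lerDl.
rewrite drop_oversize ?dens_nil ?mulr1; last exact: ltnW.
by rewrite (le_trans (dens_le s))// (le_trans (C1 _))// /Cdrop lerDr.
Qed.

Lemma nice_pln_drop j : nice (fun s => p s * ln (p (drop j s))).
Proof.
apply: (@nice_pln _ (Cdrop j)) => [||s].
- exact: nice_drop nice_dens.
- by move=> s; exact: dens_ge0.
- exact: dens_drop_Cdrop.
Qed.

Lemma dens_mean_behead L f : nice (fun s => p s * f s) -> nice (fun s => p s * f (behead s)) ->
  dens_mean L.+1 (fun s => f (behead s)) = dens_mean L f.
Proof.
move=> nf nf'; rewrite /dens_mean iterSr; congr (iter L _ _ _); apply/funext => s.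
rewrite -[p s]prep_dens /prep /= -meanZr//.
exact: (bm_cons s nice_dens).
Qed.

Lemma dens_mean_drop_last L f : nice (fun s => p s * f s) -> nice (fun s => p s * f (drop_last s)) ->
  dens_mean L.+1 (fun s => f (drop_last s)) = dens_mean L f.
Proof.
move=> nf nf'; rewrite /dens_mean !iter_prep_app_nil// iterSr.
congr (iter L _ _ _); apply/funext => s.
rewrite -[in RHS]app_dens /app -meanZr; last exact: (bm_rcons s nice_dens).
by congr mean; apply/funext => x; rewrite drop_last_rcons.
Qed.

Lemma dens_mean_drop j L f : (forall i, nice (fun s => p s * f (drop i s))) ->
  dens_mean (j + L) (fun s => f (drop j s)) = dens_mean L f.
Proof.
move=> nf; elim: j => [|j IH].
  by rewrite add0n; congr (dens_mean L _); apply/funext => s; rewrite drop0.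
rewrite -IH addSn -(@dens_mean_behead (j + L) (fun s => f (drop j s)))//.
  by congr dens_mean; apply/funext => -[|x s].
apply: nice_ext (nf j.+1) => -[|x s] //=; by rewrite drop0.
Qed.

Lemma dens_meanD L f g : nice (fun s => p s * f s) -> nice (fun s => p s * g s) ->
  dens_mean L (fun s => f s + g s) = dens_mean L f + dens_mean L g.
Proof.
move=> nf ng; rewrite /dens_mean -iter_prepD//; congr (iter L _ _ _).
by apply/funext => s; rewrite mulrDr.
Qed.

Lemma dens_meanN L f : nice (fun s => p s * f s) -> dens_mean L (fun s => - f s) = - dens_mean L f.
Proof.
move=> nf; rewrite /dens_mean -iter_prepN//; congr (iter L _ _ _).
by apply/funext => s; rewrite mulrN.
Qed.

(** Gibbs' inequality for a subprobability density [q].  The function [l] equals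
[ln q] only where the density [p] is positive, since elsewhere [p * ln q] is
not bounded. *)
Lemma gibbs L q l : nice q -> (forall s, 0 <= q s) ->
  nice (fun s => p s * l s) ->
  (forall s, size s = L -> 0 < p s -> 0 < q s /\ l s = ln (q s)) ->
  iter L (prep mu) q [::] <= 1 -> dens_mean L l <= neg_entropy L.
Proof.
move=> nq q0 nl pq q1; rewrite -subr_le0 /neg_entropy /dens_mean -iter_prepB//; last exact: nice_plnp.
apply: (@le_trans _ _ (iter L (prep mu) (fun s => q s - p s) [::])); last first.
  rewrite iter_prepB//; last exact: nice_dens.
  by rewrite iter_prep_dens dens_nil subr_le0.
apply: iter_prep_le; [by apply: niceB => //; exact: nice_plnp|by apply: niceB => //; exact: nice_dens|].
move=> s; rewrite cats0 => sL.
have [E|p0] := eqVneq (p s) 0; first by rewrite E !mul0r !subr0.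
have {}p0 : 0 < p s by rewrite lt_neqAle eq_sym p0 dens_ge0.
have [qs0 ->] := pq s sL p0.
rewrite -mulrBr -ln_div ?posrE//.
apply: (@le_trans _ _ (p s * (q s / p s - 1))).
  apply: ler_wpM2l; first exact: ltW.
  by apply: ln_le_sub1; rewrite divr_gt0.
by rewrite mulrBr mulr1 mulrCA divff ?mulr1// gt_eqF.
Qed.

Lemma dens_behead_le s : p s <= (1 + C) * p (behead s).
Proof.
case: s => [|x s] /=; first by rewrite dens_nil mulr1 lerDl ltW.
rewrite (le_trans (dens_cons_le x s))//.
by rewrite ler_wpM2r ?dens_ge0// lerDr.
Qed.

Lemma C1_gt0 : 0 < 1 + C. Proof. by rewrite addr_gt0. Qed.

Lemma dens_drop_last_behead_le s : p (drop_last s) <= (1 + C) * p (drop_last (behead s)).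
Proof.
case: s => [|x [|y s]]; rewrite /drop_last /=; try by rewrite dens_nil mulr1 lerDl ltW.
exact: (dens_behead_le (x :: take (size s) (y :: s))).
Qed.

Lemma dens_gt0_of s t c : p s <= c * p t -> 0 < c -> 0 < p s -> 0 < p t.
Proof.
move=> pst c0 ps; rewrite lt_neqAle dens_ge0 andbT eq_sym; apply/eqP => E.
by move: pst; rewrite E mulr0 leNgt ps.
Qed.

Lemma neg_entropy0 : neg_entropy 0 = 0.
Proof. by rewrite /neg_entropy /dens_mean /= dens_nil ln1 mulr0. Qed.

Lemma nice_pln_drop_last_behead : nice (fun s => p s * ln (p (drop_last (behead s)))).
Proof.
apply: (@nice_pln _ (fun=> (1 + C) * (1 + C))) => [||s].
- exact: (nice_behead (nice_drop_last nice_dens)).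
- by move=> s; exact: dens_ge0.
- rewrite (le_trans (dens_drop_last_le s))// -mulrA ler_wpM2l ?(ltW C1_gt0)//.
  exact: dens_drop_last_behead_le.
Qed.

Lemma nice_pln_behead : nice (fun s => p s * ln (p (behead s))).
Proof. by apply: nice_ext (nice_pln_drop 1) => s; rewrite drop1. Qed.

(** Conditioning on one more past observation reduces entropy: Gibbs' inequality
for the density that makes the first and the last observation independent given
those in between. *)
Lemma neg_entropy_convex L : neg_entropy L.+1 - neg_entropy L <= neg_entropy L.+2 - neg_entropy L.+1.
Proof.
suff : neg_entropy L.+1 + neg_entropy L.+1 - neg_entropy L <= neg_entropy L.+2 by lra.
pose q s := p (drop_last s) / p (drop_last (behead s)) * p (behead s).
pose l s := ln (p (drop_last s)) + ln (p (behead s)) - ln (p (drop_last (behead s))).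
have nB := nice_drop_last nice_dens; have nH := nice_behead nice_dens.
have nBH : nice (fun s => p (drop_last (behead s))) := nice_behead nB.
have n1 := nice_pln_drop_last; have n2 := nice_pln_behead; have n3 := nice_pln_drop_last_behead.
have n12 : nice (fun s => p s * (ln (p (drop_last s)) + ln (p (behead s)))).
  by apply: nice_ext (niceD n1 n2) => s; rewrite mulrDr.
have n3' : nice (fun s => p s * - ln (p (drop_last (behead s)))).
  by apply: nice_ext (niceN n3) => s; rewrite mulrN.
have E : dens_mean L.+2 l = neg_entropy L.+1 + neg_entropy L.+1 - neg_entropy L.
  rewrite /l dens_meanD// dens_meanD// dens_meanN//; congr (_ + _ - _).
  - by apply: (dens_mean_drop_last _ nice_plnp n1).
  - by apply: (dens_mean_behead _ nice_plnp n2).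
  - by rewrite (dens_mean_behead _ n1 n3) (dens_mean_drop_last _ nice_plnp n1).
rewrite -E; apply: (@gibbs _ q).
- apply: niceM => //; apply: (nice_ratio (c := fun=> 1 + C)) => // s; try exact: dens_ge0.
  exact: dens_drop_last_behead_le.
- by move=> s; rewrite /q mulr_ge0 ?divr_ge0 ?dens_ge0.
- by apply: nice_ext (niceD n12 n3') => s; rewrite /l [RHS]mulrDr.
- move=> s _ ps.
  have pb := dens_gt0_of (dens_drop_last_le s) C1_gt0 ps.
  have ph := dens_gt0_of (dens_behead_le s) C1_gt0 ps.
  have pbh := dens_gt0_of (dens_drop_last_behead_le s) C1_gt0 pb.
  split; first by rewrite /q mulr_gt0 ?divr_gt0.
  rewrite /q /l lnM ?posrE ?divr_gt0// ln_div ?posrE//.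
  by rewrite addrAC.
- apply: (@le_trans _ _ (iter L.+1 (prep mu) p [::])); last first.
    by rewrite iter_prep_dens dens_nil.
  rewrite iterSr; apply: iter_prep_le; try exact: nice_dens.
    apply: nice_prep; apply: niceM => //.
    apply: (nice_ratio (c := fun=> 1 + C)) => // s; try exact: dens_ge0.
    exact: dens_drop_last_behead_le.
  move=> u; rewrite cats0 => uL.
  rewrite /prep /q /=.
  case: u uL => // y u _.
  rewrite (_ : (fun x => _) = fun x => p (x :: drop_last (y :: u)) * ((p (drop_last (y :: u)))^-1 * p (y :: u))).
    rewrite meanZr; last exact: (bm_cons _ nice_dens).
    rewrite -/(prep mu p (drop_last (y :: u))) prep_dens.
    have [->|pn0] := eqVneq (p (drop_last (y :: u))) 0; first by rewrite mul0r dens_ge0.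
    by rewrite mulrA divff// mul1r.
  by apply/funext => x; rewrite -mulrA.
Qed.

Lemma neg_entropy_mono j n : (j <= n)%N -> neg_entropy j.+1 - neg_entropy j <= neg_entropy n.+1 - neg_entropy n.
Proof.
move=> /subnK <-; elim: (n - j)%N => // i IH.
by rewrite addSn (le_trans IH)// neg_entropy_convex.
Qed.

Lemma neg_entropy_le_mul n : neg_entropy n <= n%:R * (neg_entropy n.+1 - neg_entropy n).
Proof.
have : neg_entropy n - neg_entropy 0 = \sum_(0 <= j < n) (neg_entropy j.+1 - neg_entropy j) by rewrite telescope_sumr.
rewrite neg_entropy0 subr0 => H; rewrite [leLHS]H.
apply: (@le_trans _ _ (\sum_(0 <= j < n) (neg_entropy n.+1 - neg_entropy n))).
  by rewrite !big_mkord; apply: ler_sum => j _; apply: neg_entropy_mono; exact: ltnW.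
by rewrite sumr_const_nat subn0 mulr_natl.
Qed.

Section mixing_constant.
Variable Cp : R.
Hypothesis piC : forall z, 1 <= Cp * pi z.

Lemma Cp_ge1 : 1 <= Cp.
Proof.
have [_ p1 _] := hpi.
have [z _] : exists z : 'I_k, True.
  case: k pi p1 => [|k'] pi' p1; last by exists ord0.
  by move: p1; rewrite big_ord0 => /eqP; rewrite eq_sym oner_eq0.
have piz : pi z <= 1.
  rewrite -p1 (bigD1 z)//= lerDl sumr_ge0// => i _; exact: pi_ge0.
have Cp0 : 0 < Cp.
  rewrite ltNge; apply/negP => Cp0; have := piC z.
  by rewrite leNgt (le_lt_trans (mulr_le0_ge0 Cp0 (pi_ge0 z))).
by rewrite (le_trans (piC z))// ler_piMr// ltW.
Qed.

(** The future depends on the past through one hidden state only, and the density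
of the future from any single state is at most [1 / min pi] times the stationary
one. *)
Lemma beta_cat_le s t z : beta (s ++ t) z <= Cp * p t * beta s z.
Proof.
elim: s z => [|x s IH] z /=.
  rewrite mulr1 /dens mulr_sumr (bigD1 z)//=.
  rewrite -[leLHS]addr0 lerD//.
    by rewrite mulrA ler_peMl ?beta_ge0.
  by rewrite sumr_ge0// => i _; rewrite mulr_ge0 ?mulr_ge0 ?beta_ge0 ?pi_ge0// (le_trans ler01)// Cp_ge1.
rewrite mulrCA ler_wpM2l// mulr_sumr ler_sum// => z' _.
by rewrite mulrCA ler_wpM2l//; case: hM.
Qed.

Lemma dens_cat_le s t : p (s ++ t) <= Cp * p s * p t.
Proof.
rewrite mulrAC /dens mulr_sumr; apply: ler_sum => z _.
by rewrite mulrCA ler_wpM2l ?pi_ge0 ?beta_cat_le.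
Qed.

Lemma iter_drop_last_cat (s t : seq X) : iter (size t) (@drop_last _ X) (s ++ t) = s.
Proof.
elim/last_ind: t => [|t x IH] /=; first by rewrite cats0.
by rewrite size_rcons iterSr -rcons_cat drop_last_rcons.
Qed.

Lemma dens_iter_drop_last_le b s : p s <= (1 + C) ^+ b * p (iter b (@drop_last _ X) s).
Proof.
elim: b => [|b IH]; first by rewrite expr0 mul1r.
rewrite (le_trans IH)// exprSr -mulrA ler_wpM2l ?exprn_ge0 ?(ltW C1_gt0)//.
exact: dens_drop_last_le.
Qed.

Lemma nice_iter_drop_last b (f : seq X -> R) : nice f -> nice (fun s => f (iter b (@drop_last _ X) s)).
Proof.
move=> nf; elim: b => // b IH; apply: nice_ext (nice_drop_last IH) => s.
by rewrite iterSr.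
Qed.

Lemma nice_pln_iter_drop_last b : nice (fun s => p s * ln (p (iter b (@drop_last _ X) s))).
Proof.
apply: (@nice_pln _ (fun=> (1 + C) ^+ b)) => [||s].
- exact: nice_iter_drop_last nice_dens.
- by move=> s; exact: dens_ge0.
- exact: dens_iter_drop_last_le.
Qed.

Lemma dens_mean_iter_drop_last a b : dens_mean (b + a) (fun s => ln (p (iter b (@drop_last _ X) s))) = neg_entropy a.
Proof.
elim: b => // b <-; rewrite addSn -(dens_mean_drop_last _ (nice_pln_iter_drop_last b)).
  by congr dens_mean; apply/funext => s; rewrite iterSr.
by apply: nice_ext (nice_pln_iter_drop_last b.+1) => s; rewrite iterSr.
Qed.

(** Consecutive blocks share at most [ln Cp] of information. *)
Lemma neg_entropy_add_le a b : neg_entropy (a + b) <= neg_entropy a + neg_entropy b + ln Cp.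
Proof.
have Cp0 : 0 < Cp by rewrite (lt_le_trans ltr01)// Cp_ge1.
have nC : nice (fun s => p s * ln Cp) by apply: niceM; [exact: nice_dens|exact: nice_cst].
have n1 := nice_pln_iter_drop_last b; have n2 := nice_pln_drop a.
have n12 : nice (fun s => p s * (ln (p (iter b (@drop_last _ X) s)) + ln (p (drop a s)))).
  by apply: nice_ext (niceD n1 n2) => s; rewrite mulrDr.
have E : dens_mean (a + b) (fun s => ln (p (iter b (@drop_last _ X) s)) + ln (p (drop a s)) + ln Cp)
    = neg_entropy a + neg_entropy b + ln Cp.
  rewrite dens_meanD// dens_meanD//; congr (_ + _ + _).
  - by rewrite addnC dens_mean_iter_drop_last.
  - by rewrite (@dens_mean_drop a b (fun s => ln (p s)))// => i; exact: nice_pln_drop.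
  - rewrite /dens_mean; under eq_fun do rewrite mulrC.
    rewrite iter_prepZ; last exact: nice_dens.
    by rewrite iter_prep_dens dens_nil mulr1.
rewrite -E /neg_entropy /dens_mean; apply: iter_prep_le; first exact: nice_plnp.
  by apply: nice_ext (niceD n12 nC) => s; rewrite -mulrDr.
move=> s; rewrite cats0 => sab.
have [E0|p0] := eqVneq (p s) 0; first by rewrite E0 !mul0r.
have {}p0 : 0 < p s by rewrite lt_neqAle eq_sym p0 dens_ge0.
apply: ler_wpM2l; first exact: ltW.
have pd : 0 < p (drop a s).
  apply: dens_gt0_of (dens_drop_Cdrop a s) _ p0.
  by rewrite /Cdrop addr_gt0 ?exprn_gt0 ?C1_gt0.
have pb : 0 < p (iter b (@drop_last _ X) s).
  by apply: dens_gt0_of (dens_iter_drop_last_le b s) _ p0; rewrite exprn_gt0 ?C1_gt0.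
have tE : iter b (@drop_last _ X) s = take a s.
  have bE : b = size (drop a s) by rewrite size_drop sab addKn.
  by rewrite -{1}(cat_take_drop a s) bE iter_drop_last_cat.
rewrite -lnM ?posrE// -lnM ?posrE ?mulr_gt0//.
rewrite ler_ln ?posrE ?mulr_gt0//.
by have := dens_cat_le (take a s) (drop a s); rewrite cat_take_drop tE; lra.
Qed.

(** The increments increase, so [2 n] times the [n+1]-st one is at least
[2 * neg_entropy n]; the rest is the information shared by three consecutive
blocks of length [n]. *)
Lemma neg_entropy_memory n :
  neg_entropy (n + n.*2) - neg_entropy n - (n.*2)%:R * (neg_entropy n.+1 - neg_entropy n) <= 2 * ln Cp.
Proof.
have h1 := neg_entropy_add_le n n.*2; have h2 := neg_entropy_add_le n n.
have h3 := neg_entropy_le_mul n.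
have -> : (n.*2)%:R * (neg_entropy n.+1 - neg_entropy n) =
  n%:R * (neg_entropy n.+1 - neg_entropy n) + n%:R * (neg_entropy n.+1 - neg_entropy n) :> R.
  by rewrite -mulrDl -natrD addnn.
by move: h1; rewrite -addnn; lra.
Qed.

End mixing_constant.

(** The hypothesis on the risk is in test form: [G t] plays the role of a
likelihood ratio of the next observation, normalized under the predictor. *)
Section prediction_step.
Variables (n : nat) (K : R.-pker (n.-tuple X) ~> X) (rho : R).
Hypothesis Krisk : forall G : seq X -> R, nice G ->
  (exists2 c, 0 < c & forall t, size t = n.+1 -> c <= G t) ->
  (forall w, size w = n -> step K G w = 1) -> dens_mean n.+1 (fun t => ln (G t)) <= rho.

Lemma iter_prep_drop_last_rcons j u t x :
  iter j (prep mu) (fun s => p (drop_last s)) (u ++ rcons t x) = iter j (prep mu) p (u ++ t).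
Proof.
elim: j u => [|j IH] u /=; first by rewrite -rcons_cat drop_last_rcons.
by rewrite /prep; congr mean; apply/funext => y; rewrite -!cat_cons; exact: IH.
Qed.

(** Let [Phi = step K Phi'], and let [F] be the ratio of [Phi'] to [Phi] at the
preceding time; its mean under the predictor is [1].  Averaging [F] over the
first [j] observations, given the [n] that follow them, yields a function [G] of
the last [n+1] ones.  It is again normalized, because [prep] commutes with
[step], so the risk bounds the mean of [ln G].  It remains to compare [ln F] with
[ln G].  The first [n + j] observations, followed by one drawn from its
conditional law given the last [n], have a density, and so has its product with
[F / G]; Gibbs' inequality for the latter is the claim, the two conditionings
producing the entropy increments. *)
Lemma prediction_step j (Phi' : seq X -> R) : nice Phi' -> (forall s, 1 <= Phi' s) ->
  dens_mean (n + j).+1 (fun s => ln (Phi' s)) - dens_mean (n + j) (fun s => ln (step K Phi' s)) <=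
  rho + (neg_entropy (n + j).+1 - neg_entropy (n + j)) - (neg_entropy n.+1 - neg_entropy n).
Proof.
move=> nF' F'1.
pose Phi := step K Phi'.
have nF : nice Phi by exact: nice_step.
have F1 s : 1 <= Phi s.
  by rewrite -(step_cst K 1 s); apply: step_le => //; exact: nice_cst.
have Fp s : 0 < Phi s by apply: lt_le_trans (F1 s).
have F'p s : 0 < Phi' s by apply: lt_le_trans (F'1 s).
have [B HB] := nice_bound_fun nF; have [B' HB'] := nice_bound_fun nF'.
have BPhi s : Phi s <= B (size s) by rewrite (le_trans (ler_norm _))//; case: (HB s).
have BPhi' s : Phi' s <= B' (size s) by rewrite (le_trans (ler_norm _))//; case: (HB' s).
have szbel (s : seq X) : size (drop_last s) = (size s).-1 by rewrite /drop_last size_take_min; lia.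
pose F s := Phi' s * (Phi (drop_last s))^-1.
have nFi : nice (fun s => (Phi (drop_last s))^-1).
  by apply: (nice_inv (c := fun=> 1)) => //; exact: nice_drop_last.
have nFF : nice F by exact: niceM.
have FU s : F s <= B' (size s).
  rewrite /F -[leRHS]mulr1 ler_pM ?(ltW (F'p _)) ?invr_ge0 ?(ltW (Fp _))//.
  by rewrite invf_le1.
have F0 s : 0 < F s by rewrite /F divr_gt0.
have FL s : (B (size s).-1)^-1 <= F s.
  rewrite /F -[leLHS]mul1r ler_pM// ?invr_ge0.
    by have [h _] := HB (drop_last s); rewrite -szbel ltW.
  by rewrite lef_pV2 ?posrE// -szbel ?BPhi//; case: (HB (drop_last s)).
pose Fp' s := F s * p (drop_last s).
have npb : nice (fun s => p (drop_last s)) := nice_drop_last nice_dens.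
have nFp : nice Fp' by exact: niceM.
pose num t := iter j (prep mu) Fp' t.
have nnum : nice num by exact: nice_iter_prep.
have drop_last_cat (u t : seq X) : t != [::] -> drop_last (u ++ t) = u ++ drop_last t.
  by case/lastP: t => // t x _; rewrite -rcons_cat !drop_last_rcons.
have numpb t : t != [::] -> iter j (prep mu) (fun s => p (drop_last s)) t = p (drop_last t).
  move=> tn; case/lastP: t tn => // t x tn; rewrite drop_last_rcons.
  by rewrite -[RHS](iter_prep_dens j); exact: (iter_prep_drop_last_rcons j [::]).
have numU t : t != [::] -> num t <= B' (j + size t)%N * p (drop_last t).
  move=> tn; rewrite -numpb// -iter_prepZ//; apply: iter_prep_le => //.
    by apply: niceM => //; exact: nice_cst.
  move=> u uj; rewrite /Fp' ler_wpM2r ?dens_ge0// (le_trans (FU _))//.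
  by rewrite size_cat uj.
have numL t : t != [::] -> (B (j + size t).-1)^-1 * p (drop_last t) <= num t.
  move=> tn; rewrite -numpb// -iter_prepZ//; apply: iter_prep_le => //.
    by apply: niceM => //; exact: nice_cst.
  move=> u uj; rewrite /Fp' ler_wpM2r ?dens_ge0// (le_trans _ (FL _))//.
  by rewrite size_cat uj.
have num0 t : 0 <= num t.
  have n0 : nice (fun _ : seq X => 0 : R) by exact: nice_cst.
  apply: (@le_trans _ _ (iter j (prep mu) (fun=> 0) t)).
    have -> : (fun _ : seq X => 0 : R) = (fun=> 0 * 0) by apply/funext => ?; rewrite mul0r.
    by rewrite (iter_prepZ _ _ _ _ n0) mul0r.
  apply: iter_prep_le => // u _.
  by rewrite /Fp' mulr_ge0 ?dens_ge0// ltW.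
(* [1] where the density of the past vanishes, the quotient being [0] there *)
pose G0 t := num t / p (drop_last t) + (1 - ((0 < p (drop_last t))%R)%:R).
pose cU L := if L is 0 then `|num [::]| else B' (j + L)%N.
have nG0 : nice G0.
  apply: niceD.
    apply: (nice_ratio (c := cU)) => // s; first exact: dens_ge0.
    case: s => [|x s]; last exact: numU.
    by rewrite /= dens_nil mulr1 ler_norm.
  by apply: niceB; [exact: nice_cst|exact: nice_pos_indic].
pose G t := if size t == n.+1 then G0 t else 1.
have nG : nice G by apply: (nice_if_size (eq_op^~ n.+1)) => //; exact: nice_cst.
pose b : R := (B (j + n.+1).-1)^-1.
have B1 L : (exists s : seq X, size s = L) -> 1 <= B L.
  by move=> [s <-]; apply: le_trans (F1 s) (BPhi s).
have GL t : size t = n.+1 -> 0 < b /\ b <= G0 t.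
  move=> tn.
  have sB : exists s : seq X, size s = (j + n.+1).-1.
    case: t tn => // x t _; exists (nseq (j + n.+1).-1 x); exact: size_nseq.
  have b1 : 1 <= B (j + n.+1).-1 by exact: B1.
  have b0 : 0 < B (j + n.+1).-1 by apply: lt_le_trans b1.
  split; first by rewrite /b invr_gt0.
  have tn0 : t != [::] by case: t tn.
  rewrite /G0; have [pb|pb] := ltP 0 (p (drop_last t)).
    rewrite subrr addr0 ler_pdivlMr//.
    by have := numL t tn0; rewrite tn.
  have -> : p (drop_last t) = 0 by apply/eqP; rewrite eq_le pb dens_ge0.
  by rewrite invr0 mulr0 add0r subr0 /b invf_le1.
have Gpos t : 0 < G t.
  rewrite /G; case: eqP => // tn; have [b0 bG] := GL t tn.
  exact: lt_le_trans bG.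
pose cG L := if L == n.+1 then (if `[< exists s : seq X, size s = n.+1 >] then b else 1) else 1.
have cG0 L : 0 < cG L.
  rewrite /cG; case: eqP => // _; case: asboolP => // -[s sn].
  by case: (GL s sn).
have GcG t : cG (size t) <= G t.
  rewrite /cG /G; case: eqP => // tn; case: asboolP => [_|[]]; last by exists t.
  by case: (GL t tn).
have step1 w : size w = n -> step K G w = 1.
  move=> wn; have nw : (n <= size w)%N by rewrite wn.
  have GE y : G (rcons w y) = num (rcons w y) / p w + (1 - ((0 < p w)%R)%:R).
    by rewrite /G size_rcons wn eqxx /G0 drop_last_rcons.
  rewrite (step_ext K (g := fun s => (p (drop_last s))^-1 * num s + (1 - ((0 < p (drop_last s))%R)%:R)))//; last first.
    by move=> y; rewrite GE drop_last_rcons mulrC.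
  have [w' wE _] := windowP nw; rewrite /step wE.
  under eq_fun do rewrite drop_last_rcons.
  rewrite meanD; [|apply: bmM; [exact: bm_cst|exact: (bm_rcons w nnum)]|exact: bm_cst].
  rewrite meanZl ?mean_cst; last exact: (bm_rcons w nnum).
  have -> : mean (kernel_at K w') (fun x => num (rcons w x)) = step K num w by rewrite /step wE.
  rewrite -prep_step_iter//.
  rewrite (iter_prep_ext (g := p) mu); first last.
  - move=> u uj; have nuw : (n <= size (u ++ w))%N by rewrite size_cat wn leq_addl.
    rewrite (step_ext K (g := fun s => (p (drop_last s) * (Phi (drop_last s))^-1) * Phi' s))//; last first.
      by move=> y; rewrite /Fp' /F mulrC mulrA mulrAC.
    rewrite (step_drop_last K (fun s => p s * (Phi s)^-1) nF')//.
    by rewrite -/Phi mulrAC -mulrA divff ?mulr1// gt_eqF.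
  - exact: nice_dens.
  - exact: nice_step.
  rewrite iter_prep_dens.
  have [pw|pw] := ltP 0 (p w); first by rewrite subrr addr0 mulVf// gt_eqF.
  have -> : p w = 0 by apply/eqP; rewrite eq_le pw dens_ge0.
  by rewrite mulr0 add0r subr0.
have Erho : dens_mean n.+1 (fun t => ln (G t)) <= rho.
  apply: Krisk => //; have [[s sn]|ns] := pselect (exists s : seq X, size s = n.+1).
    exists b; first by case: (GL s sn).
    move=> t tn; rewrite /G tn eqxx; by case: (GL t tn).
  by exists 1 => // t tn; exfalso; apply: ns; exists t.
pose L := (n + j).+1.
have LE : L = (n.+1 + j)%N by rewrite /L addSn.
pose r t := p t / p (drop_last t).
have nr : nice r.
  apply: (nice_ratio (c := fun=> 1 + C)) => [|//|s|s|s].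
  - exact: nice_dens.
  - exact: dens_ge0.
  - exact: dens_ge0.
  - exact: dens_drop_last_le.
have nGi : nice (fun t => (G t)^-1) by exact: (nice_inv cG0 GcG).
pose c t := r t * (G t)^-1.
have nc : nice c by exact: niceM.
pose q s := c (drop j s) * Fp' s.
have nq : nice q by apply: niceM => //; exact: nice_drop nc.
have nlF' : nice (fun s => p s * ln (Phi' s)).
  by apply: niceM; [exact: nice_dens|apply: (nice_ln (c := fun=> 1))].
have nlF : nice (fun s => p s * ln (Phi s)).
  by apply: niceM; [exact: nice_dens|apply: (nice_ln (c := fun=> 1))].
have nlFb : nice (fun s => p s * ln (Phi (drop_last s))).
  apply: niceM; [exact: nice_dens|].
  exact: (nice_drop_last (nice_ln (c := fun=> 1) (fun=> ltr01) F1 nF)).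
have nlG i : nice (fun s => p s * ln (G (drop i s))).
  apply: niceM; [exact: nice_dens|].
  exact: (nice_drop i (nice_ln cG0 GcG nG)).
have nlpb i : nice (fun s => p s * ln (p (drop_last (drop i s)))).
  apply: (@nice_pln _ (fun l => Cdrop i l * (1 + C))) => [||s].
  - exact: (nice_drop i npb).
  - by move=> s; exact: dens_ge0.
  - rewrite (le_trans (dens_drop_Cdrop i s))// -mulrA ler_wpM2l ?dens_drop_last_le//.
    by rewrite /Cdrop addr_ge0 ?exprn_ge0 ?(ltW C1_gt0).
have nb := nice_pln_drop_last; have nd := nice_pln_drop j.
have comb f g : nice (fun s => p s * f s) -> nice (fun s => p s * g s) ->
    nice (fun s => p s * (f s + g s)).
  by move=> nf ng; apply: nice_ext (niceD nf ng) => s; rewrite mulrDr.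
have combN f : nice (fun s => p s * f s) -> nice (fun s => p s * - f s).
  by move=> nf; apply: nice_ext (niceN nf) => s; rewrite mulrN.
pose l s := ln (Phi' s) - ln (Phi (drop_last s)) + ln (p (drop_last s)) + ln (p (drop j s))
   - ln (G (drop j s)) - ln (p (drop_last (drop j s))).
have t1 := comb _ _ nlF' (combN _ nlFb).
have t2 := comb _ _ t1 nb.
have t3 := comb _ _ t2 nd.
have t4 := comb _ _ t3 (combN _ (nlG j)).
have t5 := comb _ _ t4 (combN _ (nlpb j)).
have nbl : nice (fun s => p s * ln (p (drop_last s))) := nb.
have El : dens_mean L l = dens_mean L (fun s => ln (Phi' s)) - dens_mean (n + j) (fun s => ln (Phi s))
   + neg_entropy (n + j) + neg_entropy n.+1 - dens_mean n.+1 (fun t => ln (G t)) - neg_entropy n.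
  rewrite /l dens_meanD//; last exact: combN.
  rewrite dens_meanD//; last exact: combN.
  rewrite dens_meanD// dens_meanD// dens_meanD//; last exact: combN.
  rewrite !dens_meanN//.
  have LE' : L = (j + n.+1)%N by rewrite LE addnC.
  congr (_ - _ + _ + _ - _ - _).
  - by rewrite (dens_mean_drop_last _ nlF nlFb).
  - by rewrite (dens_mean_drop_last _ nice_plnp nb).
  - by rewrite LE' (@dens_mean_drop j n.+1 (fun s => ln (p s)))// => i; exact: nice_pln_drop.
  - by rewrite LE' (@dens_mean_drop j n.+1 (fun s => ln (G s))).
  - rewrite LE' (@dens_mean_drop j n.+1 (fun s => ln (p (drop_last s))))//.
    by rewrite (dens_mean_drop_last _ nice_plnp nb).
have : dens_mean L l <= neg_entropy L; last by rewrite El /L; lra.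
apply: (@gibbs _ q) => //.
- move=> s; apply: mulr_ge0; last by apply: mulr_ge0; [exact: ltW|exact: dens_ge0].
  apply: mulr_ge0; last by rewrite invr_ge0 ltW.
  by apply: divr_ge0; exact: dens_ge0.
- move=> s sL ps.
  have pb := dens_gt0_of (dens_drop_last_le s) C1_gt0 ps.
  have pd : 0 < p (drop j s).
    apply: dens_gt0_of (dens_drop_Cdrop j s) _ ps.
    by rewrite /Cdrop addr_gt0 ?exprn_gt0 ?C1_gt0.
  have pbd := dens_gt0_of (dens_drop_last_le _) C1_gt0 pd.
  have c0 : 0 < c (drop j s) by rewrite /c /r !mulr_gt0 ?invr_gt0.
  have f0 : 0 < Fp' s by rewrite /Fp' mulr_gt0.
  split; first by rewrite /q mulr_gt0.
  rewrite /q lnM ?posrE// /c /Fp' /r /F.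
  rewrite lnM ?posrE ?divr_gt0 ?invr_gt0// ln_div ?posrE// lnV ?posrE//.
  rewrite lnM ?posrE ?divr_gt0// ln_div ?posrE// /l; lra.
- rewrite LE iterD.
  apply: (@le_trans _ _ (iter n.+1 (prep mu) p [::])); last first.
    by rewrite iter_prep_dens dens_nil.
  apply: iter_prep_le; [exact: nice_iter_prep|exact: nice_dens|].
  move=> t; rewrite cats0 => tn.
  rewrite (iter_prep_ext mu (g := fun s => c (drop (size s - size t) s) * Fp' s))//; last first.
    by move=> u uj; rewrite /q size_cat addnK uj.
    apply: niceM => // L'; have [i ni] : exists i, i = (L' - size t)%N by eexists.
    by apply: bm_ext (nice_drop i nc L') => t'; rewrite size_tuple ni.
  rewrite iter_prep_drop// -/(num t) /c /r /G tn eqxx.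
  have [b0] := GL t tn; rewrite /G0.
  have [pb|pb] := ltP 0 (p (drop_last t)).
    rewrite subrr addr0 => bG.
    have n0 : 0 < num t / p (drop_last t) by apply: lt_le_trans bG.
    have nt : num t != 0 by apply: contraTneq n0 => ->; rewrite mul0r ltxx.
    have pb0 : p (drop_last t) != 0 by rewrite gt_eqF.
    suff -> : p t / p (drop_last t) / (num t / p (drop_last t)) * num t = p t by [].
    by field; rewrite pb0.
  have -> : p (drop_last t) = 0 by apply/eqP; rewrite eq_le pb dens_ge0.
  by move=> _; rewrite invr0 !mulr0 !mul0r dens_ge0.
Qed.

(** Telescoping of [prediction_step], from [Phi] at time [n + N] back to
[iter N (step K) Phi] at time [n]. *)
Lemma prediction_transport N (Phi : seq X -> R) (c : R) : nice Phi -> (forall s, 1 <= Phi s) ->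
  (forall w, size w = n -> iter N (step K) Phi w <= c) ->
  dens_mean (n + N) (fun s => ln (Phi s)) <=
    ln c + N%:R * rho + (neg_entropy (n + N) - neg_entropy n - N%:R * (neg_entropy n.+1 - neg_entropy n)).
Proof.
elim: N Phi => [|N IH] Phi nF F1 Fc.
  rewrite addn0 !mul0r addr0 subrr subr0 addr0.
  have -> : ln c = dens_mean n (fun=> ln c).
    rewrite /dens_mean; under eq_fun do rewrite mulrC.
    by rewrite iter_prepZ ?iter_prep_dens ?dens_nil ?mulr1//; exact: nice_dens.
  apply: iter_prep_le.
  - by apply: niceM; [exact: nice_dens|apply: (nice_ln (c := fun=> 1))].
  - by apply: niceM; [exact: nice_dens|exact: nice_cst].
  move=> s; rewrite cats0 => sn; rewrite ler_wpM2l ?dens_ge0//.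
  have h := Fc s sn; have h1 := F1 s.
  by rewrite ler_ln ?posrE ?(lt_le_trans ltr01)// (le_trans h1).
have nS : nice (step K Phi) by exact: nice_step.
have S1 s : 1 <= step K Phi s.
  by rewrite -(step_cst K 1 s); apply: step_le => //; exact: nice_cst.
have := IH (step K Phi) nS S1; rewrite -!iterSr => /(_ Fc) h1.
have h2 := prediction_step N nF F1.
by rewrite addnS -natr1 !mulrDl !mul1r; move: h1 h2; lra.
Qed.

End prediction_step.

End density.

(** * Runs of a hidden Markov chain *)

Lemma cvg_sum_seq {R : realType} I (r : seq I) (F : nat -> I -> R) (l : I -> R) :
  (forall i, F n i @[n --> \oo] --> l i) ->
  \sum_(i <- r) F n i @[n --> \oo] --> \sum_(i <- r) l i.
Proof.
move=> Fl; elim: r => [|j r IH].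
  by rewrite big_nil; under eq_fun do rewrite big_nil; exact: cvg_cst.
by rewrite big_cons; under eq_fun do rewrite big_cons; exact: cvgD.
Qed.

Section run.
Context {d} {X : measurableType d} {R : realType}.
Variables (k : nat) (E : 'I_k -> probability X R) (M : 'M[R]_k).

(** The final state is an argument of [F], so that runs can be concatenated
([run_cat]). *)
Fixpoint run (L : nat) (z : 'I_k) (F : 'I_k -> seq X -> R) : R :=
  if L is L'.+1 then
    mean (E z) (fun x => \sum_z' M z z' * run L' z' (fun y s => F y (x :: s)))
  else F z [::].

Lemma run_cat a b z F :
  run (a + b) z F = run a z (fun y s => run b y (fun y' t => F y' (s ++ t))).
Proof.
elim: a z F => // a IH z F; rewrite addSn /=; congr mean; apply/funext => x.
by apply: eq_bigr => y _; rewrite IH.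
Qed.

Lemma run_ext L z F G : (forall y s, size s = L -> F y s = G y s) ->
  run L z F = run L z G.
Proof.
elim: L z F G => [|L IH] z F G FG /=; first exact: FG.
congr mean; apply/funext => x; apply: eq_bigr => y _; congr (_ * _).
by apply: IH => y' s sL; apply: FG; rewrite /= sL.
Qed.

(** Measurability in a parameter and the observations jointly, the form that
survives the induction on the number of observations. *)
Definition joint_bm {d'} {T : measurableType d'} (F : T -> 'I_k -> seq X -> R) :=
  forall z L, bm (fun p : T * L.-tuple X => F p.1 z p.2).

Lemma joint_bm_cons {d'} {T : measurableType d'} (F : T -> 'I_k -> seq X -> R) :
  joint_bm F -> joint_bm (fun (p : T * X) y s => F p.1 y (p.2 :: s)).
Proof.
move=> bF z L.
apply: (bm_comp (u := fun p : (T * X) * L.-tuple X => (p.1.1, [tuple of p.1.2 :: p.2]))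
   (f := fun p => F p.1 z p.2) _ (bF z L.+1)).
apply/measurable_fun_pairP; split.
  exact: (@measurableT_comp _ _ _ _ _ _ fst _ fst).
by apply: measurable_cons => //; exact: (@measurableT_comp _ _ _ _ _ _ snd _ fst).
Qed.

Lemma bm_run {d'} {T : measurableType d'} (F : T -> 'I_k -> seq X -> R) L z :
  joint_bm F -> bm (fun t => run L z (F t)).
Proof.
elim: L d' T F z => [|L IH] d' T F z bF /=.
  apply: (bm_comp (u := fun t : T => (t, [tuple])) (f := fun p => F p.1 z p.2) _ (bF z 0%N)).
  by apply/measurable_fun_pairP; split; [exact: measurable_id|exact: measurable_cst].
apply: (@bm_mean_const _ _ _ _ _ (E z) (fun p : T * X =>
   \sum_z' M z z' * run L z' (fun y s => F p.1 y (p.2 :: s)))).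
apply: bm_sum => y _; apply: bmM; first exact: bm_cst.
apply: (IH _ _ (fun (p : T * X) y s => F p.1 y (p.2 :: s))).
exact: joint_bm_cons.
Qed.

Definition snice (F : 'I_k -> seq X -> R) := forall z, nice (F z).

Lemma snice_cons F x : snice F -> snice (fun y s => F y (x :: s)).
Proof. by move=> nF z; exact: nice_cons. Qed.

Lemma snice_joint F : snice F -> joint_bm (fun (x : X) y s => F y (x :: s)).
Proof. by move=> nF z L; exact: bm_cons_joint. Qed.

Lemma snice_cat F s : snice F -> snice (fun y t => F y (s ++ t)).
Proof. by move=> nF; elim: s F nF => // x s IH F nF; exact: IH (snice_cons x nF). Qed.

Lemma bm_run_cons F L z : snice F -> bm (fun x => run L z (fun y s => F y (x :: s))).
Proof. by move=> nF; apply: bm_run; exact: snice_joint. Qed.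

Lemma nice_run_cat F b : snice F -> snice (fun y s => run b y (fun y' t => F y' (s ++ t))).
Proof.
move=> nF z L; apply: (@bm_run _ _ (fun (t : L.-tuple X) y s => F y (t ++ s))) => y m.
apply: (bm_comp (u := fun p : L.-tuple X * m.-tuple X => [tuple of p.1 ++ p.2])
   (f := fun t => F y t) _ (nF y _)).
apply/measurable_fun_tnthP => i.
rewrite -(splitK i); case: (fintype.split i) => j /=.
  rewrite (_ : _ \o _ = fun p : L.-tuple X * m.-tuple X => tnth p.1 j).
    exact: (measurableT_comp (measurable_tnth j) measurable_fst).
  by apply/funext => p /=; rewrite tnth_lshift.
rewrite (_ : _ \o _ = fun p : L.-tuple X * m.-tuple X => tnth p.2 j).
  exact: (measurableT_comp (measurable_tnth j) measurable_snd).
by apply/funext => p /=; rewrite tnth_rshift.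
Qed.

Lemma runZ L z c F : snice F -> run L z (fun y s => c * F y s) = c * run L z F.
Proof.
elim: L z F => //= L IH z F nF.
rewrite -meanZl; last by apply: bm_sum => y _; apply: bmM; [exact: bm_cst|exact: bm_run_cons].
congr mean; apply/funext => x; rewrite mulr_sumr; apply: eq_bigr => y _.
by rewrite (IH y (fun y s => F y (x :: s))) 1?mulrCA//; exact: snice_cons.
Qed.

Lemma runD L z F G : snice F -> snice G ->
  run L z (fun y s => F y s + G y s) = run L z F + run L z G.
Proof.
elim: L z F G => //= L IH z F G nF nG.
rewrite -meanD; try by apply: bm_sum => y _; apply: bmM; [exact: bm_cst|exact: bm_run_cons].
congr mean; apply/funext => x; rewrite -big_split; apply: eq_bigr => y _.
by rewrite (IH y (fun y s => F y (x :: s)) (fun y s => G y (x :: s))) ?mulrDr//; exact: snice_cons.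
Qed.

Lemma run_sum I (r : seq I) (P : pred I) L z (F : I -> 'I_k -> seq X -> R) :
  (forall i, P i -> snice (F i)) ->
  run L z (fun y s => \sum_(i <- r | P i) F i y s) = \sum_(i <- r | P i) run L z (F i).
Proof.
elim: L z F => //= L IH z F nF.
rewrite -mean_sum => [|i Pi]; last first.
  by apply: bm_sum => y _; apply: bmM; [exact: bm_cst|exact: bm_run_cons (nF i Pi)].
congr mean; apply/funext => x; rewrite exchange_big; apply: eq_bigr => y _.
rewrite (IH y (fun i y s => F i y (x :: s))); first by rewrite mulr_sumr.
by move=> i Pi; exact: snice_cons (nF i Pi).
Qed.

Hypothesis hM : row_stochastic M.

Lemma run_le L z F G : snice F -> snice G ->
  (forall y s, size s = L -> F y s <= G y s) -> run L z F <= run L z G.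
Proof.
elim: L z F G => /= [|L IH] z F G nF nG FG; first exact: FG.
apply: mean_le => [||x]; try by apply: bm_sum => y _; apply: bmM; [exact: bm_cst|exact: bm_run_cons].
apply: ler_sum => y _; apply: ler_wpM2l; first by case: hM.
by apply: IH => [||y' s sL]; try exact: snice_cons; apply: FG; rewrite /= sL.
Qed.

Lemma run_cst L z c : run L z (fun _ _ => c) = c.
Proof.
elim: L z => //= L IH z.
rewrite (_ : (fun=> _) = fun=> c) ?mean_cst//; apply/funext => x.
by under eq_bigr do rewrite IH; rewrite -mulr_suml; case: hM => _ ->; rewrite mul1r.
Qed.

Lemma snice_cst c : snice (fun _ _ => c).
Proof. by move=> z; exact: nice_cst. Qed.

Lemma run_ge0 L z F : snice F -> (forall y s, size s = L -> 0 <= F y s) -> 0 <= run L z F.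
Proof. by move=> nF F0; rewrite -(run_cst L z 0); apply: run_le => //; exact: snice_cst. Qed.

Lemma run_bound L z F B : snice F -> (forall y s, size s = L -> `|F y s| <= B) ->
  `|run L z F| <= B.
Proof.
move=> nF FB; rewrite ler_norml; apply/andP; split.
  rewrite -(run_cst L z (- B)); apply: run_le => //; first exact: snice_cst.
  by move=> y s /(FB y); rewrite ler_norml => /andP[].
rewrite -(run_cst L z B); apply: run_le => //; first exact: snice_cst.
by move=> y s /(FB y); rewrite ler_norml => /andP[].
Qed.

Lemma run_dct L z (F : nat -> 'I_k -> seq X -> R) G (B : R) :
  (forall i, snice (F i)) -> snice G ->
  (forall i y s, size s = L -> `|F i y s| <= B) ->
  (forall y s, size s = L -> F i y s @[i --> \oo] --> G y s) ->
  run L z (F i) @[i --> \oo] --> run L z G.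
Proof.
elim: L z F G => /= [|L IH] z F G nF nG FB FG; first exact: FG.
apply: (@mean_dct _ _ _ _ _ _ (\sum_z' `|M z z'| * B)) => [i|i x|x].
- have [] // : bm (fun x => \sum_z' M z z' * run L z' (fun y s => F i y (x :: s))).
  by apply: bm_sum => y _; apply: bmM; [exact: bm_cst|exact: bm_run_cons].
- rewrite (le_trans (ler_norm_sum _ _ _))//; apply: ler_sum => y _.
  rewrite normrM ler_wpM2l//; apply: run_bound; first exact: snice_cons.
  by move=> y' s sL; apply: FB; rewrite /= sL.
- apply: cvg_sum_seq => y; apply: cvgM; first exact: cvg_cst.
  apply: (IH y (fun i y s => F i y (x :: s))).
  + by move=> i; exact: snice_cons.
  + exact: snice_cons.
  + by move=> i y' s sL; apply: FB; rewrite /= sL.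
  + by move=> y' s sL; apply: FG; rewrite /= sL.
Qed.

End run.

Section hmm_law.
Context {d} {X : measurableType d} {R : realType}.
Variables (k : nat) (E : 'I_k -> probability X R) (M : 'M[R]_k) (pi : 'I_k -> R).
Hypotheses (hM : row_stochastic M) (hpi : stationary_distribution M pi).

(** The backward recursion for densities and the one for means are the same. *)
Lemma run_dens L z f (e : 'I_k -> X -> R) mu : (forall z, bm (e z)) ->
  (forall z h, bm h -> mean (E z) h = mean mu (fun x => e z x * h x)) ->
  nice f -> iter L (prep mu) (fun s => beta M e s z * f s) [::] = run E M L z (fun _ => f).
Proof.
move=> be eE; have nb := nice_beta M be.
have iter_app_cons j g x s : iter j (app mu) g (x :: s) = iter j (app mu) (fun s => g (x :: s)) s.
  elim: j s => // j IH s /=; rewrite /app; congr mean.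
  by apply/funext => y; rewrite rcons_cons IH.
elim: L z f => [|L IH] z f nf /=; first by rewrite mul1r.
have nbf y : nice (fun s => beta M e s y * f s) by exact: niceM.
rewrite -iterS iter_prep_app_nil// iterS.
rewrite eE; last first.
  apply: bm_sum => y _; apply: bmM; first exact: bm_cst.
  by apply: (@bm_run_cons _ _ _ _ _ _ (fun _ => f)) => ?.
rewrite /app; congr mean; apply/funext => x /=; rewrite iter_app_cons.
have nbx y : nice (fun s => beta M e s y * f (x :: s)).
  by apply: niceM => //; exact: nice_cons.
have nMx y : nice (fun s => M z y * (beta M e s y * f (x :: s))).
  by apply: niceM => //; exact: nice_cst.
rewrite (_ : (fun s => _) = fun s => e z x * \sum_y M z y * (beta M e s y * f (x :: s))); last first.
  apply/funext => s /=; rewrite -mulrA; congr (_ * _).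
  by rewrite mulr_suml; apply: eq_bigr => y _; rewrite mulrA.
rewrite -iter_prep_app_nil; last first.
  by apply: niceM; [exact: nice_cst|exact: nice_sum].
rewrite iter_prepZ; last exact: nice_sum.
congr (_ * _).
have iter_prep_sum (r : seq 'I_k) (F : 'I_k -> seq X -> R) : (forall y, nice (F y)) ->
    iter L (prep mu) (fun s => \sum_(y <- r) F y s) [::] = \sum_(y <- r) iter L (prep mu) (F y) [::].
  move=> nF; elim: r => [|y r IHr].
    rewrite big_nil -[RHS](mul0r (iter L (prep mu) (fun=> 0) [::])) -iter_prepZ; last exact: nice_cst.
    by congr (iter L _ _ _); apply/funext => s; rewrite big_nil mul0r.
  rewrite big_cons -IHr -iter_prepD//; last exact: nice_sum.
  by congr (iter L _ _ _); apply/funext => s; rewrite big_cons.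
rewrite iter_prep_sum//; apply: eq_bigr => y _.
rewrite iter_prepZ// IH//; exact: nice_cons.
Qed.

Definition hmm_mean L f : R := \sum_z pi z * run E M L z (fun _ => f).

Lemma dens_mean_hmm L f (e : 'I_k -> X -> R) mu : (forall z, bm (e z)) ->
  (forall z h, bm h -> mean (E z) h = mean mu (fun x => e z x * h x)) ->
  nice f -> dens_mean pi M e mu L f = hmm_mean L f.
Proof.
move=> be eE nf; rewrite /dens_mean /hmm_mean.
under eq_bigr => z _ do rewrite -(run_dens _ _ be eE nf).
have nbf y : nice (fun s => beta M e s y * f s) by apply: niceM => //; exact: nice_beta.
rewrite /dens.
elim: (index_enum _) => [|y r IHr].
  rewrite big_nil -[RHS](mul0r (iter L (prep mu) (fun=> 0) [::])) -iter_prepZ; last exact: nice_cst.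
  by congr (iter L _ _ _); apply/funext => s; rewrite big_nil !mul0r.
rewrite big_cons -IHr -iter_prepZ// -iter_prepD.
- by congr (iter L _ _ _); apply/funext => s; rewrite big_cons mulrDl mulrA.
- by apply: niceM; [exact: nice_cst|].
- apply: niceM => //; apply: nice_sum => z _.
  by apply: niceM; [exact: nice_cst|exact: nice_beta].
Qed.

Definition lift_tuple L (f : L.-tuple X -> R) (s : seq X) : R := oapp f 0 (insub s).

Lemma lift_tupleE L f (t : L.-tuple X) : lift_tuple f t = f t.
Proof. by rewrite /lift_tuple valK. Qed.

Lemma lift_tuple_size L f s : size s = L -> exists t : L.-tuple X,
  t = s :> seq X /\ lift_tuple f s = f t.
Proof.
move=> sL; exists (Tuple (introT eqP sL)); split => //.
by rewrite -lift_tupleE.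
Qed.

Lemma nice_lift_tuple L (f : L.-tuple X -> R) : bm f -> nice (lift_tuple f).
Proof.
move=> bf m; have [<-|Lm] := eqVneq L m.
  by apply: bm_ext bf => t; rewrite lift_tupleE.
apply: bm_ext (bm_cst 0) => t; rewrite /lift_tuple insubF//.
by rewrite size_tuple eq_sym; exact: negbTE.
Qed.

Lemma hmm_meanD L f g : nice f -> nice g ->
  hmm_mean L (fun s => f s + g s) = hmm_mean L f + hmm_mean L g.
Proof.
move=> nf ng; rewrite /hmm_mean -big_split; apply: eq_bigr => z _ /=.
by rewrite -mulrDr -runD.
Qed.

Lemma hmm_meanZ L c f : nice f -> hmm_mean L (fun s => c * f s) = c * hmm_mean L f.
Proof.
move=> nf; rewrite /hmm_mean mulr_sumr; apply: eq_bigr => z _ /=.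
by rewrite [RHS]mulrCA; congr (_ * _); exact: (@runZ _ _ _ _ _ _ _ _ _ (fun _ => f)).
Qed.

Definition hmm_functional L : mean_functional (L.-tuple X) R.
Proof.
apply: (@Expectation _ _ _ (fun f => hmm_mean L (lift_tuple f))) => [f g bf bg|c f bf|f bf f0||f g B bf bg fB fg].
- rewrite -hmm_meanD; try exact: nice_lift_tuple.
  congr hmm_mean; apply/funext => s; rewrite /lift_tuple; case: insub => //=.
  by rewrite addr0.
- rewrite -hmm_meanZ; last exact: nice_lift_tuple.
  congr hmm_mean; apply/funext => s; rewrite /lift_tuple; case: insub => //=.
  by rewrite mulr0.
- apply: sumr_ge0 => z _; apply: mulr_ge0; first by case: hpi.
  apply: run_ge0 => // [_|y s sL]; first exact: nice_lift_tuple.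
  by have [t [_ ->]] := lift_tuple_size f sL.
- rewrite /hmm_mean; under eq_bigr => z _.
    rewrite (_ : run _ _ _ _ _ = 1); first over.
    rewrite -[RHS](run_cst E hM L z 1); apply: run_ext => y s sL.
    by have [t [_ ->]] := lift_tuple_size (fun _ : L.-tuple X => 1 : R) sL.
  by rewrite -mulr_suml mulr1; case: hpi.
- apply: cvg_sum_seq => z; apply: cvgM; first exact: cvg_cst.
  apply: (run_dct hM (B := B)).
  + by move=> i _; exact: nice_lift_tuple.
  + by move=> _; exact: nice_lift_tuple.
  + by move=> i _ s sL; have [t [_ ->]] := lift_tuple_size (f i) sL.
  + move=> _ s sL; have [t [ts ->]] := lift_tuple_size g sL.
    by rewrite -ts; under eq_fun do rewrite lift_tupleE; exact: fg.
Defined.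

Definition hmm_law L : probability (L.-tuple X) R := expec_prob (hmm_functional L).

Lemma mean_hmm_law L f : nice f -> mean (hmm_law L) (fun t => f t) = hmm_mean L f.
Proof.
move=> nf; rewrite mean_expec_prob; last exact: nf.
change (hmm_mean L (lift_tuple (fun t : L.-tuple X => f t)) = hmm_mean L f).
apply: eq_bigr => z _; congr (_ * _).
apply: run_ext => _ s sL.
by have [t [<- ->]] := lift_tuple_size (fun t : L.-tuple X => f t) sL.
Qed.

End hmm_law.

(** * Membership in the hidden Markov class *)

Section path_sum.
Context {R : realType} (k : nat).

Definition cons_ffun n (z0 : 'I_k) (z : {ffun 'I_n -> 'I_k}) : {ffun 'I_n.+1 -> 'I_k} :=
  [ffun i => if unlift ord0 i is Some j then z j else z0].

Lemma cons_ffun0 n z0 (z : {ffun 'I_n -> 'I_k}) : cons_ffun z0 z ord0 = z0.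
Proof. by rewrite ffunE unlift_none. Qed.

Lemma cons_ffunS n z0 (z : {ffun 'I_n -> 'I_k}) j : cons_ffun z0 z (lift ord0 j) = z j.
Proof. by rewrite ffunE liftK. Qed.

Lemma sum_cons_ffun n (F : {ffun 'I_n.+1 -> 'I_k} -> R) :
  \sum_z F z = \sum_z0 \sum_(z : {ffun 'I_n -> 'I_k}) F (cons_ffun z0 z).
Proof.
rewrite pair_bigA /=.
rewrite (reindex (fun p : 'I_k * {ffun 'I_n -> 'I_k} => cons_ffun p.1 p.2))//=.
exists (fun z : {ffun 'I_n.+1 -> 'I_k} => (z ord0, [ffun j => z (lift ord0 j)])).
  move=> [z0 z] _ /=; rewrite cons_ffun0; congr pair; apply/ffunP => j.
  by rewrite ffunE cons_ffunS.
move=> z _ /=; apply/ffunP => i; rewrite ffunE.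
by case: unliftP => [j ->|->]//; rewrite ffunE.
Qed.

(** The chain weight summed over paths, computed by the backward recursion;
[a t z] is the weight of being in [z] at time [t]. *)
Fixpoint path_mean (M : 'M[R]_k) (a : nat -> 'I_k -> R) (L : nat) (z : 'I_k) : R :=
  if L is L'.+1 then a 0%N z * \sum_y M z y * path_mean M (fun i => a i.+1) L' y else 1.

Lemma sum_chain_weight n (p : 'I_k -> R) (M : 'M[R]_k) (a : nat -> 'I_k -> R) :
  row_stochastic M ->
  \sum_(z : {ffun 'I_n.+1 -> 'I_k}) chain_weight p M z * \prod_(t < n.+1) a t (z t) =
  \sum_z p z * path_mean M a n.+1 z.
Proof.
move=> hM; elim: n p a => [|n IH] p a; rewrite sum_cons_ffun; apply: eq_bigr => z0 _.
  rewrite (eq_bigr (fun=> p z0 * (a 0%N z0))); last first.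
    by move=> z _; rewrite /chain_weight big_ord0 mulr1 big_ord1 cons_ffun0.
  rewrite sumr_const card_ffun !card_ord expn0 mulr1n /=.
  by under [in RHS]eq_bigr do rewrite mulr1; case: hM => _ ->; rewrite mulr1.
rewrite [path_mean _ _ _ _]/=.
rewrite -(IH (M z0) (fun i => a i.+1)) mulrA mulr_sumr; apply: eq_bigr => z _.
rewrite /chain_weight big_ord_recl [in X in _ * X]big_ord_recl /= cons_ffun0.
rewrite (_ : widen_ord _ ord0 = ord0); last exact: val_inj.
rewrite cons_ffun0 cons_ffunS.
rewrite (eq_bigr (fun t : 'I_n => M (z (widen_ord (leqnSn n) t)) (z (lift ord0 t)))); last first.
  move=> t _; rewrite cons_ffunS (_ : widen_ord _ _ = lift ord0 (widen_ord (leqnSn n) t)).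
    by rewrite cons_ffunS.
  exact: val_inj.
rewrite [in X in _ * (_ * X)](eq_bigr (fun t : 'I_n.+1 => a t.+1 (z t))); last first.
  by move=> t _; rewrite cons_ffunS.
by rewrite !mulrA; congr (_ * _); rewrite mulrAC; congr (_ * _); rewrite mulrAC.
Qed.

End path_sum.

Section rectangles.
Context {d} {X : measurableType d} {R : realType}.

Fixpoint rect_fun (A : nat -> set X) (s : seq X) : R :=
  if s is x :: s' then \1_(A 0%N) x * rect_fun (fun i => A i.+1) s' else 1.

Lemma rect_funE A L (t : L.-tuple X) : rect_fun A t = \prod_(i < L) \1_(A i) (tnth t i).
Proof.
elim: L A t => [|L IH] A t; first by rewrite tuple0 big_ord0.
case/tupleP: t => x t /=; rewrite big_ord_recl tnth0 IH; congr (_ * _).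
by apply: eq_bigr => i _; rewrite tnthS.
Qed.

Lemma nice_rect_fun A : (forall i, measurable (A i)) -> nice (rect_fun A).
Proof.
move=> mA L; apply: (bm_ext (f := fun t : L.-tuple X => \prod_(i < L) \1_(A i) (tnth t i))).
  by move=> t; rewrite rect_funE.
apply: bm_prod => i _.
exact: (bm_comp (u := fun t : L.-tuple X => tnth t i) (measurable_tnth i) (bm_indic (mA i))).
Qed.

Definition ext_sets L (A : 'I_L -> set X) (i : nat) : set X :=
  if insub i is Some j then A j else setT.

Lemma ext_setsE L (A : 'I_L -> set X) (i : 'I_L) : ext_sets A i = A i.
Proof. by rewrite /ext_sets valK. Qed.

Lemma measurable_ext_sets L (A : 'I_L -> set X) i :
  (forall j, measurable (A j)) -> measurable (ext_sets A i).
Proof. by rewrite /ext_sets; case: insub. Qed.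

Lemma indic_rectangle L (A : 'I_L -> set X) :
  \1_(rectangle A) = (fun t : L.-tuple X => rect_fun (ext_sets A) t).
Proof.
apply/funext => t; rewrite rect_funE.
have [tA|tA] := pselect (rectangle A t).
  by rewrite indicE mem_set// big1// => i _; rewrite ext_setsE indicE mem_set//; exact: tA.
rewrite indicE memNset//; have [i iA] : exists i, ~ A i (tnth t i).
  by apply: contra_notP tA => H i; apply: contrapT => Ai; apply: H; exists i.
by rewrite (bigD1 i)//= ext_setsE indicE memNset// mul0r.
Qed.

Lemma measurable_rectangle L (A : 'I_L -> set X) : (forall i, measurable (A i)) ->
  measurable (rectangle A).
Proof.
move=> mA; rewrite (_ : rectangle A = (\1_(rectangle A) : _ -> R) @^-1` [set 1]).
  rewrite -[X in measurable X]setTI indic_rectangle.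
  have mA' i : measurable (ext_sets A i) by exact: measurable_ext_sets.
  by case: (nice_rect_fun mA' L) => mr _; apply: mr => //; exact: measurable_set1.
apply/seteqP; split => t /=; rewrite indicE; first by move=> tA; rewrite mem_set.
by have [/set_mem//|_ /eqP] := boolP (t \in rectangle A); rewrite eq_sym oner_eq0.
Qed.

End rectangles.

Section hmm_membership.
Context {d} {X : measurableType d} {R : realType}.
Variables (k : nat) (E : 'I_k -> probability X R) (M : 'M[R]_k) (pi : 'I_k -> R).
Hypotheses (hM : row_stochastic M) (hpi : stationary_distribution M pi).

Lemma run_rect_fun A L z : (forall i, measurable (A i)) ->
  run E M L z (fun _ => rect_fun A) = path_mean M (fun i z => mean (E z) \1_(A i)) L z.
Proof.
elim: L A z => //= L IH A z mA.
rewrite -meanZr; last exact: bm_indic.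
congr mean; apply/funext => x; rewrite mulr_sumr; apply: eq_bigr => y _.
rewrite mulrCA -IH//; congr (_ * _).
by apply: (runZ E M L y _ (F := fun _ => _)) => _; exact: nice_rect_fun.
Qed.

Lemma hmm_law_HMM n (Q : set (probability X R)) : (forall z, Q (E z)) ->
  HMM n k Q (hmm_law E hM hpi n.+1).
Proof.
move=> QE; exists pi, M, E; split => // A mA.
set A' := ext_sets A.
have mA' i : measurable (A' i) by exact: measurable_ext_sets.
rewrite -mean_indic; last exact: (measurable_rectangle (R := R)).
rewrite indic_rectangle mean_hmm_law; last exact: nice_rect_fun.
rewrite /hmm_mean; under eq_bigr => z _ do rewrite run_rect_fun//.
rewrite -(sum_chain_weight _ _ _ hM) -(sumEFin (index_enum _) xpredT); apply: eq_bigr => z _.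
rewrite EFinM; congr (_ * _)%E; rewrite -prodEFin; apply: eq_bigr => i _.
by rewrite -[RHS]mean_indic// /A' ext_setsE.
Qed.

End hmm_membership.

(** * Conditional divergence against test functions *)

(** The integrand of a conditional divergence need not be measurable; the integral
of a nonnegative function is a supremum over simple minorants, hence monotone in
any case. *)
Lemma ge0_le_integral_nonmeas {d} {T : measurableType d} {R : realType}
    (mu : probability T R) (f g : T -> \bar R) :
  (forall x, (0 <= f x)%E) -> (forall x, (f x <= g x)%E) ->
  (\int[mu]_x f x <= \int[mu]_x g x)%E.
Proof.
move=> f0 fg; rewrite !ge0_integralTE// => [|x]; last exact: le_trans (fg x).
apply: le_ereal_sup => _ [h hf <-]; exists h => // x.
exact: le_trans (hf x) (fg x).
Qed.

Section conditional_risk.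
Context {d} {X : measurableType d} {R : realType} {n : nat}.
Variable P : probability (n.+1.-tuple X) R.

Lemma measurable_past : measurable_fun [set: n.+1.-tuple X] (@past X n).
Proof. exact: measurable_reindex. Qed.

Lemma measurable_present : measurable_fun [set: n.+1.-tuple X] (@present X n).
Proof. exact: measurable_tnth. Qed.

Lemma rcons_past_present (x : n.+1.-tuple X) : rcons (past x) (present x) = x :> seq X.
Proof.
apply: (@eq_from_nth _ (present x)); first by rewrite size_rcons !size_tuple.
move=> i; rewrite size_rcons size_tuple => iS.
rewrite nth_rcons size_tuple; have [i_n|n_i] := ltnP i n.
  by rewrite (nth_mktuple _ _ (Ordinal i_n)) (tnth_nth (present x)).
have -> : i = n by lia.
by rewrite eqxx {1}/present (tnth_nth (present x)).
Qed.

(** Both sides are expectations that agree on measurable rectangles. *)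
Lemma mean_cond_law (K : R.-pker (n.-tuple X) ~> X) (h : n.-tuple X * X -> R) :
  is_cond_law P K -> bm h ->
  mean P (fun x => h (past x, present x)) =
  mean P (fun x => mean (kernel_at K (past x)) (fun y => h (past x, y))).
Proof.
move=> PK bh.
have bj (f : n.-tuple X * X -> R) : bm f -> bm (fun x : n.+1.-tuple X => f (past x, present x)).
  apply: bm_comp; apply/measurable_fun_pairP; split.
    exact: measurable_past.
  exact: measurable_present.
have bk (f : n.-tuple X * X -> R) : bm f ->
    bm (fun x : n.+1.-tuple X => mean (kernel_at K (past x)) (fun y => f (past x, y))).
  move=> bf; apply: (bm_comp (u := @past X n)
    (f := fun w => mean (kernel_at K w) (fun y => f (w, y)))); first exact: measurable_past.
  exact: bm_mean_kernel.
have bs (f : n.-tuple X * X -> R) w : bm f -> bm (fun y => f (w, y)) by exact: bm_section.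
have [F1 F1E] : exists F : mean_functional (n.-tuple X * X)%type R,
    forall f, F f = mean P (fun x => f (past x, present x)).
  unshelve eexists.
  apply: (@Expectation _ _ _ (fun f => mean P (fun x => f (past x, present x)))).
  - by move=> f g bf bg; rewrite meanD//; exact: bj.
  - by move=> c f bf; rewrite meanZl//; exact: bj.
  - by move=> f bf f0; apply: mean_ge0.
  - exact: mean_cst.
  - move=> f g B bf bg fB fg; apply: (@mean_dct _ _ _ _ _ _ B) => // i.
    by case: (bj _ (bf i)).
  by [].
have [F2 F2E] : exists F : mean_functional (n.-tuple X * X)%type R, forall f,
    F f = mean P (fun x => mean (kernel_at K (past x)) (fun y => f (past x, y))).
  unshelve eexists.
  apply: (@Expectation _ _ _ (fun f =>
    mean P (fun x => mean (kernel_at K (past x)) (fun y => f (past x, y))))).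
  - move=> f g bf bg; rewrite -meanD; try exact: bk.
    by congr mean; apply/funext => x; rewrite meanD//; exact: bs.
  - move=> c f bf; rewrite -meanZl; try exact: bk.
    by congr mean; apply/funext => x; rewrite meanZl//; exact: bs.
  - by move=> f bf f0; apply: mean_ge0 => x; exact: mean_ge0.
  - by rewrite -[RHS](mean_cst P); congr mean; apply/funext => x; rewrite mean_cst.
  - move=> f g B bf bg fB fg; apply: (@mean_dct _ _ _ _ _ _ B) => [i|i x|x].
    + by case: (bk _ (bf i)).
    + by apply: mean_bound => //; exact: bs.
    + apply: (@mean_dct _ _ _ _ _ _ B) => // i.
      by have [] := bs _ (past x) (bf i).
  by [].
have := @mean_eq_pi_system _ _ _ [set A `*` B | A in measurable & B in measurable]
  (expec_prob F1) (expec_prob F2) (measurable_prod_measurableType _ _).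
move=> /(_ _ _ _ h) H; rewrite -F1E -F2E -(mean_expec_prob F1)// -(mean_expec_prob F2)//.
apply: H.
- move=> _ _ [A1 mA1 [B1 mB1 <-]] [A2 mA2 [B2 mB2 <-]].
  exists (A1 `&` A2); first exact: measurableI.
  by exists (B1 `&` B2); [exact: measurableI|rewrite setXI].
- by exists setT => //; exists setT => //; rewrite setXTT.
move=> _ [A mA [B mB <-]].
have mAB : measurable (A `*` B) by exact: measurableX.
rewrite -!mean_indic// !mean_expec_prob ?F1E ?F2E; try exact: bm_indic.
have iE w y : \1_(A `*` B) (w, y) = \1_A w * \1_B y :> R.
  by rewrite !indicE in_setX /=; case: (w \in A); rewrite ?mul1r ?mul0r.
have mpA : measurable (@past X n @^-1` A).
  by rewrite -[X in measurable X]setTI; exact: measurable_past.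
have mpB : measurable (@present X n @^-1` B).
  by rewrite -[X in measurable X]setTI; exact: measurable_present.
have := PK A B mA mB; rewrite -mean_indic; last exact: measurableI.
rewrite integral_mkcond.
have -> : ((fun x => K (past x) B) \_ (@past X n @^-1` A)) =
    (fun x => (\1_A (past x) * mean (kernel_at K (past x)) \1_B)%:E).
  apply/funext => x; rewrite patchE EFinM mean_indic// indicE.
  have -> : (x \in @past X n @^-1` A) = (past x \in A).
    by apply/idP/idP => [/set_mem/mem_set//|/set_mem h']; exact: mem_set.
  by case: (past x \in A); rewrite ?mul1e ?mul0e.
rewrite meanE; last first.
  apply: bmM.
    exact: (bm_comp (u := @past X n) measurable_past (bm_indic mA)).
  apply: bm_ext (bk (fun p => \1_B p.2) _) => //.
  by apply: bm_comp => //; exact: bm_indic.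
have -> : \1_(@past X n @^-1` A `&` @present X n @^-1` B) =
    (fun x : n.+1.-tuple X => \1_(A `*` B) (past x, present x)) :> (_ -> R).
  apply/funext => x; rewrite iE indicI /= !indicE; congr (_%:R * _%:R);
    by congr nat_of_bool; apply/idP/idP => [/set_mem/mem_set//|/set_mem h']; exact: mem_set.
move=> ->; congr (mean P _)%:E; apply/funext => x.
rewrite -meanZl; last exact: bm_indic.
by congr mean; apply/funext => y; rewrite iE.
Qed.

(** For any version [K'] of the conditional law, the divergence at each past is at
least the [K']-mean of [ln G], since [G] has mean [1] under the predictor. *)
Lemma cond_KL_test (K : R.-pker (n.-tuple X) ~> X) (rho : R) (G : seq X -> R) c :
  (cond_KL P K <= rho%:E)%E -> nice G -> 0 < c ->
  (forall t, size t = n.+1 -> c <= G t) ->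
  (forall w, size w = n -> step K G w = 1) ->
  mean P (fun t => ln (G t)) <= rho.
Proof.
move=> Krho nG c0 Gc KG.
have bG : bm (fun p : n.-tuple X * X => ln (G (rcons p.1 p.2))).
  apply: (bm_ln c0) => [p|]; last exact: bm_rcons_joint.
  by apply: Gc; rewrite size_rcons size_tuple.
apply/ler_addgt0Pr => e e0.
have /ereal_inf_ltP[_ [K' PK' <-] K'rho] : (cond_KL P K < (rho + e)%:E)%E.
  by rewrite (le_lt_trans Krho)// lte_fin ltrDl.
rewrite -lee_fin; apply: le_trans (ltW K'rho).
have -> : mean P (fun t => ln (G t)) =
    mean P (fun x => mean (kernel_at K' (past x)) (fun y => ln (G (rcons (past x) y)))).
  rewrite -(mean_cond_law PK' bG) /=; congr mean; apply/funext => t.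
  by rewrite rcons_past_present.
set g := fun x : n.+1.-tuple X => mean _ _.
have bg : bm g.
  apply: (bm_comp (u := @past X n)
    (f := fun w => mean (kernel_at K' w) (fun y => ln (G (rcons w y))))); first exact: measurable_past.
  exact: (bm_mean_kernel K' bG).
have bg0 : bm (fun x => Num.max (g x) 0).
  have [mg [B gB]] := bg; split; first by apply: measurable_maxr => //; exact: measurable_cst.
  exists `|B| => x; rewrite (le_trans _ (ler_norm B))//.
  by rewrite (le_trans _ (gB x))// maxEle; case: ifP => // _; rewrite normr0.
apply: (@le_trans _ _ (mean P (fun x => Num.max (g x) 0))%:E).
  by rewrite lee_fin; apply: mean_le => // x; rewrite le_max lexx.
rewrite -meanE//; apply: ge0_le_integral_nonmeas.
  by move=> x; rewrite lee_fin le_max lexx orbT.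
move=> x.
have [_|_] := leP (g x) 0; first exact: KL_ge0.
have := @KL_ge _ _ _ (kernel_at K' (past x)) (kernel_at K (past x))
  (fun y => ln (G (rcons (past x) y))) (bm_section (past x) bG).
rewrite (_ : mean (kernel_at K (past x)) _ = 1); first by rewrite ln1 subr0.
have sz : size (past x) = n by rewrite size_tuple.
rewrite -(KG _ sz) /step; have [w wE wp] := windowP (eq_leq (esym sz)).
rewrite wE; have -> : w = past x by apply: val_inj; rewrite /= wp sz subnn drop0.
congr mean; apply/funext => y; rewrite lnK// posrE (lt_le_trans c0)//.
by apply: Gc; rewrite size_rcons sz.
Qed.

End conditional_risk.

(** * A common dominating law *)

Section bounded_density.
Context {d} {X : measurableType d} {R : realType} (k : nat).
Variable E : 'I_k.+1 -> probability X R.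

Lemma average_law : exists mu : probability X R, forall f : X -> R, bm f ->
  k.+1%:R * mean mu f = \sum_z mean (E z) f.
Proof.
have k0 : k.+1%:R != 0 :> R by [].
have [L LE] : exists L : mean_functional X R,
    forall f, L f = k.+1%:R^-1 * \sum_z mean (E z) f.
  unshelve eexists.
  apply: (@Expectation _ _ _ (fun f => k.+1%:R^-1 * \sum_z mean (E z) f)).
  - move=> f g bf bg; rewrite -mulrDr -big_split; congr (_ * _).
    by apply: eq_bigr => z _; rewrite meanD.
  - move=> c f bf; rewrite (eq_bigr (fun z => c * mean (E z) f)) => [|z _].
      by rewrite -mulr_sumr mulrCA.
    by rewrite meanZl.
  - move=> f bf f0; apply: mulr_ge0; first by rewrite invr_ge0.
    by apply: sumr_ge0 => z _; exact: mean_ge0.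
  - rewrite (eq_bigr (fun=> 1)); last by move=> z _; rewrite mean_cst.
    by rewrite sumr_const card_ord mulVf.
  - move=> f g B bf bg fB fg; apply: cvgM; first exact: cvg_cst.
    apply: cvg_sum_seq => z; apply: (@mean_dct _ _ _ _ _ _ B) => // i.
    by case: (bf i).
  by [].
by exists (expec_prob L) => f bf; rewrite mean_expec_prob// LE mulrA divff// mul1r.
Qed.

(** With respect to the average of [k+1] laws each of them has a density at most
[k+1], off a null set; cutting the density off makes the bound hold
everywhere. *)
Lemma bounded_density : exists (mu : probability X R) (e : 'I_k.+1 -> X -> R),
  [/\ forall z, bm (e z), forall z x, 0 <= e z x, forall z x, e z x <= k.+1%:R,
    forall z, mean mu (e z) = 1 &
    forall z h, bm h -> mean (E z) h = mean mu (fun x => e z x * h x)].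
Proof.
have [mu muE] := average_law.
suff H z : exists e : X -> R, [/\ bm e, forall x, 0 <= e x, forall x, e x <= k.+1%:R &
    forall h, bm h -> mean (E z) h = mean mu (fun x => e x * h x)].
  have [e He] := choice H; exists mu, e; split => [z|z|z|z|z]; case: (He z) => // h1 h2 h3 h4.
  rewrite -[RHS](mean_cst (E z)) h4; last exact: bm_cst.
  by congr mean; apply/funext => x; rewrite mulr1.
pose K : R := k.+1%:R.
have K0 : 0 < K by [].
have Emu f : bm f -> (forall x, 0 <= f x) -> mean (E z) f <= K * mean mu f.
  move=> bf f0; rewrite /K muE// (bigD1 z)//= lerDl sumr_ge0// => i _.
  exact: mean_ge0.
have dom : E z `<< mu.
  apply/null_content_dominatesP => A mA A0.
  apply/eqP; rewrite eq_le measure_ge0 andbT -mean_indic//.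
  have A0' : mean mu \1_A = 0 by have := mean_indic mu mA; rewrite A0 => -[].
  rewrite lee_fin (le_trans (Emu _ _ _))//; [exact: bm_indic|by rewrite A0' mulr0].
have [r [mr r0 rE _]] := RN_real dom.
pose e x := Num.min (r x) K.
have me : measurable_fun setT e by apply: measurable_minr => //; exact: measurable_cst.
have e0 x : 0 <= e x by rewrite /e le_min r0 ltW.
have eK x : e x <= K by rewrite /e ge_min lexx orbT.
have be : bm e.
  by split => //; exists K => x; rewrite ger0_norm.
pose u x := r x - e x.
have u0 x : 0 <= u x by rewrite subr_ge0 /e ge_min lexx.
have mu_ : measurable_fun setT u by exact: measurable_funB.
pose A := [set x | K < r x].
have mA : measurable A.
  rewrite (_ : A = r @^-1` `]K, +oo[); first by rewrite -[X in measurable X]setTI; exact: mr.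
  by apply/seteqP; split => x /=; rewrite in_itv/= andbT.
have uA x : u x + K * \1_A x = r x * \1_A x.
  rewrite /u /e indicE; have [xA|xA] := ltP K (r x).
    by rewrite mem_set// !mulr1 subrK.
  by rewrite memNset ?mulr0 ?subrr ?addr0// /A /= => /lt_le_trans /(_ xA); rewrite ltxx.
have bA : bm (\1_A : X -> R) by exact: bm_indic.
have Iu : (\int[mu]_x (u x)%:E = 0)%E.
  have : (\int[mu]_x (u x)%:E + (K * mean mu \1_A)%:E = (mean (E z) \1_A)%:E)%E.
    rewrite -meanZl// -(@meanE _ _ _ mu); last by apply: bmM => //; exact: bm_cst.
    rewrite -ge0_integralD//.
    - rewrite -meanE// -rE.
      + by apply: eq_integral => x _; rewrite -EFinD uA EFinM muleC.
      + by move=> x; rewrite lee_fin indicE.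
      + by apply/measurable_EFinP; exact: measurable_indic.
    - by move=> x _; rewrite lee_fin.
    - exact/measurable_EFinP.
    - by move=> x _; rewrite lee_fin; apply: mulr_ge0; [exact: ltW|rewrite indicE].
    - by apply/measurable_EFinP; apply: measurable_funM => //; exact: measurable_indic.
  have I0 : (0 <= \int[mu]_x (u x)%:E)%E by apply: integral_ge0 => x _; rewrite lee_fin.
  have := Emu _ bA (fun x => ltac:(by rewrite indicE)).
  move: I0; case: (\int[mu]_x (u x)%:E)%E => [v| |]//.
  rewrite lee_fin => v0 Emu1 -[E1]; congr EFin; lra.
exists e; split => //.
have pos h : bm h -> (forall x, 0 <= h x) -> mean (E z) h = mean mu (fun x => e x * h x).
  move=> bh h0; have [mh [B hB]] := bh; apply: EFin_inj.
  rewrite -!meanE//; last exact: bmM.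
  rewrite -rE; last 2 first.
  - by move=> x; rewrite lee_fin.
  - exact/measurable_EFinP.
  have -> : (\int[mu]_x ((h x)%:E * (r x)%:E) =
     \int[mu]_x ((e x * h x)%:E + (u x * h x)%:E))%E.
    by apply: eq_integral => x _; rewrite -EFinM -EFinD /u; congr EFin; ring.
  rewrite ge0_integralD//; last 4 first.
  - by move=> x _; rewrite lee_fin mulr_ge0.
  - by apply/measurable_EFinP; exact: measurable_funM.
  - by move=> x _; rewrite lee_fin mulr_ge0.
  - by apply/measurable_EFinP; exact: measurable_funM.
  rewrite [X in (_ + X)%E](_ : _ = 0%E) ?adde0//; apply/eqP; rewrite eq_le; apply/andP; split.
    apply: (@le_trans _ _ (\int[mu]_x (`|B|%:E * (u x)%:E))%E).
      apply: ge0_le_integral_nonmeas => x; rewrite -?EFinM lee_fin ?mulr_ge0//.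
      rewrite mulrC ler_wpM2r// (le_trans _ (ler_norm B))//.
      by rewrite (le_trans (ler_norm _)).
    rewrite ge0_integralZl//; first by rewrite Iu mule0.
    - exact/measurable_EFinP.
    - by move=> x _; rewrite lee_fin.
  by apply: integral_ge0 => x _; rewrite lee_fin mulr_ge0.
move=> h bh; have [_ [B hB]] := bh.
have bB : bm (fun x => h x + B) by apply: bmD => //; exact: bm_cst.
have hB0 x : 0 <= h x + B by have := hB x; rewrite ler_norml => /andP[]; lra.
have := pos _ bB hB0.
rewrite meanD//; last exact: bm_cst.
have B0 (x : X) : 0 <= B by apply: le_trans (hB x).
have := pos _ (bm_cst 1) (fun=> ler01); rewrite !mean_cst => E1.
under [in RHS]eq_fun do rewrite mulrDr.
rewrite [RHS]meanD; [|exact: bmM|by apply: bmM => //; exact: bm_cst].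
rewrite meanZr//; have -> : mean mu e = 1.
  by rewrite E1; congr mean; apply/funext => x; rewrite mulr1.
by rewrite mul1r => /addIr.
Qed.

End bounded_density.

(** * Stationary laws of damped chains *)

Section damped.
Context {R : realType} (q : nat).

(** The stationary law [p] of the chain that follows [M] with probability [a] and
restarts from [nu] otherwise.  The system [p (1 - a M) = (1 - a) nu] is
invertible since [M] does not increase the [l1] norm; the solution has total mass
[1] and [l1] norm at most [1], so it is nonnegative. *)
Lemma damped_stationary (M : 'M[R]_q) (nu : 'I_q -> R) (a : R) :
  row_stochastic M -> (forall i, 0 <= nu i) -> \sum_i nu i = 1 -> 0 <= a < 1 ->
  exists p : 'I_q -> R, [/\ forall i, (1 - a) * nu i <= p i, \sum_i p i = 1 &
    forall j, p j = (1 - a) * nu j + a * \sum_i p i * M i j].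
Proof.
move=> [M0 M1] nu0 nu1 /andP[a0 a1].
have sumM (w : 'I_q -> R) : \sum_j \sum_i w i * M i j = \sum_i w i.
  rewrite exchange_big; apply: eq_bigr => i _.
  by rewrite -mulr_sumr M1 mulr1.
have absM (w : 'I_q -> R) (c : 'I_q -> R) : (forall j, w j = c j + a * \sum_i w i * M i j) ->
    (forall j, 0 <= c j) -> (1 - a) * \sum_j `|w j| <= \sum_j c j.
  move=> wE c0.
  have : \sum_j `|w j| <= \sum_j (c j + a * \sum_i `|w i| * M i j).
    apply: ler_sum => j _; rewrite [in leLHS]wE (le_trans (ler_normD _ _))//.
    rewrite ger0_norm// lerD2l normrM ger0_norm// ler_wpM2l// (le_trans (ler_norm_sum _ _ _))//.
    by apply: ler_sum => i _; rewrite normrM [`|M i j|]ger0_norm.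
  by rewrite big_split/= -mulr_sumr sumM; lra.
pose A : 'M[R]_q := 1%:M - a *: M.
have Aunit : A \in unitmx.
  rewrite -row_free_unit -kermx_eq0; apply/eqP/row_matrixP => i; rewrite row0.
  set v := row i (kermx A).
  have vA : v *m A = 0 by rewrite /v -row_mul mulmx_ker row0.
  have vE j : v ord0 j = 0 + a * \sum_i v ord0 i * M i j.
    rewrite add0r; move: vA; rewrite mulmxBr mulmx1 -scalemxAr => /eqP.
    by rewrite subr_eq0 => /eqP /matrixP /(_ ord0 j); rewrite !mxE.
  have := absM (fun j => v ord0 j) (fun=> 0) vE (fun=> lexx 0).
  rewrite big1_eq pmulr_rle0 ?subr_gt0// => S0.
  have S00 : \sum_j `|v ord0 j| = 0.
    by apply/eqP; rewrite eq_le S0 sumr_ge0.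
  apply/rowP => j; rewrite [RHS]mxE; apply/eqP; rewrite -normr_eq0; apply/eqP.
  exact: (psumr_eq0P (fun j _ => normr_ge0 (v ord0 j)) S00).
have [w wA] : exists w : 'rV[R]_q, w *m A = \row_j ((1 - a) * nu j).
  by exists ((\row_j ((1 - a) * nu j)) *m invmx A); rewrite mulmxKV.
pose p j := w ord0 j.
have pE j : p j = (1 - a) * nu j + a * \sum_i p i * M i j.
  move: wA; rewrite mulmxBr mulmx1 -scalemxAr => /matrixP /(_ ord0 j); rewrite !mxE => <-.
  by rewrite /p; ring.
have c0 j : 0 <= (1 - a) * nu j by rewrite mulr_ge0// subr_ge0 ltW.
have p1 : \sum_i p i = 1.
  have : \sum_j p j = \sum_j ((1 - a) * nu j + a * \sum_i p i * M i j) by apply: eq_bigr.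
  rewrite big_split/= -!mulr_sumr sumM nu1 mulr1 => E1.
  have a1' : 1 - a != 0 by rewrite subr_eq0 gt_eqF.
  by apply: (mulfI a1'); lra.
have pabs : \sum_j `|p j| <= 1.
  have := absM p _ pE c0; rewrite -mulr_sumr nu1 mulr1.
  by rewrite -[leRHS]mulr1 ler_pM2l// subr_gt0.
have p0 j : 0 <= p j.
  have S0 : \sum_j (`|p j| - p j) = 0.
    apply/eqP; rewrite eq_le sumrB p1 subr_le0 pabs/= -p1 subr_ge0.
    by apply: ler_sum => i _; exact: ler_norm.
  have h i : true -> 0 <= `|p i| - p i by move=> _; rewrite subr_ge0 ler_norm.
  have := psumr_eq0P h S0 (i := j) isT => /eqP; rewrite subr_eq0 => /eqP <-.
  exact: normr_ge0.
exists p; split => // i; rewrite [leRHS]pE lerDl mulr_ge0// sumr_ge0// => j _.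
exact: mulr_ge0.
Qed.

End damped.

(** * Iterated prediction *)

Section iterated_step.
Context {d} {X : measurableType d} {R : realType}.
Variables (n : nat) (K : R.-pker (n.-tuple X) ~> X).
Implicit Types (f g : seq X -> R) (s t : seq X).

Lemma nice_iter_step j f : nice f -> nice (iter j (step K) f).
Proof. by move=> nf; elim: j => // j IH; exact: nice_step. Qed.

Lemma iter_step_ext j f g s : (n <= size s)%N ->
  (forall t, size t = j -> f (s ++ t) = g (s ++ t)) ->
  iter j (step K) f s = iter j (step K) g s.
Proof.
elim: j s => [|j IH] s ns fg /=; first by have := fg [::] erefl; rewrite cats0.
apply: step_ext => // y; apply: IH; first by rewrite size_rcons (leq_trans ns).
by move=> t tj; rewrite cat_rcons; apply: fg; rewrite /= tj.
Qed.

Lemma iter_step_cst j c s : iter j (step K) (fun=> c) s = c.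
Proof.
elim: j s => // j IH s /=.
by rewrite -[RHS](step_cst K c s); congr step; apply/funext => t; rewrite IH.
Qed.

Lemma iter_stepD j f g s : nice f -> nice g ->
  iter j (step K) (fun s => f s + g s) s = iter j (step K) f s + iter j (step K) g s.
Proof.
move=> nf ng; elim: j s => // j IH s /=.
by rewrite -stepD; try exact: nice_iter_step; congr step; apply/funext => t; rewrite IH.
Qed.

Lemma iter_step_sum I (r : seq I) j (f : I -> seq X -> R) s : (forall i, nice (f i)) ->
  iter j (step K) (fun s => \sum_(i <- r) f i s) s = \sum_(i <- r) iter j (step K) (f i) s.
Proof.
move=> nf; elim: r => [|i r IH].
  rewrite big_nil -[RHS](iter_step_cst j 0 s); congr (iter j _ _ _).
  by apply/funext => t; rewrite big_nil.
rewrite big_cons -IH -iter_stepD//; last exact: nice_sum.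
by congr (iter j _ _ _); apply/funext => t; rewrite big_cons.
Qed.

Lemma iter_step_le j f g s : nice f -> nice g -> (forall t, f t <= g t) ->
  iter j (step K) f s <= iter j (step K) g s.
Proof.
move=> nf ng fg; elim: j s => // j IH s /=.
by apply: step_le => //; exact: nice_iter_step.
Qed.

Lemma step_takeM a f g s : nice f -> (n <= size s)%N -> (a <= size s)%N ->
  step K (fun t => g (take a t) * f t) s = g (take a s) * step K f s.
Proof.
move=> nf ns sa; rewrite -(step_drop_last K (fun t => g (take a t)))//.
apply: step_ext => // y; rewrite drop_last_rcons; congr (g _ * _).
by rewrite -cats1 takel_cat.
Qed.

Lemma iter_step_takeM j a f g s : nice f -> (n <= size s)%N -> (a <= size s)%N ->
  iter j (step K) (fun t => g (take a t) * f t) s = g (take a s) * iter j (step K) f s.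
Proof.
move=> nf; elim: j s => // j IH s ns sa /=.
rewrite -step_takeM//; last exact: nice_iter_step.
apply: step_ext => // y; rewrite IH// size_rcons; lia.
Qed.

Lemma step_drop T f s : (n + T <= size s)%N ->
  step K (fun t => f (drop T t)) s = step K f (drop T s).
Proof.
move=> ns; have ns1 : (n <= size s)%N by lia.
have ns2 : (n <= size (drop T s))%N by rewrite size_drop; lia.
have [w wE wv] := windowP ns1; have [w' wE' wv'] := windowP ns2.
have ww : w = w'.
  apply: val_inj; rewrite /= wv wv' size_drop drop_drop; congr drop; lia.
rewrite /step wE wE' -ww; congr mean; apply/funext => y.
by rewrite drop_rcons//; lia.
Qed.

Lemma iter_step_drop j T f s : (n + T <= size s)%N ->
  iter j (step K) (fun t => f (drop T t)) s = iter j (step K) f (drop T s).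
Proof.
elim: j s => // j IH s ns /=; rewrite -step_drop//.
apply: step_ext => [|y]; first by lia.
by rewrite IH// size_rcons; lia.
Qed.

End iterated_step.

Lemma stochastic1 {R : realType} : row_stochastic (1%:M : 'M[R]_1).
Proof.
split=> [i j|i]; first by rewrite mxE.
by rewrite big_ord1 mxE !ord1 eqxx.
Qed.

Section iid.
Context {d} {X : measurableType d} {R : realType}.
Variable E0 : probability X R.

Definition iid L (f : seq X -> R) : R :=
  run (fun _ : 'I_1 => E0) 1%:M L ord0 (fun _ => f).

Lemma iidS L f : iid L.+1 f = mean E0 (fun x => iid L (fun s => f (x :: s))).
Proof.
rewrite /iid /=; congr mean; apply/funext => x.
by rewrite big_ord1 mxE eqxx mul1r.
Qed.

Lemma iid_cat a b f : iid (a + b) f = iid a (fun s => iid b (fun t => f (s ++ t))).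
Proof.
rewrite /iid run_cat; apply: run_ext => y s _.
by rewrite !ord1.
Qed.

Lemma iid_drop T L f : nice f -> iid (T + L) (fun s => f (drop T s)) = iid L f.
Proof.
move=> nf; rewrite iid_cat -[RHS](run_cst (fun _ : 'I_1 => E0) stochastic1 T ord0).
by apply: run_ext => y s sT; apply: run_ext => y' t _; rewrite drop_size_cat.
Qed.

(** Jensen's inequality. *)
Lemma iid_ln_le L f c : nice f -> 0 < c -> (forall s, c <= f s) ->
  iid L (fun s => ln (f s)) <= ln (iid L f).
Proof.
move=> nf c0 cf; have fc : c <= iid L f.
  rewrite -[leLHS](run_cst (fun _ : 'I_1 => E0) stochastic1 L ord0); apply: run_le => //.
  + exact: stochastic1.
  + exact: snice_cst.
have If0 : 0 < iid L f by exact: lt_le_trans fc.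
have nln : nice (fun s => ln (f s)) by exact: (nice_ln (c := fun=> c)).
apply: (@le_trans _ _ (iid L (fun s => (ln (iid L f) - 1) + (iid L f)^-1 * f s))).
  apply: run_le => [|_|_|_ s _] //; first exact: stochastic1.
    by apply: niceD; [exact: nice_cst|apply: niceM => //; exact: nice_cst].
  have f0 : 0 < f s by exact: lt_le_trans (cf s).
  have -> : f s = iid L f * (f s / iid L f) by field; rewrite gt_eqF.
  rewrite lnM ?posrE ?divr_gt0// -addrA lerD2l.
  have := @ln_le_sub1 _ (f s / iid L f) (divr_gt0 f0 If0).
  by rewrite (mulrA (iid L f)^-1) mulVf ?gt_eqF// mul1r; lra.
rewrite /iid runD; [|exact: snice_cst|by move=> _; apply: niceM => //; exact: nice_cst].
rewrite run_cst; last exact: stochastic1.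
rewrite (@runZ _ _ _ _ _ _ _ _ _ (fun _ => f)); last by move=> _.
by rewrite -/(iid L f) mulVf ?gt_eqF//; lra.
Qed.

End iid.

(** * The chain with a waiting state *)

Section waiting_chain.
Context {R : realType} (q : nat).
Variables (M' : 'M[R]_q) (nu : 'I_q -> R) (p : R).
Hypotheses (hM' : row_stochastic M') (nu0 : forall i, 0 <= nu i) (nu1 : \sum_i nu i = 1)
  (p01 : 0 < p < 1).

(** State [ord0] is the waiting state.  It is left with probability [p], for a
state drawn from [nu], and entered from each active state with probability [p],
so that half of the stationary mass waits. *)
Definition wait_matrix : 'M[R]_q.+1 := \matrix_(z, z')
  match unlift ord0 z, unlift ord0 z' with
  | None, None => 1 - p
  | None, Some j => p * nu j
  | Some i, None => p
  | Some i, Some j => (1 - p) * M' i j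
  end.

Let p0 : 0 < p. Proof. by case/andP: p01. Qed.
Let p1 : 0 < 1 - p. Proof. by case/andP: p01 => _; rewrite subr_gt0. Qed.

Lemma wait_stochastic : row_stochastic wait_matrix.
Proof.
have [M0 M1] := hM'; split => [z z'|z].
  rewrite mxE; case: (unlift ord0 z) => [i|]; case: (unlift ord0 z') => [j|].
  - by apply: mulr_ge0; [exact: ltW|exact: M0].
  - exact: ltW.
  - by apply: mulr_ge0; [exact: ltW|exact: nu0].
  - exact: ltW.
rewrite big_ord_recl.
rewrite (eq_bigr (fun j => if unlift ord0 z is Some i then (1 - p) * M' i j else p * nu j)); last first.
  by move=> j _; rewrite mxE liftK; case: (unlift ord0 z).
rewrite mxE unlift_none; case: (unlift ord0 z) => [i|].
  by rewrite -mulr_sumr M1; lra.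
by rewrite -mulr_sumr nu1; lra.
Qed.

Lemma wait_stationary : exists pi : 'I_q.+1 -> R,
  [/\ stationary_distribution wait_matrix pi, pi ord0 = 2^-1 &
      forall i, p * nu i / 2 <= pi (lift ord0 i)].
Proof.
have a01 : 0 <= 1 - p < 1 by rewrite (ltW p1)/= ltrBlDr ltrDl.
have [w [wnu w1 wE]] := damped_stationary hM' nu0 nu1 a01.
have p1E : 1 - (1 - p) = p by lra.
rewrite p1E in wnu wE.
pose pi z := if unlift ord0 z is Some i then w i / 2 else 2^-1.
have piS i : pi (lift ord0 i) = w i / 2 by rewrite /pi liftK.
have pi0 : pi ord0 = 2^-1 by rewrite /pi unlift_none.
have w0 i : 0 <= w i by rewrite (le_trans _ (wnu i))// mulr_ge0// ltW.
exists pi; split => //; last by move=> i; rewrite piS ler_pM2r.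
split => [z||z].
- by rewrite /pi; case: (unlift ord0 z) => [i|]; rewrite ?divr_ge0 ?invr_ge0.
- rewrite big_ord_recl pi0; under eq_bigr do rewrite piS.
  by rewrite -mulr_suml w1; lra.
- rewrite big_ord_recl pi0; under eq_bigr do rewrite piS mxE liftK.
  rewrite mxE unlift_none.
  case: unliftP => [j ->|->].
    rewrite piS [in RHS]wE.
    rewrite (eq_bigr (fun i => (1 - p) / 2 * (w i * M' i j))); last by move=> i _; ring.
    by rewrite -mulr_sumr; ring.
  rewrite (eq_bigr (fun i => w i * (p / 2))); last by move=> i _; ring.
  by rewrite -mulr_suml w1 pi0; ring.
Qed.

Context {d} {X : measurableType d}.
Variables (E0 : probability X R) (E' : 'I_q -> probability X R).

Definition wait_emission (z : 'I_q.+1) : probability X R :=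
  if unlift ord0 z is Some i then E' i else E0.

Notation runW := (run wait_emission wait_matrix).

Lemma run_wait0 L F : runW L.+1 ord0 F =
  mean E0 (fun x => (1 - p) * runW L ord0 (fun y s => F y (x :: s)) +
    \sum_i p * nu i * runW L (lift ord0 i) (fun y s => F y (x :: s))).
Proof.
rewrite /= {1}/wait_emission unlift_none; congr mean; apply/funext => x.
rewrite big_ord_recl mxE !unlift_none; congr (_ + _); apply: eq_bigr => i _.
by rewrite mxE unlift_none liftK.
Qed.

Lemma run_wait_ge0 L z F : snice F -> (forall y s, 0 <= F y s) -> 0 <= runW L z F.
Proof. by move=> nF F0; apply: run_ge0 => //; exact: wait_stochastic. Qed.

(** Decomposition over the time [j+1] at which the chain leaves the waiting state,
for the state [i0]. *)
Lemma wait_lower L (i0 : 'I_q) F : snice F -> (forall y s, 0 <= F y s) ->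
  \sum_(j < L) (1 - p) ^+ j * (p * nu i0 *
     iid E0 j.+1 (fun u => runW (L - j.+1) (lift ord0 i0) (fun y t => F y (u ++ t))))
  <= runW L ord0 F.
Proof.
elim: L F => [|L IH] F nF F0; first by rewrite big_ord0; exact: F0.
rewrite run_wait0 big_ord_recl expr0 mul1r.
have nFx x : snice (fun y s => F y (x :: s)) by exact: snice_cons.
have bi j : bm (fun x => iid E0 j.+1 (fun u =>
    runW (L - j.+1) (lift ord0 i0) (fun y t => F y (x :: (u ++ t))))).
  pose G := fun (_ : 'I_1) s => runW (L - j.+1) (lift ord0 i0) (fun y t => F y (s ++ t)).
  apply: (@bm_run_cons _ _ _ _ _ _ G) => z.
  exact: (nice_run_cat wait_emission wait_matrix _ nF).
have b0 z : bm (fun x => runW L z (fun y t => F y (x :: t))) by exact: bm_run_cons.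
pose S x := \sum_(j < L) (1 - p) ^+ j * (p * nu i0 *
     iid E0 j.+1 (fun u => runW (L - j.+1) (lift ord0 i0) (fun y t => F y (x :: u ++ t)))).
have bS : bm S.
  by apply: bm_sum => j _; apply: bmM; [exact: bm_cst|apply: bmM => //; exact: bm_cst].
have -> : p * nu i0 * iid E0 1 (fun u => runW (L.+1 - 1) (lift ord0 i0) (fun y t => F y (u ++ t)))
   + \sum_(i < L) (1 - p) ^+ lift ord0 i * (p * nu i0 * iid E0 (lift ord0 i).+1
       (fun u => runW (L.+1 - (lift ord0 i).+1) (lift ord0 i0) (fun y t => F y (u ++ t)))) =
  mean E0 (fun x => (1 - p) * S x + p * nu i0 * runW L (lift ord0 i0) (fun y t => F y (x :: t))).
  rewrite meanD; last 2 first.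
  - by apply: bmM => //; exact: bm_cst.
  - by apply: bmM => //; exact: bm_cst.
  rewrite !meanZl// addrC /S mean_sum; last first.
    by move=> j _; apply: bmM; [exact: bm_cst|apply: bmM => //; exact: bm_cst].
  congr (_ + _); last by rewrite iidS subn1.
  rewrite mulr_sumr; apply: eq_bigr => j _.
  rewrite meanZl; last by apply: bmM => //; exact: bm_cst.
  by rewrite meanZl// lift0 iidS subSS exprS -!mulrA.
apply: mean_le => [||x].
- apply: bmD; first by apply: bmM => //; exact: bm_cst.
  by apply: bmM => //; exact: bm_cst.
- apply: bmD; first by apply: bmM => //; exact: bm_cst.
  by apply: bm_sum => i _; apply: bmM => //; exact: bm_cst.
apply: lerD.
  by apply: ler_wpM2l; [exact: ltW|apply: IH].
rewrite (bigD1 i0)//= lerDl; apply: sumr_ge0 => i _.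
by apply: mulr_ge0; [apply: mulr_ge0 => //; exact: ltW|exact: run_wait_ge0].
Qed.

Lemma wait_emissionS i : wait_emission (lift ord0 i) = E' i.
Proof. by rewrite /wait_emission liftK. Qed.

(** The chain stays active for [m] steps with probability [(1 - p) ^+ m], and then
moves as the active chain. *)
Lemma active_lower m i (F : 'I_q -> seq X -> R) (G : 'I_q.+1 -> seq X -> R) :
  snice F -> snice G ->
  (forall y s, 0 <= F y s) -> (forall y s, 0 <= G y s) ->
  (forall y s, size s = m -> F y s <= G (lift ord0 y) s) ->
  (1 - p) ^+ m * run E' M' m i F <= runW m (lift ord0 i) G.
Proof.
elim: m i F G => [|m IH] i F G nF nG F0 G0 FG /=; first by rewrite expr0 mul1r; exact: FG.
rewrite wait_emissionS -meanZl; last first.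
  by apply: bm_sum => y _; apply: bmM; [exact: bm_cst|exact: bm_run_cons].
apply: mean_le => [||x].
- apply: bmM; first exact: bm_cst.
  by apply: bm_sum => y _; apply: bmM; [exact: bm_cst|exact: bm_run_cons].
- by apply: bm_sum => y _; apply: bmM; [exact: bm_cst|exact: bm_run_cons].
rewrite big_ord_recl mulr_sumr -[leLHS]add0r; apply: lerD.
  apply: mulr_ge0; first by case: wait_stochastic.
  by apply: run_wait_ge0 => //; exact: snice_cons.
apply: ler_sum => y _; rewrite mxE !liftK exprS.
rewrite -[leLHS]mulrA -[leRHS]mulrA; apply: ler_wpM2l; first exact: ltW.
rewrite mulrCA.
apply: ler_wpM2l; first by case: hM'.
apply: IH => //; try exact: snice_cons.
by move=> y' s sm; apply: FG; rewrite /= sm.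
Qed.

End waiting_chain.

(** * The forecast and its regret *)

Lemma sum_ge_window {R : realType} (a : nat -> R) (c : R) (i l N : nat) : (i + l <= N)%N ->
  (forall j, 0 <= a j) -> (forall j, (i <= j < i + l)%N -> c <= a j) ->
  l%:R * c <= \sum_(j < N) a j.
Proof.
move=> iN a0 ac; rewrite -(big_mkord xpredT a) (@big_cat_nat _ _ _ i)//=; last by lia.
rewrite (@big_cat_nat _ _ _ (i + l) i N)//=; last by lia.
rewrite -[leLHS]add0r lerD ?sumr_ge0// -[leLHS]addr0 lerD ?sumr_ge0//.
have -> : l%:R * c = \sum_(i <= j < i + l) c.
  by rewrite sumr_const_nat addKn mulr_natl.
by apply: ler_sum_nat.
Qed.

Section core.
Context {d} {X : measurableType d} {R : realType} (q n : nat).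
Variables (Q : set (probability X R)) (E0 : probability X R) (E' : 'I_q.+1 -> probability X R)
  (M' : 'M[R]_q.+1) (K : R.-pker (n.-tuple X) ~> X) (rho : R) (m : nat).
Hypotheses (QE0 : Q E0) (QE' : forall i, Q (E' i)) (hM' : row_stochastic M')
  (n2 : (0 < n)%N) (mn : (m <= n)%N)
  (Krho : forall P, HMM n q.+2 Q P -> (cond_KL P K <= rho%:E)%E).

Definition forecast (f : seq X -> R) : R :=
  iid E0 n (iter m (step K) (fun s => f (drop n s))).

Variables (h : seq X -> R) (B : R).
Hypotheses (nh : nice h) (hB : forall s, `|h s| <= B).

(* The normalization of [expR h] under the predictor, given a window. *)
Let H0 := iter m (step K) (fun s => expR (h (drop n s))).
Let neh : nice (fun s => expR (h (drop n s))).
Proof. exact: (nice_drop n (nice_expR nh)). Qed.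
Let nH0 : nice H0. Proof. exact: nice_iter_step. Qed.
Let H0_ge s : expR (- B) <= H0 s.
Proof.
rewrite -(iter_step_cst K m (expR (- B)) s); apply: iter_step_le => //; first exact: nice_cst.
by move=> t; rewrite ler_expR; have := hB (drop n t); rewrite ler_norml => /andP[].
Qed.
Let H0_gt0 s : 0 < H0 s. Proof. exact: lt_le_trans (expR_gt0 _) (H0_ge s). Qed.
Let nlnH0 : nice (fun s => ln (H0 s)).
Proof. exact: (nice_ln (c := fun=> expR (- B)) (fun=> expR_gt0 _)). Qed.

(* [expR (score T)] is the likelihood ratio for a switch at time [n + T]: it tests
   [h] on the [m] observations after the switch, given the [n] preceding ones. *)
Let score T s := h (take m (drop (n + T) s)) - ln (H0 (take n (drop T s))).
Let nscore T : nice (score T).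
Proof.
apply: niceB; first exact: (nice_drop _ (nice_take m nh)).
exact: (nice_drop _ (nice_take n nlnH0)).
Qed.
(* The mixture over switching times; the summand [1] keeps [ln Phi] nonnegative. *)
Let Phi s := 1 + \sum_(T < n) expR (score T s).
Let nPhi : nice Phi.
Proof.
apply: niceD; first exact: nice_cst.
by apply: nice_sum => T _; exact: nice_expR.
Qed.
Let Phi_ge1 s : 1 <= Phi s.
Proof. by rewrite lerDl sumr_ge0// => T _; exact: expR_ge0. Qed.
Let Phi_score (T : 'I_n) s : expR (score T s) <= Phi s.
Proof.
rewrite /Phi (bigD1 T)//= addrCA lerDl addr_ge0// sumr_ge0// => i _; exact: expR_ge0.
Qed.
Let nlnPhi : nice (fun s => ln (Phi s)).
Proof. exact: (nice_ln (c := fun=> 1)). Qed.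
Let lnPhi_ge0 s : 0 <= ln (Phi s). Proof. exact: ln_ge0. Qed.

(** Predictions after the [m] tested observations leave the score unchanged, the
[m] predictions of these observations normalize [expR h], and the earlier ones
see the constant [1]. *)
Lemma score_step (T : nat) w : (T < n)%N -> size w = n ->
  iter n.*2 (step K) (fun s => expR (score T s)) w = 1.
Proof.
move=> Tn wn.
have -> : n.*2 = (T + (m + (n.*2 - (T + m))))%N by lia.
rewrite iterD iterD.
pose g1 v := (H0 (drop T v))^-1; pose f1 v := expR (h (drop (n + T) v)).
have scoreE s : size s = (n + T + m)%N -> expR (score T s) = g1 (take (n + T) s) * f1 s.
  move=> sE; rewrite /score expRB lnK ?posrE// [LHS]mulrC /g1 /f1; congr (_^-1 * _).
    by rewrite take_drop addnC.
  by rewrite (take_oversize (s := drop (n + T) s))// size_drop sE; lia.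
rewrite -[RHS](iter_step_cst K T 1 w); apply: iter_step_ext; first by rewrite wn.
move=> t tT; set s := w ++ t; have sE : size s = (n + T)%N by rewrite size_cat wn tT.
transitivity (iter m (step K) (fun v => g1 (take (n + T) v) * f1 v) s).
  apply: iter_step_ext; first by lia.
  move=> u um; have suE : size (s ++ u) = (n + T + m)%N by rewrite size_cat sE um.
  rewrite -scoreE//.
  have -> : (fun v => expR (score T v)) = (fun v => expR (score T (take (n + T + m) v)) * 1).
    apply/funext => v; rewrite mulr1 /score.
    have -> : take m (drop (n + T) (take (n + T + m) v)) = take m (drop (n + T) v).
      by rewrite (addnC _ m) -take_drop take_takel.
    have -> // : take n (drop T (take (n + T + m) v)) = take n (drop T v).
    have -> : (n + T + m = n + m + T)%N by lia.
    by rewrite -take_drop take_takel// leq_addr.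
  rewrite (iter_step_takeM K _ (a := n + T + m) (fun v => expR (score T v)) (nice_cst 1)); try lia.
  by rewrite iter_step_cst mulr1 take_oversize// suE.
have nf1 : nice f1 by exact: nice_drop (nice_expR nh).
rewrite iter_step_takeM//; try lia.
rewrite take_oversize ?sE// /f1.
have -> : (fun v => expR (h (drop (n + T) v))) = (fun v => expR (h (drop n (drop T v)))).
  by apply/funext => v; rewrite drop_drop.
rewrite (iter_step_drop K m (fun v => expR (h (drop n v)))) ?sE//.
by rewrite /g1 -/H0 mulVf// gt_eqF.
Qed.

(* Over the [3 n] steps considered no change of mode occurs with probability at
   least [1 - 3 n p = 1/2]. *)
Let p : R := (6 * n%:R)^-1.
Let n0 : 0 < n%:R :> R. Proof. by rewrite ltr0n. Qed.
Let p01 : 0 < p < 1.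
Proof.
have n1 : 1 <= n%:R :> R by rewrite ler1n.
apply/andP; split; first by rewrite invr_gt0 mulr_gt0.
rewrite invf_lt1 ?mulr_gt0//; lra.
Qed.
(* Half of the mass at the initial state of the active chain, and the other half
   spread so that every state has stationary mass of order [p / q]. *)
Let nu (i : 'I_q.+1) : R := ((i == ord0)%:R + q.+1%:R^-1) / 2.
Let nu0 i : 0 <= nu i.
Proof. by rewrite /nu divr_ge0// addr_ge0// invr_ge0. Qed.
Let nu1 : \sum_i nu i = 1.
Proof.
rewrite -mulr_suml big_split/= sumr_const card_ord -[X in _ + X]mulr_natr mulVf//.
by rewrite (bigD1 ord0)//= big1 ?addr0 => [|i /negbTE ->//]; rewrite mulfV.
Qed.

Let Ew := wait_emission E0 E'.
Let Mw := wait_matrix M' nu p.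
Let hMw : row_stochastic Mw. Proof. exact: (wait_stochastic hM' nu0 nu1 p01). Qed.

Let g := run E' M' m ord0 (fun _ => h) - ln (forecast (fun s => expR (h s))).

Lemma stay_prob j : (j <= n.*2 + n)%N -> 2^-1 <= (1 - p) ^+ j.
Proof.
move=> jn; have p0 : 0 < p by case/andP: p01.
have p1 : p < 1 by case/andP: p01.
have bern i : 1 - i%:R * p <= (1 - p) ^+ i.
  elim: i => [|i IH]; first by rewrite mul0r subr0 expr0.
  rewrite exprS -natr1; have := ler_wpM2l (_ : 0 <= 1 - p) IH.
  rewrite subr_ge0 => /(_ (ltW p1)); apply: le_trans.
  have : 0 <= i%:R * p * p by rewrite !mulr_ge0// ltW.
  by nra.
apply: le_trans (bern j).
have : j%:R * p <= 2^-1.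
  rewrite /p ler_pdivrMr ?mulr_gt0//.
  have : (j%:R : R) <= (n.*2 + n)%:R by rewrite ler_nat.
  rewrite natrD -addnn natrD; lra.
lra.
Qed.

(** After a switch at time [n + T] the mean of [ln Phi] is at least that of the
score with this [T]; the normalization is averaged over the past by Jensen's
inequality, which turns it into the forecast. *)
Lemma window_score T : (T < n)%N -> (1 - p) ^+ m * g <=
  iid E0 (n + T) (fun u => run Ew Mw (n + n.*2 - (n + T)) (lift ord0 ord0)
                             (fun _ t => ln (Phi (u ++ t)))).
Proof.
move=> Tn; have p1 : 0 < 1 - p by case/andP: p01 => _; rewrite subr_gt0.
have -> : (n + n.*2 - (n + T) = m + (n.*2 - T - m))%N by lia.
set r := (n.*2 - T - m)%N.
pose Y := run E' M' m ord0 (fun _ => h).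
have nlnd : nice (fun u => ln (H0 (drop T u))) by exact: (nice_drop T nlnH0).
have low u : size u = (n + T)%N -> (1 - p) ^+ m * (Y - ln (H0 (drop T u))) <=
    run Ew Mw (m + r) (lift ord0 ord0) (fun _ t => ln (Phi (u ++ t))).
  move=> uE; rewrite run_cat.
  pose c := ln (H0 (drop T u)).
  (* nonnegative, as the lower bound of probabilities requires, and still below
     [ln Phi] *)
  pose F (_ : 'I_q.+1) s := Num.max 0 (h s - c).
  have nF : snice F.
    move=> z L; have [mh [b hb]] := niceB nh (nice_cst c) L; split.
      by apply: measurable_maxr => //; exact: measurable_cst.
    exists `|b| => t; rewrite (le_trans _ (ler_norm b))// (le_trans _ (hb t))//.
    by rewrite /F; have [_|_] := leP 0 (h t - c); rewrite ?normr0.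
  apply: (@le_trans _ _ ((1 - p) ^+ m * run E' M' m ord0 F)).
    apply: ler_wpM2l; first exact/exprn_ge0/ltW.
    rewrite /Y /c; apply: (@le_trans _ _ (run E' M' m ord0 (fun _ s => - c + h s))).
      rewrite runD; [|exact: snice_cst|by move=> _].
      by rewrite run_cst// addrC.
    apply: run_le => // [_|y s _]; last by rewrite /F le_max addrC lexx orbT.
    by apply: niceD => //; exact: nice_cst.
  have nlu (s : seq X) : snice (fun (_ : 'I_q.+2) t => ln (Phi (s ++ t))).
    by apply: (@snice_cat _ _ _ _ (fun _ s => ln (Phi s))) => _.
  apply: active_lower => //.
  - move=> z; apply: (nice_run_cat Ew Mw r (F := fun _ s => ln (Phi (u ++ s)))).
    exact: nlu.
  - by move=> y s; rewrite /F le_max lexx.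
  - move=> y s; apply: (run_ge0 Ew hMw) => [z|_ t _]; last exact: lnPhi_ge0.
    by apply: nice_ext (nlu (u ++ s) z) => t; rewrite catA.
  move=> y s sm; rewrite /F ge_max; apply/andP; split.
    apply: (run_ge0 Ew hMw) => [z|_ t _]; last exact: lnPhi_ge0.
    by apply: nice_ext (nlu (u ++ s) z) => t; rewrite catA.
  rewrite -[leLHS](run_cst Ew hMw r (lift ord0 y)); apply: (run_le Ew hMw).
  - exact: snice_cst.
  - by move=> z; apply: nice_ext (nlu (u ++ s) z) => t; rewrite catA.
  move=> _ t _; have := Phi_score (Ordinal Tn) (u ++ (s ++ t)).
  rewrite -ler_ln ?posrE ?expR_gt0 ?(lt_le_trans ltr01)// expRK; apply: le_trans.
  rewrite /score /= drop_size_cat// take_size_cat// /c drop_cat uE.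
  case: ltnP => [_|h1]; last by lia.
  by rewrite take_size_cat// size_drop uE addnK.
apply: (@le_trans _ _ (iid E0 (n + T) (fun u => (1 - p) ^+ m * (Y + - ln (H0 (drop T u)))))).
  have nYl : nice (fun u => Y + - ln (H0 (drop T u))).
    by apply: niceD; [exact: nice_cst|exact: niceN].
  rewrite /iid (@runZ _ _ _ _ _ _ _ _ _ (fun _ u => Y + - ln (H0 (drop T u)))); last by move=> _.
  rewrite runD; [|exact: snice_cst|by move=> _; exact: niceN].
  rewrite (run_cst (fun=> E0) stochastic1).
  apply: ler_wpM2l; first exact/exprn_ge0/ltW.
  rewrite /g -/Y lerD2l.
  have -> : run (fun=> E0) 1%:M (n + T) ord0 (fun (_ : 'I_1) u => - ln (H0 (drop T u))) =
     - iid E0 (n + T) (fun u => ln (H0 (drop T u))).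
    rewrite /iid -mulN1r -(@runZ _ _ _ _ _ _ _ _ _ (fun _ u => ln (H0 (drop T u)))); last by move=> _.
    by apply: run_ext => y s _; rewrite mulN1r.
  rewrite lerN2 addnC (iid_drop E0 T n (f := fun u => ln (H0 u)))//.
  exact: (iid_ln_le E0 n nH0 (expR_gt0 (- B))).
apply: run_le => //; first exact: stochastic1.
- move=> _; apply: niceM; first exact: nice_cst.
  by apply: niceD; [exact: nice_cst|exact: niceN].
- move=> _; apply: (nice_run_cat Ew Mw (m + r) (F := fun _ s => ln (Phi s))).
  by move=> _.
Qed.

(** The [ln Phi] of the mixture has mean at most the right-hand side, by transport
of predictions, and at least [g / 48]: the stationary chain waits with
probability [1/2], it leaves for the state [ord0] of the active chain at one of
[n] possible times, with probability at least [p / 2] each, and the mode does not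
change otherwise with probability at least [1/2].  The sign of [g] matters since
lower bounds of probabilities multiply it. *)
Lemma nonneg_regret_le : 0 <= g ->
  g <= 48 * ((n.*2)%:R * rho + ln n.+1%:R + 2 * ln (24 * n%:R * q.+1%:R)).
Proof.
move=> g0; have p0 : 0 < p by case/andP: p01.
have p1 : 0 < 1 - p by case/andP: p01 => _; rewrite subr_gt0.
have [pi [hpi pi0 piS]] := wait_stationary hM' nu0 nu1 p01.
have [mu [e [be e0 eC e1 eE]]] := bounded_density Ew.
have C0 : 0 < q.+2%:R :> R by [].
pose P := hmm_law Ew hMw hpi n.+1.
have QEw z : Q (Ew z) by rewrite /Ew /wait_emission; case: (unlift ord0 z).
have PK : (cond_KL P K <= rho%:E)%E by apply: Krho; exact: hmm_law_HMM.
have Krisk (G : seq X -> R) : nice G ->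
    (exists2 c, 0 < c & forall t, size t = n.+1 -> c <= G t) ->
    (forall w, size w = n -> step K G w = 1) -> dens_mean pi Mw e mu n.+1 (fun t => ln (G t)) <= rho.
  move=> nG [c c0 Gc] KG; have := cond_KL_test PK nG c0 Gc KG.
  pose G' s := if size s == n.+1 then G s else 1.
  have nG' : nice G' by apply: (nice_if_size (eq_op^~ n.+1)) => //; exact: nice_cst.
  have G'c s : Num.min c 1 <= G' s.
    rewrite /G'; case: eqP => [sn|_]; rewrite ge_min ?lexx ?orbT//.
    by rewrite Gc.
  have nlG' : nice (fun s => ln (G' s)).
    by apply: (nice_ln (c := fun=> Num.min c 1)) => // _; rewrite lt_min c0 ltr01.
  have -> : (fun t : n.+1.-tuple X => ln (G t)) = (fun t => ln (G' t)).
    by apply/funext => t; rewrite /G' size_tuple eqxx.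
  rewrite /P (mean_hmm_law _ _ _ _ nlG') -(dens_mean_hmm _ _ _ be eE)//.
  suff -> : dens_mean pi Mw e mu n.+1 (fun s => ln (G' s)) = dens_mean pi Mw e mu n.+1 (fun s => ln (G s)) by [].
  have ext j (f1 f2 : seq X -> R) t : (forall u, size u = j -> f1 (u ++ t) = f2 (u ++ t)) ->
      iter j (prep mu) f1 t = iter j (prep mu) f2 t.
    elim: j t => [|j IH] t ff /=; first exact: (ff [::]).
    rewrite /prep; congr mean; apply/funext => x; apply: IH => u uj.
    by rewrite -cat_rcons; apply: ff; rewrite size_rcons uj.
  by apply: ext => u un; rewrite cats0 /G' un eqxx.
have Phi_n w : size w = n -> iter n.*2 (step K) Phi w <= n.+1%:R.
  move=> wn; rewrite /Phi iter_stepD; last 2 first.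
  - exact: nice_cst.
  - by apply: nice_sum => T _; exact: nice_expR.
  rewrite iter_step_cst iter_step_sum; last by move=> T; exact: nice_expR.
  under eq_bigr => T _ do rewrite score_step//.
  by rewrite sumr_const card_ord -natr1 addrC.
have piC z : 1 <= (24 * n%:R * q.+1%:R) * pi z.
  have qn : 0 < 24 * n%:R * q.+1%:R :> R by rewrite !mulr_gt0.
  rewrite -ler_pdivrMl// mulr1.
  case: (unliftP ord0 z) => [i ->|->].
    apply: le_trans (piS i); rewrite /nu /p.
    have -> : (24 * n%:R * q.+1%:R)^-1 = (6 * n%:R)^-1 * (q.+1%:R^-1 / 2) / 2 :> R.
      by field; rewrite !gt_eqF.
    rewrite ler_pM2r// ler_wpM2l ?invr_ge0 ?mulr_ge0// ler_pM2r// lerDr//.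
  rewrite pi0 lef_pV2 ?posrE//.
  have n1 : 1 <= n%:R :> R by rewrite ler1n.
  have q1 : 1 <= q.+1%:R :> R by rewrite ler1n.
  by nra.
have up := prediction_transport hMw hpi be e0 eC C0 e1 Krisk nPhi Phi_ge1 Phi_n.
have mem := neg_entropy_memory hMw hpi be e0 eC C0 e1 piC n.
have lo : g / 48 <= dens_mean pi Mw e mu (n + n.*2) (fun s => ln (Phi s)).
  rewrite (dens_mean_hmm _ _ _ be eE)// /hmm_mean (bigD1 ord0)//= pi0.
  have rest : 0 <= \sum_(i < q.+2 | i != ord0) pi i * run Ew Mw (n + n.*2) i (fun _ s => ln (Phi s)).
    apply: sumr_ge0 => z _; apply: mulr_ge0; first by have [] := hpi.
    by apply: run_ge0 => // _.
  apply: (@le_trans _ _ (2^-1 * run Ew Mw (n + n.*2) ord0 (fun _ s => ln (Phi s)))); last by lra.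
  suff : g / 24 <= run Ew Mw (n + n.*2) ord0 (fun _ s => ln (Phi s)) by lra.
  have nF : snice (fun (_ : 'I_q.+2) s => ln (Phi s)) by move=> _.
  apply: le_trans (wait_lower hM' nu0 nu1 p01 E0 E' (n + n.*2) ord0 nF (fun _ => lnPhi_ge0)).
  pose a j := (1 - p) ^+ j * (p * nu ord0 * iid E0 j.+1 (fun u =>
     run Ew Mw (n + n.*2 - j.+1) (lift ord0 ord0) (fun _ t => ln (Phi (u ++ t))))).
  have a0 j : 0 <= a j.
    apply: mulr_ge0; first exact/exprn_ge0/ltW.
    apply: mulr_ge0; first by apply: mulr_ge0 => //; exact: ltW.
    apply: run_ge0; first exact: stochastic1.
      by move=> _; apply: (nice_run_cat Ew Mw _ (F := fun _ s => ln (Phi s))).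
    move=> _ s _; apply: run_ge0 => //.
    by apply: (@snice_cat _ _ _ _ (fun _ s => ln (Phi s))) => _.
  have nu_half : 2^-1 <= nu ord0.
    by rewrite /nu eqxx ler_pdivlMr// mulVf// lerDl invr_ge0.
  have -> : g / 24 = n%:R * (p * (g / 4)).
    by rewrite /p; field; rewrite gt_eqF.
  have nn : (n.-1 + n <= n + n.*2)%N by clear -n2; lia.
  apply: (@sum_ge_window _ a _ n.-1 _ _ nn).
    exact: a0.
  move=> j /andP[j1 j2].
  have [T jT] : exists T, j.+1 = (n + T)%N by exists (j.+1 - n)%N; clear -j1; lia.
  have [Tn jm] : (T < n)%N /\ (j + m <= n.*2 + n)%N by clear -n2 j1 j2 jT mn; lia.
  have ws := window_score Tn; rewrite -jT in ws.
  have sp := stay_prob jm; rewrite exprD in sp.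
  rewrite /a; set I := iid _ _ _ in ws *.
  have pj0 : 0 <= (1 - p) ^+ j by exact/exprn_ge0/ltW.
  have -> : (1 - p) ^+ j * (p * nu ord0 * I) = p * (nu ord0 * ((1 - p) ^+ j * I)) by ring.
  apply: ler_wpM2l; first exact: ltW.
  have h1 : 2^-1 * g <= (1 - p) ^+ j * I.
    apply: (@le_trans _ _ ((1 - p) ^+ j * ((1 - p) ^+ m * g))); last exact: ler_wpM2l.
    by rewrite mulrA; exact: ler_wpM2r.
  have -> : g / 4 = 2^-1 * (2^-1 * g) by field.
  apply: ler_pM => //; rewrite ?invr_ge0// mulr_ge0// invr_ge0//.
move: lo up mem; lra.
Qed.

End core.

(** * Product laws and interleaved samples *)

Section product_law.
Context {d} {X : measurableType d} {R : realType}.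

Lemma tuple_rectangles L : @measurable _ (L.-tuple X) =
  <<s [set rectangle A | A in [set A : 'I_L -> set X | forall i, measurable (A i)]] >>.
Proof.
apply/seteqP; split.
  apply: smallest_sub; first exact: smallest_sigma_algebra.
  elim/big_ind: _ => [//|A B hA hB x [/hA|/hB]//|i _ B [A mA <-]].
  apply: sub_sigma_algebra.
  exists (fun j => if j == i then A else setT) => [j|]; first by case: eqP.
  apply/seteqP; split => [t /(_ i)|t [_ tA] j]; first by rewrite eqxx; split.
  by case: eqP => [->|//].
apply: smallest_sub; first exact: sigma_algebra_measurable.
move=> _ [A mA <-].
exact: (measurable_rectangle (R := R)).
Qed.

Lemma path_mean1 (a : nat -> 'I_1 -> R) L :
  path_mean 1%:M a L ord0 = \prod_(i < L) a i ord0.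
Proof.
elim: L a => [|L IH] a; first by rewrite big_ord0.
by rewrite big_ord_recl /= big_ord1 mxE eqxx mul1r (IH (fun i => a i.+1)).
Qed.

Lemma prod_class_iid (Q : set (probability X R)) L P : prod_class Q L P ->
  exists2 Q0, Q Q0 & forall f : seq X -> R, nice f -> mean P (fun t => f t) = iid Q0 L f.
Proof.
move=> [Q0 QQ0 PE]; exists Q0 => // f nf.
have h1 : stationary_distribution (1%:M : 'M[R]_1) (fun=> 1).
  by split => // [|j]; rewrite big_ord1// mxE !ord1 eqxx mulr1.
transitivity (mean (hmm_law (fun=> Q0) stochastic1 h1 L) (fun t => f t)); last first.
  by rewrite mean_hmm_law// /hmm_mean big_ord1 mul1r.
apply: (mean_eq_pi_system (tuple_rectangles L)).
- move=> _ _ [A mA <-] [B mB <-]; exists (fun i => A i `&` B i).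
    by move=> i; exact: measurableI.
  apply/seteqP; split => t.
    by move=> H; split => i; case: (H i).
  by move=> [H1 H2] i; split; [exact: H1|exact: H2].
- by exists (fun=> setT) => //; apply/seteqP; split.
move=> _ [A mA <-]; rewrite PE//.
set A' := ext_sets A.
have mA' i : measurable (A' i) by exact: measurable_ext_sets.
rewrite -[RHS]mean_indic; last exact: (measurable_rectangle (R := R)).
rewrite indic_rectangle mean_hmm_law; last exact: nice_rect_fun.
rewrite /hmm_mean big_ord1 mul1r run_rect_fun// path_mean1 -prodEFin.
by apply: eq_bigr => i _; rewrite /A' ext_setsE mean_indic.
Qed.

End product_law.

Section selectors.
Context {d} {X : measurableType d}.
Implicit Types phi psi : seq X -> seq X.

Lemma selector_comp phi psi : selector phi -> selector psi -> selector (psi \o phi).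
Proof.
move=> h1 h2 L; have [m1 [s1 E1]] := h1 L; have [m2 [s2 E2]] := h2 m1.
exists m2, (s1 \o s2) => t; rewrite (_ : (psi \o phi) t = psi (phi t))// E1 E2; apply: (congr1 val).
by apply: eq_from_tnth => i; rewrite !tnth_mktuple.
Qed.

Lemma selector_cat phi psi : selector phi -> selector psi ->
  selector (fun s => phi s ++ psi s).
Proof.
move=> h1 h2 L; have [m1 [s1 E1]] := h1 L; have [m2 [s2 E2]] := h2 L.
exists (m1 + m2)%N, (fun i => match fintype.split i with inl j => s1 j | inr j => s2 j end) => t.
rewrite E1 E2.
have -> : mktuple (fun i => tnth t (s1 i)) ++ mktuple (fun i => tnth t (s2 i)) =
  [tuple of mktuple (fun i => tnth t (s1 i)) ++ mktuple (fun i => tnth t (s2 i))] :> seq X by [].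
apply: (congr1 val); apply: eq_from_tnth => i; rewrite tnth_mktuple -{1}(splitK i).
case: (fintype.split i) => j /=; rewrite ?tnth_lshift ?tnth_rshift tnth_mktuple//.
Qed.

(** The entries at positions [i], [i + c], [i + 2 c] and so on: the observations
of one state of a cycle of length [c]. *)
Fixpoint stripe c i m (s : seq X) : seq X :=
  if m is m'.+1 then take 1 (drop i s) ++ stripe c i m' (drop c s) else [::].

Lemma selector_stripe c i m : selector (stripe c i m).
Proof.
elim: m => [|m IH] /=.
  move=> L; have f0 : 'I_0 -> 'I_L by case.
  exists 0%N, f0 => t.
  by apply/esym/size0nil; rewrite size_tuple.
apply: selector_cat.
  by apply: (@selector_comp (drop i) (take 1)); [exact: selector_drop|exact: selector_take].
by apply: (@selector_comp (drop c) (stripe c i m)) => //; exact: selector_drop.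
Qed.

Lemma size_stripe c i m s : (i < c)%N -> size s = (c * m)%N -> size (stripe c i m s) = m.
Proof.
move=> ic; elim: m s => // m IH s sE /=.
by rewrite size_cat IH ?size_take_min ?size_drop sE; [nia|nia].
Qed.

End selectors.

Section cyclic_chain.
Context {R : realType} (q : nat).

Definition cyclic_matrix : 'M[R]_q.+1 := \matrix_(i, j) (j == ordS i)%:R.

Lemma cyclic_sum z (g : 'I_q.+1 -> R) : \sum_y cyclic_matrix z y * g y = g (ordS z).
Proof.
rewrite (bigD1 (ordS z))//= mxE eqxx mul1r big1 ?addr0// => y /negbTE yz.
by rewrite mxE yz mul0r.
Qed.

Lemma cyclic_stochastic : row_stochastic cyclic_matrix.
Proof.
split=> [i j|i]; first by rewrite mxE.
by have := cyclic_sum i (fun=> 1); under eq_bigr do rewrite mulr1.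
Qed.

Context {d} {X : measurableType d}.
Variable E' : 'I_q.+1 -> probability X R.

Notation runC := (run E' cyclic_matrix).

Lemma run_cyclicS L z F : runC L.+1 z F =
  mean (E' z) (fun x => runC L (ordS z) (fun y s => F y (x :: s))).
Proof. by rewrite /=; congr mean; apply/funext => x; rewrite cyclic_sum. Qed.

Lemma run_cyclic_state L z F : runC L z F = runC L z (fun _ s => F (iter L (@ordS q.+1) z) s).
Proof.
elim: L z F => // L IH z F; rewrite !run_cyclicS; congr mean; apply/funext => x.
by rewrite IH -iterSr.
Qed.

Lemma run_cyclic_entry i L z (G : seq X -> R) : (i < L)%N ->
  runC L z (fun _ s => G (take 1 (drop i s))) =
  mean (E' (iter i (@ordS q.+1) z)) (fun x => G [:: x]).
Proof.
elim: i L z => [|i IH] [//|L] z iL; rewrite run_cyclicS.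
  congr mean; apply/funext => x; under [X in runC _ _ X]eq_fun do under eq_fun do rewrite drop0 /= take0.
  by rewrite run_cst//; exact: cyclic_stochastic.
rewrite -[RHS](mean_cst (E' z)); congr mean; apply/funext => x /=.
by rewrite IH// -iterSr.
Qed.

Lemma val_iter_ordS i : (i <= q)%N -> iter i (@ordS q.+1) ord0 = i :> nat.
Proof.
elim: i => // i IH iq; rewrite iterS /= IH; last exact: ltnW.
by rewrite modn_small.
Qed.

Lemma iter_ordS_period : iter q.+1 (@ordS q.+1) ord0 = ord0.
Proof. by apply: val_inj; rewrite iterS /= val_iter_ordS// modnn. Qed.

(** Around the cycle, state [i] emits exactly at the positions congruent to [i]. *)
Lemma run_stripe (i : 'I_q.+1) m (f : seq X -> R) :
  runC (q.+1 * m) ord0 (fun _ s => f (stripe q.+1 i m s)) = iid (E' i) m f.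
Proof.
elim: m f => [|m IH] f; first by rewrite muln0.
rewrite mulnS run_cat run_cyclic_state iter_ordS_period iidS.
have iE : iter i (@ordS q.+1) ord0 = i.
  by apply: val_inj; rewrite /= val_iter_ordS// -ltnS.
have := run_cyclic_entry ord0 (fun l => iid (E' i) m (fun s => f (l ++ s))) (ltn_ord i).
rewrite iE => H; apply: (etrans _ H).
apply: run_ext => _ s sq; rewrite -IH; apply: run_ext => _ t _ /=.
congr (f (_ ++ _)); last by rewrite drop_size_cat.
by rewrite drop_cat sq ltn_ord takel_cat// size_drop sq subn_gt0.
Qed.

End cyclic_chain.

(** * The forecast as an expectation *)

Section forecast_functional.
Context {d} {X : measurableType d} {R : realType} {n : nat}.
Variables (E0 : probability X R) (K : R.-pker (n.-tuple X) ~> X) (m : nat).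
Notation Lam := (forecast E0 K m).
Implicit Types f g : seq X -> R.

Let nice_inner f : nice f -> nice (iter m (step K) (fun s => f (drop n s))).
Proof. by move=> nf; apply: nice_iter_step; exact: nice_drop. Qed.

Lemma forecast_ext f g : (forall s, size s = m -> f s = g s) -> Lam f = Lam g.
Proof.
move=> fg; apply: run_ext => _ u un; apply: iter_step_ext; first by rewrite un.
by move=> t tm; rewrite -un !drop_size_cat//; exact: fg.
Qed.

Lemma forecastD f g : nice f -> nice g -> Lam (fun s => f s + g s) = Lam f + Lam g.
Proof.
move=> nf ng; rewrite /forecast /iid -runD; try by move=> _; exact: nice_inner.
by apply: run_ext => _ u _; rewrite iter_stepD//; exact: nice_drop.
Qed.

Lemma iter_stepZ j c f s : nice f ->
  iter j (step K) (fun s => c * f s) s = c * iter j (step K) f s.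
Proof.
move=> nf; elim: j s => // j IH s /=.
rewrite {1}/step; case wE: (window n s) => [w|]; rewrite {2}/step wE; last by rewrite IH.
rewrite -meanZl; last by apply: bm_rcons; exact: nice_iter_step.
by congr mean; apply/funext => y; rewrite IH.
Qed.

Lemma forecastZ c f : nice f -> Lam (fun s => c * f s) = c * Lam f.
Proof.
move=> nf; rewrite /forecast /iid -(@runZ _ _ _ _ _ _ _ _ _ (fun _ => _)); last first.
  by move=> _; exact: nice_inner.
by apply: run_ext => _ u _; rewrite iter_stepZ//; exact: nice_drop.
Qed.

Lemma forecast_cst c : Lam (fun=> c) = c.
Proof.
rewrite -[RHS](run_cst (fun _ : 'I_1 => E0) stochastic1 n ord0).
by apply: run_ext => _ u _; rewrite iter_step_cst.
Qed.

Lemma forecast_le f g : nice f -> nice g -> (forall s, f s <= g s) -> Lam f <= Lam g.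
Proof.
move=> nf ng fg; apply: (run_le _ stochastic1); try by move=> _; exact: nice_inner.
by move=> _ u _; apply: iter_step_le => //; exact: nice_drop.
Qed.

Lemma iter_step_dct j (f : nat -> seq X -> R) g (B : R) s :
  (forall i, nice (f i)) -> nice g -> (forall i t, `|f i t| <= B) ->
  (forall t, f i t @[i --> \oo] --> g t) ->
  iter j (step K) (f i) s @[i --> \oo] --> iter j (step K) g s.
Proof.
move=> nf ng fB fg; elim: j s => [|j IH] s /=; first exact: fg.
rewrite /step; case: (window n s) => [w|]; last exact: IH.
apply: (@mean_dct _ _ _ _ _ _ B) => [i|i y|y]; last exact: IH.
  by case: (bm_rcons s (nice_iter_step K j (nf i))).
rewrite ler_norml; apply/andP; split.
  rewrite -(iter_step_cst K j (- B) (rcons s y)); apply: iter_step_le => //; first exact: nice_cst.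
  by move=> t; have := fB i t; rewrite ler_norml => /andP[].
rewrite -(iter_step_cst K j B (rcons s y)); apply: iter_step_le => //; first exact: nice_cst.
by move=> t; have := fB i t; rewrite ler_norml => /andP[].
Qed.

Lemma forecast_dct (f : nat -> seq X -> R) g (B : R) :
  (forall i, nice (f i)) -> nice g -> (forall i t, `|f i t| <= B) ->
  (forall t, f i t @[i --> \oo] --> g t) -> Lam (f i) @[i --> \oo] --> Lam g.
Proof.
move=> nf ng fB fg.
apply: (run_dct stochastic1 (B := B)) => [i _|_|i _ s _|_ s _]; try exact: nice_inner.
  rewrite ler_norml; apply/andP; split.
    rewrite -(iter_step_cst K m (- B) s); apply: iter_step_le => [||t]; try exact: nice_cst.
      exact: nice_drop.
    by have := fB i (drop n t); rewrite ler_norml => /andP[].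
  rewrite -(iter_step_cst K m B s); apply: iter_step_le => [||t]; try exact: nice_cst.
    exact: nice_drop.
  by have := fB i (drop n t); rewrite ler_norml => /andP[].
apply: (iter_step_dct (B := B)) => [i||i t|t]; try exact: nice_drop.
  exact: fB.
exact: fg.
Qed.

End forecast_functional.

(** * The regret dominates the redundancy of products *)

Section product_redundancy.
Context {d} {X : measurableType d} {R : realType} (q n l : nat).
Variables (Q : set (probability X R)) (E0 : probability X R) (K : R.-pker (n.-tuple X) ~> X)
  (Bd : R).
Let m := (q.+1 * l)%N.
Notation Lam := (forecast E0 K m).
Hypothesis forecast_regret : forall (E' : 'I_q.+1 -> probability X R) (M' : 'M[R]_q.+1)
    (h : seq X -> R) (B : R), (forall i, Q (E' i)) -> row_stochastic M' -> nice h ->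
  (forall s, `|h s| <= B) ->
  run E' M' m ord0 (fun _ => h) - ln (Lam (fun s => expR (h s))) <= Bd.

Let st i := @stripe _ X q.+1 i l.

(** The law of the [i]-th stripe under the forecast weighted by [expR S]. *)
Lemma tilted_law (S : seq X -> R) B (i : 'I_q.+1) : nice S -> (forall s, `|S s| <= B) ->
  exists V : probability (l.-tuple X) R, forall f, bm f ->
    Lam (fun s => expR (S s)) * mean V f = Lam (fun s => expR (S s) * lift_tuple f (st i s)).
Proof.
move=> nS SB; pose w s := expR (S s).
have nw : nice w by exact: nice_expR.
have w0 s : 0 < w s by exact: expR_gt0.
have wB s : w s <= expR B by rewrite ler_expR (le_trans (ler_norm _)).
have Lw : 0 < Lam w.
  rewrite (lt_le_trans (expR_gt0 (- B)))// -(forecast_cst E0 K m (expR (- B))).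
  apply: forecast_le => // [|s]; first exact: nice_cst.
  by rewrite ler_expR; have := SB s; rewrite ler_norml => /andP[].
have nl f : bm f -> nice (fun s => lift_tuple (f : l.-tuple X -> R) (st i s)).
  by move=> bf; apply: nice_selector (nice_lift_tuple bf); exact: selector_stripe.
have nwl f : bm f -> nice (fun s => w s * lift_tuple (f : l.-tuple X -> R) (st i s)).
  by move=> bf; apply: niceM => //; exact: nl.
have [V VE] : exists V : mean_functional (l.-tuple X) R, forall f,
    V f = (Lam w)^-1 * Lam (fun s => w s * lift_tuple f (st i s)).
  unshelve eexists.
  apply: (@Expectation _ _ _ (fun f => (Lam w)^-1 * Lam (fun s => w s * lift_tuple f (st i s)))).
  - move=> f g bf bg; rewrite -mulrDr -forecastD; try exact: nwl.
    congr (_ * forecast _ _ _ _); apply/funext => s; rewrite -mulrDr; congr (_ * _).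
    by rewrite /lift_tuple; case: insub => //=; rewrite addr0.
  - move=> c f bf; rewrite [RHS]mulrCA -(forecastZ E0 K m c (nwl _ bf)).
    congr (_ * forecast _ _ _ _); apply/funext => s; rewrite mulrCA; congr (_ * _).
    by rewrite /lift_tuple; case: insub => //=; rewrite mulr0.
  - move=> f bf f0; apply: mulr_ge0; first by rewrite invr_ge0 ltW.
    rewrite -(forecast_cst E0 K m 0); apply: forecast_le; [exact: nice_cst|exact: nwl|].
    move=> s; apply: mulr_ge0; first exact: ltW.
    by rewrite /lift_tuple; case: insub => //=.
  - rewrite (_ : Lam _ = Lam w); first by rewrite mulVf// gt_eqF.
    apply: forecast_ext => s sm.
    have [t [_ ->]] := lift_tuple_size (fun _ : l.-tuple X => 1 : R)
       (size_stripe (ltn_ord i) sm).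
    by rewrite mulr1.
  - move=> f g C bf bg fC fg; apply: cvgM; first exact: cvg_cst.
    apply: (forecast_dct (B := expR B * `|C|)) => [j||j s|s].
    + exact: nwl.
    + exact: nwl.
    + rewrite normrM (gtr0_norm (w0 s)); apply: ler_pM => //; first exact: ltW.
      rewrite /lift_tuple; case: insub => [t|] /=; last by rewrite normr0.
      by rewrite (le_trans (fC _ _))// ler_norm.
    + apply: cvgM; first exact: cvg_cst.
      rewrite /lift_tuple; case: insub => [t|] /=; first exact: fg.
      exact: cvg_cst.
  by [].
exists (expec_prob V) => f bf; rewrite mean_expec_prob// VE mulrA mulfV ?mul1r//.
by rewrite gt_eqF.
Qed.

(** The redundancy exceeds [r], so whatever the tilted law of the next stripe is,
some product law has divergence more than [r] from it, witnessed by a test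
function.  Tilting by this function as well and continuing with the next stripe
adds up the divergences: this is the chain rule, without conditional laws. *)
Lemma tilting r j : (r%:E < Red (prod_class Q l))%E -> (j <= q.+1)%N ->
  exists (E' : nat -> probability X R) (hs : nat -> seq X -> R) (B : R),
  [/\ forall i, (i < j)%N -> Q (E' i), forall i, nice (hs i), forall i s, `|hs i s| <= B &
    ln (Lam (fun s => expR (\sum_(i < j) hs i (st i s)))) <=
      \sum_(i < j) iid (E' i) l (hs i) - j%:R * r].
Proof.
move=> rRed; elim: j => [|j IH] jq.
  exists (fun=> E0), (fun _ _ => 0), 0; split => // [i|i s|]; [exact: nice_cst|by rewrite normr0|].
  rewrite big_ord0 (_ : (fun s => _) = fun=> 1); last first.
    by apply/funext => s; rewrite ?big_ord0 expR0.
  by rewrite forecast_cst ln1 mul0r big_ord0 subrr.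
have [E' [hs [B [QE' nhs hsB IHle]]]] := IH (ltnW jq).
pose S s := \sum_(i < j) hs i (st i s).
have nst i f : nice f -> nice (fun s => f (st i s)).
  by move=> nf; apply: nice_selector nf; exact: selector_stripe.
have nS : nice S by apply: nice_sum => i _; exact: nst.
have SB s : `|S s| <= \sum_(i < j) B.
  by rewrite (le_trans (ler_norm_sum _ _ _))// ler_sum.
have [V VE] := tilted_law (Ordinal jq) nS SB.
have : (r%:E < ereal_sup [set KL P V | P in prod_class Q l])%E.
  by apply: (lt_le_trans rRed); apply: ereal_inf_lbound; exists V.
move=> /ereal_sup_gt[_ [P PQ <-]] /KL_gt_test[g bg rg].
have [Q0 QQ0 PE] := prod_class_iid PQ.
pose h := lift_tuple g.
have nh : nice h by exact: nice_lift_tuple.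
have [_ [Bg gB]] := bg.
have hB s : `|h s| <= `|Bg|.
  rewrite /h /lift_tuple; case: insub => [t|] /=; last by rewrite normr0.
  by rewrite (le_trans (gB t))// ler_norm.
exists (fun i => if i == j then Q0 else E' i), (fun i => if i == j then h else hs i),
  (Num.max B `|Bg|); split => [i|i|i s|].
- rewrite ltnS leq_eqVlt; case: eqP => //= _; exact: QE'.
- by case: eqP.
- by case: eqP => _; rewrite le_max ?hB ?hsB ?orbT.
have ne (i : 'I_j) : (nat_of_ord i == j) = false by apply/negbTE; rewrite neq_ltn ltn_ord.
have wE : Lam (fun s => expR (\sum_(i < j.+1) (if i == j :> nat then h else hs i) (st i s))) =
    Lam (fun s => expR (S s)) * mean V (fun t => expR (g t)).
  rewrite VE; last exact: bm_expR.
  apply: forecast_ext => s sm; rewrite big_ord_recr /= eqxx expRD; congr (expR _ * _).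
    by apply: eq_bigr => i _; rewrite ne.
  have sl : size (st j s) = l := size_stripe jq sm.
  have [t [ts E1]] := lift_tuple_size g sl.
  by rewrite /h E1 -ts lift_tupleE.
rewrite wE big_ord_recr /= eqxx.
rewrite (eq_bigr (fun i : 'I_j => iid (E' i) l (hs i))); last by move=> i _; rewrite ne.
have Lw : 0 < Lam (fun s => expR (S s)).
  rewrite (lt_le_trans (expR_gt0 (- \sum_(i < j) B)))// -(forecast_cst E0 K m (expR _)).
  apply: forecast_le => [||s]; [exact: nice_cst|exact: nice_expR|].
  by rewrite ler_expR; have := SB s; rewrite ler_norml => /andP[].
have Vg : 0 < mean V (fun t => expR (g t)).
  rewrite (lt_le_trans (expR_gt0 (- Bg)))// -(mean_cst V (expR _)).
  apply: mean_le => [||t]; [exact: bm_cst|exact: bm_expR|].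
  by rewrite ler_expR; have := gB t; rewrite ler_norml => /andP[].
rewrite lnM ?posrE//.
have hE : iid Q0 l h = mean P g.
  rewrite -PE//; congr mean; apply/funext => t; exact: lift_tupleE.
rewrite hE -natr1 mulrDl mul1r.
by move: IHle rg; rewrite -/(S _); lra.
Qed.

(** The sum of the test functions of [tilting] is a single test function for the
cyclic chain with the laws found there. *)
Lemma red_le_regret : ((q.+1%:R)%:E * Red (prod_class Q l) <= Bd%:E)%E.
Proof.
have key r : (r%:E < Red (prod_class Q l))%E -> q.+1%:R * r <= Bd.
  move=> /tilting /(_ (leqnn _)) [E' [hs [B [QE' nhs hsB le1]]]].
  have nst i f : nice f -> nice (fun s => f (st i s)).
    by move=> nf; apply: nice_selector nf; exact: selector_stripe.
  have nh : nice (fun s => \sum_(i < q.+1) hs i (st i s)).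
    by apply: nice_sum => i _; exact: nst.
  have hB s : `|\sum_(i < q.+1) hs i (st i s)| <= \sum_(i < q.+1) B.
    by rewrite (le_trans (ler_norm_sum _ _ _))// ler_sum.
  have := forecast_regret (fun i : 'I_q.+1 => QE' i (ltn_ord i)) (cyclic_stochastic q) nh hB.
  rewrite (run_sum _ _ _ _ _ (F := fun (i : 'I_q.+1) _ s => hs i (st i s))); last first.
    by move=> i _ z; exact: nst.
  under eq_bigr => i _ do rewrite run_stripe.
  by move: le1; lra.
have q0 : 0 < q.+1%:R :> R by [].
case E1 : (Red _) key => [x| |] key.
- rewrite -EFinM lee_fin leNgt; apply/negP => Bx.
  have rx : Bd / q.+1%:R < x by rewrite ltr_pdivrMr// mulrC.
  have [r r1 r2] : exists2 r, Bd / q.+1%:R < r & r < x.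
    by exists ((Bd / q.+1%:R + x) / 2); [exact: (midf_lt rx).1|exact: (midf_lt rx).2].
  have := key r; rewrite lte_fin => /(_ r2).
  by move: r1; rewrite ltr_pdivrMr// leNgt mulrC => ->.
- have := key (`|Bd| + 1) (ltry _); have := ler_norm Bd; have := normr_ge0 Bd.
  have : 1 <= q.+1%:R :> R by rewrite ler1n.
  by move=> *; exfalso; nra.
- by rewrite gt0_muleNy// ?leNye// lte_fin.
Qed.

End product_redundancy.

(** * Deviations of block sums *)

Section block_sums.
Context {d} {X : measurableType d} {R : realType} (l : nat).

Fixpoint block_sum (f : seq X -> R) N (s : seq X) : R :=
  if N is N'.+1 then f (take l s) + block_sum f N' (drop l s) else 0.

Lemma nice_block_sum f N : nice f -> nice (block_sum f N).
Proof.
move=> nf; elim: N => [|N IH] /=; first exact: nice_cst.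
by apply: niceD; [exact: nice_take|exact: nice_drop IH].
Qed.

Lemma block_sum_lin f g c N s :
  block_sum (fun s => f s - c * g s) N s = block_sum f N s - c * block_sum g N s.
Proof. by elim: N s => [|N IH] s /=; rewrite ?mulr0 ?subrr// IH; ring. Qed.

Lemma block_sum_opp f N s : block_sum (fun s => - f s) N s = - block_sum f N s.
Proof. by elim: N s => [|N IH] s /=; rewrite ?oppr0// IH opprD. Qed.

Lemma block_sum_subc f c N s : block_sum (fun s => f s - c) N s = block_sum f N s - N%:R * c.
Proof.
elim: N s => [|N IH] s /=; first by rewrite mul0r subrr.
by rewrite IH -natr1; ring.
Qed.

(** Only deviations below matter, and the square of the negative part bounds their
probability while needing no upper bound on the conditional means. *)
Definition deficit (v : R) : R := Num.min v 0 ^+ 2.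

Lemma deficit_ge0 v : 0 <= deficit v. Proof. exact: sqr_ge0. Qed.

Lemma deficitD v x : deficit (v + x) <= deficit v + 2 * Num.min v 0 * x + x ^+ 2.
Proof.
rewrite /deficit; case: (leP v 0) => v0; case: (leP (v + x) 0) => vx; try nra.
Qed.

Lemma deficit_le v c : 0 < c -> v <= - c -> 1 <= deficit v / c ^+ 2.
Proof.
move=> c0 vc; rewrite ler_pdivlMr ?exprn_gt0// mul1r /deficit.
rewrite (_ : Num.min v 0 = v); last by apply/min_idPl; lra.
by nra.
Qed.

Variables (k : nat) (E : 'I_k -> probability X R) (M : 'M[R]_k) (hM : row_stochastic M).
Variables (f : seq X -> R) (B : R).
Hypotheses (nf : nice f) (fB : forall s, `|f s| <= B) (f0 : forall z, 0 <= run E M l z (fun _ => f)).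

Lemma nice_deficit (g : seq X -> R) v : nice g -> nice (fun s => deficit (v + g s)).
Proof.
move=> ng; have nm : nice (fun s => Num.min (v + g s) 0).
  move=> L; have [mg [b gb]] := niceD (nice_cst v) ng L; split.
    by apply: measurable_minr => //; exact: measurable_cst.
  exists `|b| => t; rewrite (le_trans _ (ler_norm b))// (le_trans _ (gb t))//.
  by have [_|_] := leP (v + g t) 0; rewrite ?normr0.
by apply: nice_ext (niceM nm nm) => s; rewrite -expr2.
Qed.

(** One more block of nonnegative mean increases the mean deficit by at most its
second moment. *)
Lemma run_deficit N z v :
  run E M (l * N) z (fun _ s => deficit (v + block_sum f N s)) <= deficit v + N%:R * B ^+ 2.
Proof.
elim: N z v => [|N IH] z v; first by rewrite muln0 /= addr0 mul0r addr0.
rewrite mulnS run_cat.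
have nd v' : snice (fun _ : 'I_k => fun s => deficit (v' + f s)).
  by move=> _; exact: nice_deficit.
apply: (@le_trans _ _ (run E M l z (fun _ s => deficit (v + f s) + N%:R * B ^+ 2))).
  apply: (run_le E hM).
  - apply: (nice_run_cat E M _ (F := fun _ s => deficit (v + block_sum f N.+1 s))) => _.
    by apply: nice_deficit; exact: nice_block_sum.
  - by move=> y; apply: niceD; [exact: nd|exact: nice_cst].
  move=> y s sl; apply: le_trans (IH y (v + f s)); rewrite le_eqVlt; apply/orP; left.
  apply/eqP/run_ext => _ t _ /=.
  by rewrite take_size_cat// drop_size_cat// addrA.
apply: (@le_trans _ _ (run E M l z (fun _ s =>
    (deficit v + B ^+ 2 + N%:R * B ^+ 2) + 2 * Num.min v 0 * f s))).
  apply: (run_le E hM).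
  - by move=> y; apply: niceD; [exact: nd|exact: nice_cst].
  - by move=> y; apply: niceD; [exact: nice_cst|apply: niceM => //; exact: nice_cst].
  move=> _ s _; have := deficitD v (f s).
  have : f s ^+ 2 <= B ^+ 2.
    rewrite -(real_normK (num_real (f s))).
    by have := fB s; have := normr_ge0 (f s); nra.
  lra.
rewrite runD; [|exact: snice_cst|by move=> _; apply: niceM => //; exact: nice_cst].
rewrite run_cst// (@runZ _ _ _ _ _ _ _ _ _ (fun _ => f)); last by move=> _.
have : 2 * Num.min v 0 * run E M l z (fun _ => f) <= 0.
  apply: mulr_le0_ge0 => //; rewrite pmulr_rle0//.
  by have [//|_] := leP v 0.
by rewrite -natr1; lra.
Qed.

Lemma run_low_block_sum N z c : 0 < c ->
  run E M (l * N) z (fun _ s => (block_sum f N s <= - c)%R%:R) <= N%:R * B ^+ 2 / c ^+ 2.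
Proof.
move=> c0; have ns : nice (fun s => (block_sum f N s <= - c)%R%:R : R).
  have nb : nice (fun s => block_sum f N s + c) by apply: niceD; [exact: nice_block_sum|exact: nice_cst].
  apply: nice_ext (niceB (nice_cst 1) (nice_pos_indic nb)) => s.
  by rewrite -ltrBlDr sub0r ltNge; case: (_ <= _); rewrite ?subr0 ?subrr.
apply: (@le_trans _ _ (run E M (l * N) z (fun _ s => (c ^+ 2)^-1 * deficit (0 + block_sum f N s)))).
  apply: (run_le E hM) => [_|_|_ s _] //.
    apply: niceM; first exact: nice_cst.
    by apply: nice_deficit; exact: nice_block_sum.
  rewrite add0r mulrC; have [h|h] := leP (block_sum f N s) (- c); last by rewrite divr_ge0// ?deficit_ge0// exprn_ge0// ltW.
  by apply: deficit_le.
rewrite (@runZ _ _ _ _ _ _ _ _ _ (fun _ s => deficit (0 + block_sum f N s))); last first.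
  by move=> _; apply: nice_deficit; exact: nice_block_sum.
rewrite mulrC ler_pM2r ?invr_gt0 ?exprn_gt0//.
have := run_deficit N z 0; rewrite {2}/deficit minxx expr0n /= add0r.
by [].
Qed.

End block_sums.

(** * Patterns of noisy bits *)

Section patterns.
Context {d} {X : measurableType d} {R : realType}.
Variable gam : X -> R.
Hypothesis bg : bm gam.

Definition letter (o : option bool) (x : X) : R :=
  match o with None => 1 | Some true => gam x | Some false => 1 - gam x end.

(** A pattern prescribes marked, unmarked or arbitrary letters.  As [gam] is an
unbiased estimate of the mark of the current state, the product of the letters is
an unbiased estimate of the event that the hidden path follows the pattern. *)
Fixpoint pattern_value (pt : seq (option bool)) (s : seq X) : R :=
  match pt, s with
  | [::], _ => 1
  | o :: pt', x :: s' => letter o x * pattern_value pt' s'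
  | _ :: _, [::] => 0
  end.

Lemma bm_letter o : bm (letter o).
Proof.
case: o => [[]|] /=; [exact: bg| |exact: bm_cst].
by apply: bmB => //; exact: bm_cst.
Qed.

Lemma nice_pattern_value pt : nice (pattern_value pt).
Proof.
elim: pt => [|o pt IH]; first by apply: nice_ext (nice_cst 1) => -[].
move=> [|L]; first by apply: bm_ext (bm_cst 0) => t; rewrite tuple0.
apply: (bm_ext (f := fun t : L.+1.-tuple X => letter o (tnth t ord0) * pattern_value pt (behead t))).
  by move=> t; case/tupleP: t => x t; rewrite tnth0.
apply: bmM; last exact: nice_behead IH L.+1.
exact: (bm_comp (u := fun t : L.+1.-tuple X => tnth t ord0) (measurable_tnth ord0) (bm_letter o)).
Qed.

Lemma pattern_value_bound G pt s : 1 <= G -> (forall o x, `|letter o x| <= G) ->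
  `|pattern_value pt s| <= G ^+ count isSome pt.
Proof.
move=> G1 lG; elim: pt s => [|o pt IH] [|x s] /=; rewrite ?normr1 ?normr0 ?exprn_ege1//.
  by rewrite exprn_ge0// (le_trans ler01).
rewrite normrM; case: o => [b|] /=; last by rewrite normr1 mul1r.
by rewrite add1n exprS ler_pM//; exact: (lG (Some b)).
Qed.

End patterns.

(** * A chain with freely chosen transition probabilities *)

(** States are natural numbers.  [0 .. 2r-1] form a descending corridor, the only
marked states; from [0] the chain passes through [2r] to the ladder
[2r+1 .. 3r+1].  At the [i]-th rung [2r+1+i], [i < r], it jumps into the corridor
at [r+j] with probability [th i j], and else climbs to the next rung; the last
rung leads to [r].  A jump can be recognized from the marks: the number of
unmarked steps tells the rung, and the length of the following marked run tells
the entry point.  The remaining states are sent to [0]. *)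
Section hidden_chain.
Context {R : realType} (r : nat).
Variable th : 'I_r -> 'I_r -> R.
Hypotheses (r0 : (0 < r)%N) (th0 : forall i j, 0 <= th i j)
  (th1 : forall i, \sum_j th i j <= (r.*2)%:R^-1).

Let Th i := \sum_j th i j.
Let Th01 i : 0 <= 1 - Th i.
Proof.
rewrite subr_ge0 (le_trans (th1 i))// invf_le1 ?ler1n ?ltr0n ?double_gt0//.
Qed.

Definition succ_mean (v : nat) (g : nat -> R) : R :=
  if v == 0%N then g r.*2
  else if (v < r.*2)%N then g v.-1
  else if v == r.*2 then g r.*2.+1
  else if insub (v - r.*2.+1)%N is Some i
    then \sum_j th i j * g (r + j)%N + (1 - Th i) * g v.+1
  else if v == (r.*2.+1 + r)%N then g r
  else g 0%N.

Lemma succ_mean_lin v (f g : nat -> R) c :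
  succ_mean v (fun u => f u + c * g u) = succ_mean v f + c * succ_mean v g.
Proof.
rewrite /succ_mean; do 3 (case: ifP => // _); case: insub => [i|]; last by case: ifP.
rewrite (eq_bigr (fun j => th i j * f (r + j)%N + c * (th i j * g (r + j)%N))); last first.
  by move=> j _; rewrite mulrDr mulrCA.
by rewrite big_split/= -mulr_sumr; ring.
Qed.

Lemma succ_meanZ v (g : nat -> R) c : succ_mean v (fun u => c * g u) = c * succ_mean v g.
Proof.
have := succ_mean_lin v (fun=> 0) g c.
rewrite (_ : succ_mean v (fun=> 0) = 0); last first.
  rewrite /succ_mean; do 3 (case: ifP => // _); case: insub => [i|]; last by case: ifP.
  by rewrite mulr0 addr0 big1// => j _; rewrite mulr0.
by rewrite add0r => <-; congr succ_mean; apply/funext => u; rewrite add0r.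
Qed.

Lemma succ_mean_cst v c : succ_mean v (fun=> c) = c.
Proof.
rewrite /succ_mean; do 3 (case: ifP => // _); case: insub => [i|]; last by case: ifP.
by rewrite -mulr_suml -/(Th i); ring.
Qed.

Definition succ_rel (v u : nat) : bool :=
  if v == 0%N then u == r.*2
  else if (v < r.*2)%N then u == v.-1
  else if v == r.*2 then u == r.*2.+1
  else if (v < r.*2.+1 + r)%N then (r <= u < r.*2)%N || (u == v.+1)
  else if v == (r.*2.+1 + r)%N then u == r
  else u == 0%N.

Lemma succ_mean_le v (f g : nat -> R) : (forall u, succ_rel v u -> f u <= g u) ->
  succ_mean v f <= succ_mean v g.
Proof.
rewrite /succ_rel /succ_mean => fg; move: fg.
case: ifP => // _ fg; first exact: fg.
move: fg; case: ifP => // _ fg; first exact: fg.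
move: fg; case: ifP => // v3 fg; first exact: fg.
case: insubP fg => [i iv _|iv].
  move=> fg; have v4 : (v < r.*2.+1 + r)%N by lia.
  rewrite v4 in fg; apply: lerD; last by apply: ler_wpM2l => //; apply: fg; rewrite eqxx orbT.
  apply: ler_sum => j _; apply: ler_wpM2l => //; apply: fg; apply/orP; left.
  by have := ltn_ord j; lia.
move=> fg; have v4 : (v < r.*2.+1 + r)%N = false by lia.
by move: fg; rewrite v4; case: eqP => _ fg; exact: fg.
Qed.

Lemma succ_mean_ext v (f g : nat -> R) : (forall u, succ_rel v u -> f u = g u) ->
  succ_mean v f = succ_mean v g.
Proof.
by move=> fg; apply/eqP; rewrite eq_le !succ_mean_le// => u /fg ->.
Qed.

Definition marked (v : nat) : bool := (v < r.*2)%N.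

(** Probability that the hidden path from [v] follows the pattern. *)
Fixpoint hidden_mean (pt : seq (option bool)) (v : nat) : R :=
  if pt is o :: pt' then
    (if o is Some b then (marked v == b)%:R else 1) * succ_mean v (hidden_mean pt')
  else 1.

Notation N_ := (@None bool).
Notation B_ := (Some true).
Notation U_ := (Some false).

(** The first pattern says that the chain goes from [0] up to the [i]-th rung, and
the second one that moreover it then enters the corridor at [r+j]: the final
marked and unmarked letters show when the corridor ends. *)
Definition pre_pattern i := [:: B_, U_ & nseq i N_ ++ [:: U_]].
Definition full_pattern i j := pre_pattern i ++ B_ :: nseq (r + j).-1 N_ ++ [:: B_; U_].

Lemma hidden_mean_marked pt v : (v < r.*2)%N ->
  hidden_mean (B_ :: pt) v = succ_mean v (hidden_mean pt) /\ hidden_mean (U_ :: pt) v = 0.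
Proof. by rewrite /= /marked => ->; rewrite !eqxx mul1r mul0r. Qed.

Lemma hidden_mean_unmarked pt v : (r.*2 <= v)%N ->
  hidden_mean (B_ :: pt) v = 0 /\ hidden_mean (U_ :: pt) v = succ_mean v (hidden_mean pt).
Proof. by rewrite /= /marked ltnNge => ->; rewrite eqxx mul1r mul0r. Qed.

(** Only [0] is a marked state with an unmarked successor. *)
Lemma hidden_mean_start pt v : hidden_mean [:: B_, U_ & pt] v =
  (v == 0%N)%:R * hidden_mean pt r.*2.+1.
Proof.
have [vr|rv] := ltnP v r.*2; last first.
  rewrite (hidden_mean_unmarked _ rv).1 gtn_eqF ?mul0r//; lia.
rewrite (hidden_mean_marked _ vr).1 /succ_mean; have [v0|v0] := eqVneq v 0%N.
  by rewrite mul1r (hidden_mean_unmarked _ (leqnn _)).2 /succ_mean eqxx double_eq0 gtn_eqF ?ltnn.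
by rewrite vr (hidden_mean_marked pt (_ : (v.-1 < r.*2)%N)).2 ?mul0r//; lia.
Qed.

(** Lower and upper bounds on the number of steps to the state [0]. *)
Definition dist_lb (v : nat) : nat :=
  if (v < r.*2)%N then v else if v == r.*2 then r.+2
  else if (v <= r.*2.+1 + r)%N then r.+1 else 1%N.

Definition dist_ub (v : nat) : nat :=
  if (v < r.*2)%N then v else if (v <= r.*2.+1 + r)%N then (r.*2 + r + r.*2.+1 - v)%N
  else 1%N.

Lemma succ_relP v u : succ_rel v u ->
  (v = 0 /\ u = r.*2)%N \/ (0 < v < r.*2 /\ u = v.-1)%N \/ (v = r.*2 /\ u = r.*2.+1)%N \/
  (r.*2 < v < r.*2.+1 + r /\ (r <= u < r.*2 \/ u = v.+1))%N \/
  (v = r.*2.+1 + r /\ u = r)%N \/ (r.*2.+1 + r < v /\ u = 0)%N.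
Proof. by rewrite /succ_rel; repeat (case: ifP => ?); move=> ?; lia. Qed.

Lemma dist_lbP v : (v < r.*2 /\ dist_lb v = v)%N \/ (v = r.*2 /\ dist_lb v = r.+2)%N \/
  (r.*2 < v <= r.*2.+1 + r /\ dist_lb v = r.+1)%N \/ (r.*2.+1 + r < v /\ dist_lb v = 1)%N.
Proof. by rewrite /dist_lb; repeat (case: ifP => ?); lia. Qed.

Lemma dist_ubP v : (v < r.*2 /\ dist_ub v = v)%N \/
  (r.*2 <= v <= r.*2.+1 + r /\ dist_ub v = r.*2 + r + r.*2.+1 - v)%N \/
  (r.*2.+1 + r < v /\ dist_ub v = 1)%N.
Proof. by rewrite /dist_ub; repeat (case: ifP => ?); lia. Qed.

Lemma dist_lb_succ v u : (0 < dist_lb v)%N -> succ_rel v u -> (dist_lb v <= (dist_lb u).+1)%N.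
Proof. by move=> h /succ_relP; have := dist_lbP v; have := dist_lbP u; lia. Qed.

Lemma dist_ub_succ v u : v != 0%N -> succ_rel v u -> (dist_ub u < dist_ub v)%N.
Proof. by move=> h /succ_relP; have := dist_ubP v; have := dist_ubP u; lia. Qed.

Lemma dist_ub_max v : (dist_ub v < r.*2 + r + 2)%N.
Proof. by have := dist_ubP v; lia. Qed.

Lemma hidden_mean_skipS a pt v : hidden_mean (nseq a.+1 N_ ++ pt) v = succ_mean v (hidden_mean (nseq a N_ ++ pt)).
Proof. by rewrite /= mul1r. Qed.

Lemma hidden_mean_far a v : (a < dist_lb v)%N -> hidden_mean (nseq a N_ ++ [:: B_; U_]) v = 0.
Proof.
elim: a v => [|a IH] v av.
  by rewrite hidden_mean_start; case: eqP av => [->|]; rewrite ?mul0r// /dist_lb double_gt0 r0.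
rewrite hidden_mean_skipS -[RHS](succ_mean_cst v 0); apply: succ_mean_ext => u vu; apply: IH.
by have := dist_lb_succ (leq_ltn_trans (leq0n _) av) vu; lia.
Qed.

Lemma hidden_mean_walk a l pt : (a + l < r.*2)%N ->
  hidden_mean (nseq a N_ ++ pt) (a + l)%N = hidden_mean pt l.
Proof.
elim: a l => // a IH l al; rewrite hidden_mean_skipS /succ_mean addSn /= -addSn al.
by apply: IH; lia.
Qed.

Lemma hidden_mean_walk0 l pt : (l < r.*2)%N -> hidden_mean (nseq l N_ ++ pt) l = hidden_mean pt 0%N.
Proof. by move=> lr; have := @hidden_mean_walk l 0 pt; rewrite addn0; exact. Qed.

(** From [l] in the corridor the next visit to [0] takes [l] steps and the one
after that more than [r] others, so [l] is determined by when [0] is met. *)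
Lemma hidden_mean_locate a l : (l < r.*2)%N -> (a <= l + r)%N ->
  hidden_mean (nseq a N_ ++ [:: B_; U_]) l = (a == l)%:R.
Proof.
move=> lr alr; have [al|la|->] := ltngtP a l.
- by rewrite hidden_mean_far// /dist_lb lr.
- have -> : (a = l + (a - l).-1.+1)%N by lia.
  rewrite nseqD -catA hidden_mean_walk0// hidden_mean_skipS /succ_mean eqxx.
  by rewrite hidden_mean_far// /dist_lb ltnn eqxx; lia.
- by rewrite hidden_mean_walk0// hidden_mean_start eqxx mul1r.
Qed.

Definition climb (i : nat) : R := \prod_(i' < r | (i' < i)%N) (1 - Th i').

Lemma hidden_mean_climb i i0 pt : (i0 + i <= r)%N ->
  hidden_mean (nseq i N_ ++ U_ :: pt) (r.*2.+1 + i0)%N =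
  (\prod_(i' < r | (i0 <= i' < i0 + i)%N) (1 - Th i')) *
    succ_mean (r.*2.+1 + i0 + i)%N (hidden_mean pt).
Proof.
elim: i i0 => [|i IH] i0 iir.
  rewrite (hidden_mean_unmarked pt (_ : (r.*2 <= _)%N)).2; last by lia.
  rewrite big_pred0 ?mul1r ?addn0// => i'; apply/negbTE; lia.
rewrite hidden_mean_skipS.
have i0r : (i0 < r)%N by lia.
have -> : succ_mean (r.*2.+1 + i0) (hidden_mean (nseq i N_ ++ U_ :: pt)) =
    \sum_j th (Ordinal i0r) j * hidden_mean (nseq i N_ ++ U_ :: pt) (r + j)%N
    + (1 - Th (Ordinal i0r)) * hidden_mean (nseq i N_ ++ U_ :: pt) (r.*2.+1 + i0.+1)%N.
  rewrite /succ_mean; do 3 (case: eqP; first by lia).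
  rewrite ltnNge (_ : (r.*2 <= _)%N) /=; last by lia.
  by move=> _ _; rewrite addKn; case: insubP => [i' _ iE|]; [|by rewrite i0r];
     rewrite (_ : i' = Ordinal i0r) ?addnS//; exact: val_inj.
rewrite big1 ?add0r => [|j _]; last first.
  have jr := ltn_ord j.
  have -> : (r + j = i + (r + j - i))%N by lia.
  by rewrite hidden_mean_walk; [rewrite (hidden_mean_marked pt (_ : (_ < r.*2)%N)).2 ?mulr0//; lia|lia].
rewrite IH; last by lia.
rewrite mulrA; congr (_ * _); last by congr succ_mean; lia.
rewrite [in RHS](bigD1 (Ordinal i0r)) /=; last by lia.
congr (_ * _); apply: eq_bigl => i'; rewrite -val_eqE /=; lia.
Qed.

Lemma hidden_mean_pre i v : (i <= r)%N -> hidden_mean (pre_pattern i) v = (v == 0%N)%:R * climb i.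
Proof.
move=> ir; rewrite hidden_mean_start -[r.*2.+1 in LHS]addn0 hidden_mean_climb ?add0n//.
rewrite (_ : succ_mean _ _ = 1) ?mulr1; last exact: succ_mean_cst.
by congr (_ * _); apply: eq_bigl => i'; rewrite leq0n.
Qed.

(** The second pattern has [th i j] times the probability of the first, from every
state.  So the ratio of the two frequencies estimates [th i j] whatever the
history is. *)
Lemma hidden_mean_full (i j : 'I_r) v :
  hidden_mean (full_pattern i j) v = th i j * hidden_mean (pre_pattern i) v.
Proof.
rewrite hidden_mean_pre ?(ltnW (ltn_ord i))//.
rewrite (_ : full_pattern i j = [:: B_, U_ & nseq i N_ ++ U_ :: (B_ :: nseq (r + j).-1 N_ ++ [:: B_; U_])]); last first.
  by rewrite /full_pattern /pre_pattern /= -catA.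
rewrite hidden_mean_start -[r.*2.+1 in LHS]addn0 hidden_mean_climb ?add0n ?(ltnW (ltn_ord i))//.
rewrite addn0 (eq_bigl (fun i' : 'I_r => (i' < i)%N)) -/(climb i); last by move=> i'; rewrite leq0n.
suff -> : succ_mean (r.*2.+1 + i) (hidden_mean (B_ :: nseq (r + j).-1 N_ ++ [:: B_; U_])) = th i j.
  by ring.
set pt := B_ :: _.
have -> : succ_mean (r.*2.+1 + i) (hidden_mean pt) =
    \sum_j th i j * hidden_mean pt (r + j)%N + (1 - Th i) * hidden_mean pt (r.*2.+1 + i).+1.
  have ir := ltn_ord i.
  rewrite /succ_mean; do 3 (case: eqP; first by lia).
  rewrite ltnNge (_ : (r.*2 <= _)%N) /=; last by lia.
  by move=> _ _; rewrite addKn; case: insubP => [i' _ iE|]; [|by rewrite ir];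
     rewrite (_ : i' = i)//; exact: val_inj.
rewrite (hidden_mean_unmarked _ (_ : (r.*2 <= (r.*2.+1 + i).+1)%N)).1 ?mulr0 ?addr0; last by lia.
have jr := ltn_ord j.
have H (j' : 'I_r) : hidden_mean pt (r + j')%N = (j' == j)%:R.
  have j'r := ltn_ord j'.
  have rj' : (r + j' < r.*2)%N by lia.
  rewrite (hidden_mean_marked _ rj').1 /succ_mean addn_eq0 gtn_eqF//= rj' hidden_mean_locate; [|lia|lia].
  congr (nat_of_bool _)%:R; rewrite -val_eqE /=; lia.
rewrite (eq_bigr (fun j' => th i j' * (j' == j)%:R)); last by move=> j' _; rewrite H.
by rewrite (bigD1 j)//= eqxx mulr1 big1 ?addr0// => j' /negbTE ->; rewrite mulr0.
Qed.

Lemma succ_mean_ge0 v (g : nat -> R) : (forall u, 0 <= g u) -> 0 <= succ_mean v g.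
Proof. by move=> g0; rewrite -(succ_mean_cst v 0); exact: succ_mean_le. Qed.

Lemma succ_mean_sum I (s : seq I) v (f : I -> nat -> R) :
  succ_mean v (fun u => \sum_(i <- s) f i u) = \sum_(i <- s) succ_mean v (f i).
Proof.
elim: s => [|i s IH].
  rewrite big_nil -[RHS](succ_mean_cst v 0); congr succ_mean.
  by apply/funext => u; rewrite big_nil.
rewrite big_cons -IH -[X in _ + X]mul1r -succ_mean_lin; congr succ_mean.
by apply/funext => u; rewrite big_cons mul1r.
Qed.

Lemma hidden_mean_delayZ u pt pt' c : (forall v, hidden_mean pt v = c * hidden_mean pt' v) ->
  forall v, hidden_mean (nseq u N_ ++ pt) v = c * hidden_mean (nseq u N_ ++ pt') v.
Proof.
move=> H; elim: u => // u IH v.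
by rewrite !hidden_mean_skipS -succ_meanZ; congr succ_mean; apply/funext => w; rewrite IH.
Qed.

Lemma hidden_mean_ge0 pt v : 0 <= hidden_mean pt v.
Proof.
elim: pt v => [|o pt IH] v /=; first exact: ler01.
by apply: mulr_ge0; [case: o|apply: succ_mean_ge0].
Qed.

(** The chain visits [0] within [U] steps, and the pattern that starts at that visit
already contributes [c]. *)
Lemma hidden_mean_recurrent U pt c v : (dist_ub v < U)%N -> c <= hidden_mean pt 0%N -> 0 <= c ->
  c <= \sum_(u < U) hidden_mean (nseq u N_ ++ pt) v.
Proof.
move=> vU cpt c0; elim: U v vU => // U IH v vU; rewrite big_ord_recl /=.
have [->|v0] := eqVneq v 0%N; first by rewrite -[leLHS]addr0 lerD// sumr_ge0// => u _; rewrite mul1r; apply: succ_mean_ge0 => w; exact: hidden_mean_ge0.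
rewrite -[leLHS]add0r lerD ?hidden_mean_ge0//.
rewrite (eq_bigr (fun u : 'I_U => succ_mean v (hidden_mean (nseq u N_ ++ pt)))); last first.
  by move=> u _; rewrite mul1r.
rewrite -succ_mean_sum -(succ_mean_cst v c); apply: succ_mean_le => u vu.
by apply: IH; have := dist_ub_succ v0 vu; lia.
Qed.

(** Each of the [r] rungs is left for the corridor with probability at most
[1/(2r)]. *)
Lemma climb_ge i : 2^-1 <= climb i.
Proof.
have bern (s : seq 'I_r) (P : pred 'I_r) :
    1 - (size s)%:R * (r.*2)%:R^-1 <= \prod_(i' <- s | P i') (1 - Th i') <= 1.
  elim: s => [|i' s /andP[IH1 IH2]]; first by rewrite big_nil mul0r subr0 lexx.
  have h0 : 0 <= (r.*2)%:R^-1 :> R by rewrite invr_ge0.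
  have p0 : 0 <= \prod_(i' <- s | P i') (1 - Th i') by exact: prodr_ge0.
  have := th1 i'; have := Th01 i'; rewrite -/(Th i') => t1 t2.
  have t3 : 0 <= Th i' by exact: sumr_ge0.
  rewrite big_cons /= -natr1 mulrDl mul1r; case: ifP => _.
    by apply/andP; split; nra.
  by apply/andP; split => //; lra.
have /andP[h _] := bern (index_enum 'I_r) (fun i' => (i' < i)%N).
apply: le_trans h; rewrite [index_enum _]unlock -enumT size_enum_ord -addnn natrD.
have rr : 0 < r%:R :> R by rewrite ltr0n.
rewrite (_ : r%:R / (r%:R + r%:R) = 2^-1 :> R); first by lra.
have -> : r%:R + r%:R = 2 * r%:R :> R by ring.
by rewrite invfM mulrCA mulfV ?mulr1// gt_eqF.
Qed.

End hidden_chain.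

Section hidden_matrix.
Context {R : realType} (r q : nat).
Variable th : 'I_r -> 'I_r -> R.
Hypotheses (r0 : (0 < r)%N) (th0 : forall i j, 0 <= th i j)
  (th1 : forall i, \sum_j th i j <= (r.*2)%:R^-1) (rq : (r.*2.+1 + r <= q)%N).

Definition succ_matrix : 'M[R]_q.+1 := \matrix_(z, y) succ_mean th z (fun u => (u == y)%:R).

Lemma succ_matrixE (z : 'I_q.+1) (g : nat -> R) :
  \sum_y succ_matrix z y * g y = succ_mean th z g.
Proof.
under eq_bigr => y _ do rewrite mxE mulrC -succ_meanZ.
rewrite -(succ_mean_sum th); apply: succ_mean_ext => // u /succ_relP zu.
have uq : (u < q.+1)%N by have := ltn_ord z; lia.
rewrite (bigD1 (Ordinal uq))//= eqxx mulr1 big1 ?addr0// => y yu.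
by rewrite (_ : (u == y) = false) ?mulr0//; apply: contraNF yu => /eqP uy; apply/eqP/val_inj.
Qed.

Lemma succ_stochastic : row_stochastic succ_matrix.
Proof.
split=> [z y|z]; first by rewrite mxE succ_mean_ge0.
have := succ_matrixE z (fun=> 1); rewrite succ_mean_cst.
by under eq_bigr do rewrite mulr1.
Qed.

Context {d} {X : measurableType d}.
Variables (E : 'I_q.+1 -> probability X R) (gam : X -> R).
Hypotheses (bg : bm gam) (Eg : forall z, mean (E z) gam = (marked r z)%:R).

(** Given the hidden path the observations are independent, so the letters can be
averaged one by one. *)
Lemma run_pattern_value L z pt : (size pt <= L)%N ->
  run E succ_matrix L z (fun _ => pattern_value gam pt) = hidden_mean th pt z.
Proof.
elim: pt L z => [|o pt IH] [|L] z //= ptL; first by rewrite -[RHS](run_cst E succ_stochastic L.+1 z 1).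
transitivity (mean (E z) (fun x => letter gam o x * succ_mean th z (hidden_mean th pt))).
  congr mean; apply/funext => x; rewrite -succ_matrixE mulr_sumr.
  apply: eq_bigr => y _; rewrite mulrCA -(IH L y)//; congr (_ * _).
  by rewrite -(@runZ _ _ _ _ _ _ _ _ _ (fun _ => pattern_value gam pt))// => _; exact: nice_pattern_value.
rewrite meanZr; last exact: bm_letter.
congr (_ * _); case: o => [[]|] /=; last exact: mean_cst.
  by rewrite Eg; case: (marked r z).
rewrite meanB//; last exact: bm_cst.
by rewrite mean_cst Eg; case: (marked r z); rewrite ?subrr ?subr0.
Qed.

End hidden_matrix.

(** * Decoding the transition probabilities *)

Section decoding.
Context {d} {X : measurableType d} {R : realType} (r : nat).
Variables (th : 'I_r -> 'I_r -> R) (gam : X -> R).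
Hypothesis bg : bm gam.

(** Within [horizon] steps the chain visits [0]; a block of length [block_size]
contains the whole of every pattern that starts within the horizon. *)
Definition horizon := (r.*2 + r + 2)%N.
Definition block_size := (6 * r + 6)%N.

Definition occurrences pt (s : seq X) : R :=
  \sum_(u < horizon) pattern_value gam (nseq u None ++ pt) s.

Definition exit_score i j (t : R) (s : seq X) : R :=
  occurrences (full_pattern r i j) s - t * occurrences (pre_pattern i) s.

(** Statistics with nonnegative mean in every block, for any initial state: the two
signs of a centred one for each [(i, j)], and a count of mean at least [1/2]
for each rung [i]. *)
Definition score (p : ('I_r * 'I_r * bool) + 'I_r) (s : seq X) : R :=
  match p with
  | inl (i, j, true) => exit_score i j (th i j) s
  | inl (i, j, false) => - exit_score i j (th i j) s
  | inr i => occurrences (pre_pattern i) s - 2^-1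
  end.

Lemma nice_occurrences pt : nice (occurrences pt).
Proof. by apply: nice_sum => u _; exact: nice_pattern_value. Qed.

Lemma nice_score p : nice (score p).
Proof.
case: p => [[[i j] []]|i] /=.
- apply: niceB; first exact: nice_occurrences.
  by apply: niceM; [exact: nice_cst|exact: nice_occurrences].
- apply: niceN; apply: niceB; first exact: nice_occurrences.
  by apply: niceM; [exact: nice_cst|exact: nice_occurrences].
- by apply: niceB; [exact: nice_occurrences|exact: nice_cst].
Qed.

Definition decode (N : nat) (eps : R) (s : seq X) : bool :=
  [forall p, - (N%:R * eps) < block_sum block_size (score p) N s].

Lemma nice_decode N eps : nice (fun s => (decode N eps s)%:R : R).
Proof.
have np p : nice (fun s => ((0 < N%:R * eps + block_sum block_size (score p) N s)%R)%:R : R).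
  apply: nice_pos_indic; apply: niceD; first exact: nice_cst.
  by apply: nice_block_sum; exact: nice_score.
move=> L; apply: (bm_ext (f := fun t : L.-tuple X =>
   \prod_p ((0 < N%:R * eps + block_sum block_size (score p) N t)%R)%:R)); last first.
  by apply: bm_prod => p _; exact: np.
move=> t; rewrite /decode.
  have [/forallP H|/forallPn[p pN]] :=
    boolP [forall p, - (N%:R * eps) < block_sum block_size (score p) N t].
  by rewrite big1// => p _; have := H p; rewrite -subr_gt0 opprK addrC => ->.
rewrite (bigD1 p)//= (_ : (0 < _) = false) ?mul0r//.
by apply/negbTE; move: pN; rewrite -!leNgt; lra.
Qed.

Variables (q : nat) (G : R).
Hypotheses (r0 : (0 < r)%N) (th0 : forall i j, 0 <= th i j)
  (th1 : forall i, \sum_j th i j <= (r.*2)%:R^-1) (rq : (r.*2.+1 + r <= q)%N).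
Variable E : 'I_q.+1 -> probability X R.
Hypotheses (Eg : forall z, mean (E z) gam = (marked r z)%:R)
  (G1 : 1 <= G) (lG : forall o x, `|letter gam o x| <= G).

Let M := succ_matrix q th.
Let hM : row_stochastic M. Proof. exact: succ_stochastic. Qed.

Lemma run_occurrences pt z : (size pt <= 3 * r + 4)%N ->
  run E M block_size z (fun _ => occurrences pt) =
  \sum_(u < horizon) hidden_mean th (nseq u None ++ pt) z.
Proof.
move=> ptr; rewrite /occurrences (run_sum E M _ _ _ (F := fun (u : 'I_horizon) _ s =>
   pattern_value gam (nseq u None ++ pt) s)); last by move=> u _ _; exact: nice_pattern_value.
apply: eq_bigr => u _; rewrite run_pattern_value// size_cat size_nseq /block_size.
by have := ltn_ord u; rewrite /horizon; lia.
Qed.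

Lemma size_pre i : size (pre_pattern i) = i.+3.
Proof. by rewrite /= size_cat size_nseq addn1. Qed.

Lemma size_full (i j : 'I_r) : (size (full_pattern r i j) <= 3 * r + 4)%N.
Proof.
rewrite size_cat size_pre /= size_cat size_nseq /=.
by have := ltn_ord i; have := ltn_ord j; lia.
Qed.

Lemma run_score_ge0 p z : 0 <= run E M block_size z (fun _ => score p).
Proof.
have snO pt : snice (fun _ : 'I_q.+1 => occurrences pt) by move=> _; exact: nice_occurrences.
have preS (i : 'I_r) : (size (pre_pattern i) <= 3 * r + 4)%N.
  by rewrite size_pre; have := ltn_ord i; lia.
have zero (i j : 'I_r) : run E M block_size z (fun _ => exit_score i j (th i j)) = 0.
  have -> : run E M block_size z (fun _ => exit_score i j (th i j)) =
      run E M block_size z (fun _ => occurrences (full_pattern r i j)) +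
      - th i j * run E M block_size z (fun _ => occurrences (pre_pattern i)).
    rewrite -(@runZ _ _ _ _ _ _ _ _ _ (fun _ => occurrences (pre_pattern i)))//.
    rewrite -runD => [|//|_]; last by apply: niceM; [exact: nice_cst|exact: nice_occurrences].
    by apply: run_ext => _ s _; rewrite /exit_score mulNr.
  rewrite !run_occurrences//; last exact: size_full.
  rewrite mulr_sumr -big_split big1// => u _ /=.
  have full v : hidden_mean th (full_pattern r i j) v = th i j * hidden_mean th (pre_pattern i) v.
    exact: hidden_mean_full.
  have -> : hidden_mean th (nseq u None ++ full_pattern r i j) z =
      th i j * hidden_mean th (nseq u None ++ pre_pattern i) z by exact: hidden_mean_delayZ.
  by rewrite mulNr subrr.
case: p => [[[i j] []]|i] /=; first by rewrite zero.
  rewrite -[leLHS](mulr0 (-1)) -{1}(zero i j) -(@runZ _ _ _ _ _ _ _ _ _ (fun _ => exit_score i j (th i j))); last first.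
    by move=> _; exact: (nice_score (inl (i, j, true))).
  by rewrite le_eqVlt; apply/orP; left; apply/eqP/run_ext => _ s _; rewrite mulN1r.
have -> : run E M block_size z (fun _ s => occurrences (pre_pattern i) s - 2^-1) =
   run E M block_size z (fun _ => occurrences (pre_pattern i)) - 2^-1.
  rewrite runD//; last exact: snice_cst.
  by rewrite run_cst.
rewrite run_occurrences// subr_ge0; apply: hidden_mean_recurrent => //.
- exact: dist_ub_max.
- by rewrite hidden_mean_pre ?(ltnW (ltn_ord i))// eqxx mul1r; exact: climb_ge.
Qed.

Let B : R := 16 * r%:R * G ^+ 6.

Lemma occurrences_bound pt s : (count isSome pt <= 6)%N ->
  `|occurrences pt s| <= horizon%:R * G ^+ 6.
Proof.
move=> pt6; rewrite (le_trans (ler_norm_sum _ _ _))//.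
apply: (@le_trans _ _ (\sum_(u < horizon) G ^+ 6)); last first.
  by rewrite sumr_const card_ord mulr_natl.
apply: ler_sum => u _; apply: le_trans (pattern_value_bound _ _ G1 lG) _.
rewrite count_cat (_ : count isSome (nseq u None) = 0%N) ?add0n; last first.
  by elim: (nat_of_ord u).
exact: ler_weXn2l.
Qed.

Lemma score_bound p s : `|score p s| <= B.
Proof.
have r1 : 1 <= r%:R :> R by rewrite ler1n.
have G6 : 1 <= G ^+ 6 by exact: exprn_ege1.
have cnt0 a : count isSome (nseq a (@None bool)) = 0%N by elim: a.
have hz : horizon%:R = 3 * r%:R + 2 :> R.
  rewrite /horizon -addnn !natrD; ring.
have c1 i : (count isSome (pre_pattern i) <= 6)%N by rewrite /= count_cat cnt0.
have c2 i j : (count isSome (full_pattern r i j) <= 6)%N.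
  by rewrite /full_pattern count_cat /= !count_cat !cnt0.
have o1 i := occurrences_bound s (c1 i); have o2 i j := occurrences_bound s (c2 i j).
have th11 i j : th i j <= 1.
  have := th1 i; rewrite (bigD1 j)//= => h.
  have h2 : (r.*2)%:R^-1 <= 1 :> R by rewrite invf_le1 ?ler1n ?ltr0n ?double_gt0.
  have h3 : 0 <= \sum_(j' < r | j' != j) th i j' by exact: sumr_ge0.
  by move: h; lra.
have ex (i j : 'I_r) : `|exit_score i j (th i j) s| <= B.
  rewrite (le_trans (ler_normB _ _))// normrM (ger0_norm (th0 i j)).
  have h1 := o1 i; have h2 := o2 i j; have h3 := th11 i j; have h4 := th0 i j.
  have h5 : th i j * `|occurrences (pre_pattern i) s| <= `|occurrences (pre_pattern i) s|.
    by rewrite ler_piMl.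
  by rewrite hz in h1 h2; rewrite /B; nra.
case: p => [[[i j] []]|i] /=; rewrite ?normrN//.
rewrite (le_trans (ler_normB _ _))// [`|2^-1|]ger0_norm ?invr_ge0//.
have h1 := o1 i; rewrite hz in h1.
by rewrite /B; nra.
Qed.

(** Chebyshev's inequality for the [2 r^2 + r] statistics, with a union bound. *)
Lemma decode_prob N eps z : (0 < N)%N -> 0 < eps ->
  1 - (3 * r ^ 2)%:R * B ^+ 2 / (N%:R * eps ^+ 2) <=
  run E M (block_size * N) z (fun _ s => (decode N eps s)%:R).
Proof.
move=> N0 eps0; have Ne : 0 < N%:R * eps by rewrite mulr_gt0 ?ltr0n.
pose bad p s : R := (block_sum block_size (score p) N s <= - (N%:R * eps))%R%:R.
have nbad p : nice (bad p).
  have nb : nice (fun s => block_sum block_size (score p) N s + N%:R * eps).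
    by apply: niceD; [apply: nice_block_sum; exact: nice_score|exact: nice_cst].
  apply: nice_ext (niceB (nice_cst 1) (nice_pos_indic nb)) => s.
  by rewrite /bad -ltrBlDr sub0r ltNge; case: (_ <= _); rewrite ?subr0 ?subrr.
apply: (@le_trans _ _ (run E M (block_size * N) z (fun _ s => 1 + -1 * \sum_p bad p s))); last first.
  apply: (run_le E hM) => [_|_|_ s _].
  - by apply: niceD; [exact: nice_cst|apply: niceM; [exact: nice_cst|exact: nice_sum]].
  - exact: nice_decode.
  rewrite mulN1r /decode.
  have [_|/forallPn[p pN]] :=
    boolP [forall p, - (N%:R * eps) < block_sum block_size (score p) N s].
    by rewrite gerBl sumr_ge0// => p _; rewrite /bad ler0n.
  have badp : bad p s = 1 by rewrite /bad leNgt pN.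
  rewrite subr_le0 (bigD1 p)//= badp lerDl.
  by apply: sumr_ge0 => p' _; exact: ler0n.
rewrite runD; [|exact: snice_cst|by move=> _; apply: niceM; [exact: nice_cst|exact: nice_sum]].
rewrite run_cst// (@runZ _ _ _ _ _ _ _ _ _ (fun _ s => \sum_p bad p s)); last first.
  by move=> _; exact: nice_sum.
rewrite mulN1r lerD2l lerN2 (run_sum E M _ _ _ (F := fun p _ s => bad p s)); last by move=> p _ _.
have one p : run E M (block_size * N) z (fun _ => bad p) <= B ^+ 2 / (N%:R * eps ^+ 2).
  have h := run_low_block_sum hM (nice_score p) (score_bound p) (run_score_ge0 p) N z Ne.
  apply: (le_trans h).
  rewrite le_eqVlt; apply/orP; left; apply/eqP.
  by rewrite exprMn; field; rewrite gt_eqF// gt_eqF// ltr0n.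
apply: (@le_trans _ _ (\sum_(p : ('I_r * 'I_r * bool) + 'I_r) B ^+ 2 / (N%:R * eps ^+ 2))).
  by apply: ler_sum => p _; exact: one.
rewrite sumr_const card_sum !card_prod card_bool !card_ord -[leLHS]mulr_natl -mulrA.
apply: ler_wpM2r; first by rewrite mulr_ge0 ?sqr_ge0// invr_ge0 mulr_ge0 ?sqr_ge0.
by rewrite ler_nat; nia.
Qed.

End decoding.

Section codebook.
Context {R : realType} (r Lv : nat).
Hypotheses (r0 : (0 < r)%N) (L0 : (0 < Lv)%N).

Definition code := {ffun 'I_r * 'I_r -> 'I_Lv}.

(** Values of order [1/r^2], so that the chain climbs past any rung with probability
bounded below, and spaced by [1/(4 r^2 Lv)]. *)
Definition exit_prob (c : code) (i j : 'I_r) : R :=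
  (1 + (c (i, j))%:R / Lv%:R) / (4 * r%:R ^+ 2).

Let rr : 0 < r%:R :> R. Proof. by rewrite ltr0n. Qed.
Let LL : 0 < Lv%:R :> R. Proof. by rewrite ltr0n. Qed.

Lemma exit_prob_ge0 c i j : 0 <= exit_prob c i j.
Proof. by rewrite /exit_prob !mulr_ge0 ?invr_ge0 ?addr_ge0 ?mulr_ge0 ?invr_ge0 ?exprn_ge0. Qed.

Lemma exit_prob_row c i : \sum_j exit_prob c i j <= (r.*2)%:R^-1.
Proof.
apply: (@le_trans _ _ (\sum_(j < r) 2 / (4 * r%:R ^+ 2))).
  apply: ler_sum => j _; apply: ler_wpM2r; first by rewrite invr_ge0 mulr_ge0// exprn_ge0.
  have : (c (i, j))%:R / Lv%:R <= 1 :> R by rewrite ler_pdivrMr// mul1r ler_nat ltnW.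
  lra.
rewrite sumr_const card_ord -[leLHS]mulr_natl -addnn natrD le_eqVlt; apply/orP; left; apply/eqP.
have -> : r%:R + r%:R = 2 * r%:R :> R by ring.
by move: rr; move: (r%:R : R) => x x0; field; rewrite gt_eqF.
Qed.

Lemma exit_prob_sep (c c' : code) i j : c (i, j) != c' (i, j) ->
  (4 * r%:R ^+ 2 * Lv%:R)^-1 <= `|exit_prob c i j - exit_prob c' i j|.
Proof.
move=> cc'; have rl : 0 < 4 * r%:R ^+ 2 * Lv%:R :> R by rewrite !mulr_gt0 ?exprn_gt0.
have -> : exit_prob c i j - exit_prob c' i j =
    ((c (i, j))%:R - (c' (i, j))%:R) / (4 * r%:R ^+ 2 * Lv%:R).
  rewrite /exit_prob; move: rr LL; move: (r%:R : R) (Lv%:R : R) => x y x0 y0.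
  by field; rewrite !gt_eqF.
rewrite normrM [`|_^-1|]ger0_norm; last by rewrite invr_ge0 ltW.
rewrite ler_peMl ?invr_ge0 ?(ltW rl)//.
have [h|h|h] := ltngtP (c (i, j)) (c' (i, j)).
- rewrite distrC ger0_norm; last by rewrite subr_ge0 ler_nat ltnW.
  by rewrite lerBrDr addrC natr1 ler_nat.
- rewrite ger0_norm; last by rewrite subr_ge0 ler_nat ltnW.
  by rewrite lerBrDr addrC natr1 ler_nat.
- by move: cc'; rewrite -val_eqE /= h eqxx.
Qed.

Context {d} {X : measurableType d}.
Variable gam : X -> R.

(** If two codes differ at [(i, j)], the frequency of the second pattern would be
close to two different multiples of the frequency of the first, which is at least
[1/4] per block. *)
Lemma decode_inj N (c c' : code) s : (0 < N)%N ->
  decode (exit_prob c) gam N (32 * r%:R ^+ 2 * Lv%:R)^-1 s ->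
  decode (exit_prob c') gam N (32 * r%:R ^+ 2 * Lv%:R)^-1 s -> c = c'.
Proof.
move=> N0 /forallP D /forallP D'; apply/eqP; apply/negPn/negP => cc'.
have [[i j] cij] : exists p, c p != c' p.
  apply/existsP; rewrite -negb_forall; apply: contra cc' => /forallP H.
  by apply/eqP/ffunP => p; apply/eqP.
have sep := exit_prob_sep cij.
have := D (inl (i, j, true)); have := D (inl (i, j, false)); have := D (inr i).
have := D' (inl (i, j, true)); have := D' (inl (i, j, false)).
rewrite /score /exit_score !block_sum_opp !block_sum_lin block_sum_subc.
set F := block_sum _ (occurrences _ _ _) _ _.
set P := block_sum _ _ _ _.
set t := exit_prob c i j in sep *; set t' := exit_prob c' i j in sep *.
have NN : 0 < N%:R :> R by rewrite ltr0n.
have x0 : 0 < (32 * r%:R ^+ 2 * Lv%:R)^-1 :> R by rewrite invr_gt0 !mulr_gt0 ?exprn_gt0.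
have xE : (4 * r%:R ^+ 2 * Lv%:R)^-1 = 8 * (32 * r%:R ^+ 2 * Lv%:R)^-1 :> R.
  move: rr LL; move: (r%:R : R) (Lv%:R : R) => x y x0' y0.
  by field; rewrite !gt_eqF.
have x32 : (32 * r%:R ^+ 2 * Lv%:R)^-1 <= 32^-1 :> R.
  rewrite lef_pV2 ?posrE ?mulr_gt0 ?exprn_gt0// -mulrA ler_peMr//.
  rewrite -[leLHS]mulr1 ler_pM ?ler1n// exprn_ege1// ler1n//.
rewrite xE in sep; move: sep x0 x32; set x := (32 * _ * _)^-1 => sep x0 x32 h1 h2 h3 h4 h5.
have P0 : N%:R / 4 < P by nra.
have Pt : `|t - t'| * P < 2 * (N%:R * x).
  rewrite -[P]ger0_norm; last by lra.
  by rewrite -normrM ltr_norml; apply/andP; split; lra.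
nra.
Qed.

End codebook.

(** * The regret dominates the number of encoded bits *)

Section bits.
Context {d} {X : measurableType d} {R : realType} (q n r Lv N : nat).
Variables (Q : set (probability X R)) (E0 : probability X R) (K : R.-pker (n.-tuple X) ~> X)
  (Bd G : R) (Q1 Q2 : probability X R) (gam : X -> R).
Let m := (block_size r * N)%N.
Notation Lam := (forecast E0 K m).
Hypothesis forecast_regret : forall (E' : 'I_q.+1 -> probability X R) (M' : 'M[R]_q.+1)
    (h : seq X -> R) (B : R), (forall i, Q (E' i)) -> row_stochastic M' -> nice h ->
  (forall s, `|h s| <= B) ->
  run E' M' m ord0 (fun _ => h) - ln (Lam (fun s => expR (h s))) <= Bd.
Hypotheses (QQ1 : Q Q1) (QQ2 : Q Q2) (bg : bm gam) (Q1g : mean Q1 gam = 0)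
  (Q2g : mean Q2 gam = 1) (G1 : 1 <= G) (lG : forall o x, `|letter gam o x| <= G)
  (r0 : (0 < r)%N) (L0 : (0 < Lv)%N) (N0 : (0 < N)%N) (rq : (r.*2.+1 + r <= q)%N)
  (NG : 6 * r%:R ^+ 2 * (16 * r%:R * G ^+ 6) ^+ 2 * (32 * r%:R ^+ 2 * Lv%:R) ^+ 2 <= N%:R).

(** Fano's argument: the decoding sets of distinct codes are disjoint, so some code
has a decoding set [D] of forecast probability at most [1/T], where [T] is the
number of codes, while the chain of that code produces [D] with probability at
least [1/2].  The test function is [ln T] on [D]. *)
Lemma bits_regret : 2^-1 * ((r ^ 2)%:R * ln Lv%:R) - ln 2 <= Bd.
Proof.
pose x : R := (32 * r%:R ^+ 2 * Lv%:R)^-1.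
pose th (c : code r Lv) i j : R := exit_prob c i j.
pose D (c : code r Lv) s : R := (decode (th c) gam N x s)%:R.
have nD c : nice (D c) by exact: nice_decode.
have D01 c s : 0 <= D c s <= 1 by rewrite /D; case: decode; rewrite lexx ler01.
pose T := (Lv ^ (r ^ 2))%N.
have cT : #|code r Lv| = T by rewrite card_ffun card_prod !card_ord.
have T0 : (0 < T)%N by rewrite expn_gt0 L0.
have TT : 0 < T%:R :> R by rewrite ltr0n.
have sumD s : \sum_c D c s <= 1.
  have [[c cs]|H] := pselect (exists c, decode (th c) gam N x s).
    rewrite (bigD1 c)//= big1 ?addr0 => [|c' cc']; first by case/andP: (D01 c s).
    rewrite /D; case: (boolP (decode (th c') _ _ _ _)) => // c's.
    by move: cc'; rewrite (decode_inj r0 L0 N0 cs c's) eqxx.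
  rewrite big1// => c _; rewrite /D; case: (boolP (decode _ _ _ _ _)) => // cs.
  by exfalso; apply: H; exists c.
have sumLam : \sum_c Lam (D c) <= 1.
  have -> : \sum_c Lam (D c) = Lam (fun s => \sum_c D c s).
    elim: (index_enum _) => [|c cs IH].
      rewrite big_nil (_ : (fun s => _) = fun=> 0) ?forecast_cst//.
      by apply/funext => s; rewrite big_nil.
    rewrite big_cons IH -forecastD//; last exact: nice_sum.
    by congr forecast; apply/funext => s; rewrite big_cons.
  rewrite -(forecast_cst E0 K m 1); apply: forecast_le => //; first exact: nice_sum.
  exact: nice_cst.
have [c Lc] : exists c, Lam (D c) <= T%:R^-1.
  apply: contrapT => H; suff : 1 < \sum_c Lam (D c) by rewrite ltNge sumLam.
  have -> : 1 = \sum_(c : code r Lv) T%:R^-1 :> R.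
    by rewrite sumr_const cT -[RHS]mulr_natl mulfV// gt_eqF.
  apply: ltr_sum => [|c _]; last by rewrite ltNge; apply/negP => Lc; apply: H; exists c.
  by rewrite has_predT [index_enum _]unlock -enumT -cardE cT.
have th0 i j : 0 <= th c i j by exact: exit_prob_ge0.
have th1 i : \sum_j th c i j <= (r.*2)%:R^-1 by exact: exit_prob_row.
have hM : row_stochastic (succ_matrix q (th c)) by exact: succ_stochastic.
pose E' (z : 'I_q.+1) := if marked r z then Q2 else Q1.
have QE' z : Q (E' z) by rewrite /E'; case: ifP.
have Eg z : mean (E' z) gam = (marked r z)%:R by rewrite /E'; case: ifP.
have x0 : 0 < x by rewrite invr_gt0 !mulr_gt0 ?exprn_gt0 ?ltr0n.
have := decode_prob bg r0 th0 th1 rq Eg G1 lG ord0 N0 x0.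
set pr := run _ _ _ _ _ => prD.
have half : 2^-1 <= pr.
  apply: le_trans prD; have NN : 0 < N%:R :> R by rewrite ltr0n.
  have w0 : 0 < 32 * r%:R ^+ 2 * Lv%:R :> R by rewrite !mulr_gt0 ?exprn_gt0 ?ltr0n.
  have alg (b w Nr rr : R) : 0 < Nr -> 0 < w -> 6 * rr ^+ 2 * b ^+ 2 * w ^+ 2 <= Nr ->
      2^-1 <= 1 - 3 * rr ^+ 2 * b ^+ 2 / (Nr * w^-1 ^+ 2).
    move=> Nr0 wp H.
    have -> : 3 * rr ^+ 2 * b ^+ 2 / (Nr * w^-1 ^+ 2) = (3 * rr ^+ 2 * b ^+ 2 * w ^+ 2) / Nr.
      by field; rewrite !gt_eqF.
    suff : 3 * rr ^+ 2 * b ^+ 2 * w ^+ 2 / Nr <= 2^-1 by lra.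
    by rewrite ler_pdivrMr//; lra.
  by rewrite natrM natrX; exact: alg.
pose h s := ln T%:R * D c s.
have lT : 0 <= ln T%:R :> R by rewrite ln_ge0// ler1n.
have nh : nice h by apply: niceM => //; exact: nice_cst.
have hB s : `|h s| <= ln T%:R.
  by have /andP[d0 d1] := D01 c s; rewrite normrM !ger0_norm// ler_piMr.
have := forecast_regret QE' hM nh hB.
have -> : run E' (succ_matrix q (th c)) m ord0 (fun _ => h) = ln T%:R * pr.
  by rewrite (@runZ _ _ _ _ _ _ _ _ _ (fun _ => D c)).
have Le : Lam (fun s => expR (h s)) <= 2.
  apply: (@le_trans _ _ (Lam (fun s => 1 + T%:R * D c s))).
    apply: forecast_le => [||s]; first exact: nice_expR.
      by apply: niceD; [exact: nice_cst|apply: niceM => //; exact: nice_cst].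
    rewrite /h /D; case: decode; last by rewrite !mulr0 expR0 addr0.
    by rewrite !mulr1 lnK ?posrE// lerDr.
  rewrite forecastD; [|exact: nice_cst|by apply: niceM => //; exact: nice_cst].
  rewrite forecast_cst forecastZ//.
  have : T%:R * Lam (D c) <= 1 by rewrite -ler_pdivlMl// mulr1.
  lra.
have Lp : 0 < Lam (fun s => expR (h s)).
  rewrite (lt_le_trans (expR_gt0 (- ln T%:R)))// -(forecast_cst E0 K m (expR _)).
  apply: forecast_le => [||s]; [exact: nice_cst|exact: nice_expR|].
  by rewrite ler_expR; have := hB s; rewrite ler_norml => /andP[].
have : ln (Lam (fun s => expR (h s))) <= ln 2 by rewrite ler_ln ?posrE.
have -> : (r ^ 2)%:R * ln Lv%:R = ln T%:R :> R.
  by rewrite /T [in RHS]natrX lnXn ?ltr0n// mulr_natl.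
have : 2^-1 * ln T%:R <= ln T%:R * pr by rewrite mulrC; exact: ler_wpM2l.
lra.
Qed.

End bits.

(** * The noisy bit of an observation *)

Section bits_of_observations.
Context {d} {X : measurableType d} {R : realType}.
Variables (c1 c2 : R) (f : X -> bool).
Hypotheses (hc1 : 0 <= c1) (hc12 : c1 < c2) (hc2 : c2 <= 1) (mf : measurable_fun [set: X] f).

(** Affine in the bit, with mean [0] if the bit is [Bern c1], as in unmarked states,
and [1] if it is [Bern c2], as in marked ones. *)
Definition mark (x : X) : R := ((f x)%:R - c1) / (c2 - c1).

Let bit_indic : (fun x => (f x)%:R) = \1_(f @^-1` [set true]) :> (X -> R).
Proof.
apply/funext => x; rewrite indicE; congr (nat_of_bool _)%:R.
by apply/idP/idP => [fx|/set_mem//]; exact: mem_set.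
Qed.

Let mbit : measurable (f @^-1` [set true]).
Proof. by rewrite -[X in measurable X]setTI; exact: mf. Qed.

Let bm_bit : bm (fun x => (f x)%:R : R).
Proof. by rewrite bit_indic; exact: bm_indic. Qed.

Lemma bm_mark : bm mark.
Proof. by apply: bmM; [apply: bmB => //; exact: bm_cst|exact: bm_cst]. Qed.

Lemma mean_mark (P : probability X R) c : 0 <= c <= 1 ->
  (forall B : set bool, pushforward P f B = bernoulli_prob c B) ->
  mean P mark = (c - c1) / (c2 - c1).
Proof.
move=> c01 Pc; rewrite meanZr; last by apply: bmB => //; exact: bm_cst.
rewrite meanB//; last exact: bm_cst.
rewrite mean_cst bit_indic; congr ((_ - _) / _); apply: EFin_inj.
rewrite mean_indic//; have := Pc [set true]; rewrite /pushforward => ->.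
by rewrite bernoulli_probE// !diracE mem_set// memNset// mule1 mule0 adde0.
Qed.

Lemma letter_mark o x : `|letter mark o x| <= (c2 - c1)^-1.
Proof.
have d0 : 0 < c2 - c1 by rewrite subr_gt0.
have b01 : 0 <= ((f x)%:R : R) <= 1 by case: (f x); rewrite lexx ler01.
move: b01; case: o => [[]|] /=; rewrite /mark; move: (f x)%:R => b /andP[b0 b1].
- rewrite normrM [`|_^-1|]gtr0_norm ?invr_gt0//.
  apply: ler_piMl; first by rewrite invr_ge0 ltW.
  by rewrite ler_norml; apply/andP; split; move: hc1 hc12 hc2; lra.
- have -> : 1 - (b - c1) / (c2 - c1) = (c2 - b) / (c2 - c1) by field; rewrite gt_eqF.
  rewrite normrM [`|_^-1|]gtr0_norm ?invr_gt0//.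
  apply: ler_piMl; first by rewrite invr_ge0 ltW.
  by rewrite ler_norml; apply/andP; split; move: hc1 hc12 hc2; lra.
- by rewrite normr1 invf_ge1//; move: hc1 hc2; lra.
Qed.

End bits_of_observations.

(** * Orders of magnitude and the rate *)

Section arithmetic.
Context {R : realType}.

(** The number of levels of the grid of transition probabilities: a precision of
[n ^ (-1/4)] leaves a comfortable margin to the sampling error [n ^ (-1/2)], and
costs only a constant factor in the logarithm. *)
Lemma fourth_root n : (16 <= n)%N -> exists Lv, [/\ (0 < Lv)%N, (Lv ^ 4 <= n)%N &
  ln n%:R / 8 <= ln Lv%:R :> R].
Proof.
move=> n16; pose P L := (L ^ 4 <= n)%N.
have exP : exists L, P L by exists 0%N.
have ubP L : P L -> (L <= n)%N.
  by rewrite /P => h; case: L h => // L h; rewrite (leq_trans _ h)// expnS leq_pmulr// expn_gt0.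
have [L PL Lmax] := ex_maxnP exP ubP.
have L2 : (2 <= L)%N by apply: Lmax.
exists L; split => //; first by lia.
have nL : (n < L.+1 ^ 4)%N by rewrite ltnNge; apply/negP => /Lmax; rewrite ltnn.
have nL2 : (n <= L ^ 8)%N.
  have -> : (L ^ 8 = (L ^ 2) ^ 4)%N by rewrite -expnM.
  by rewrite (leq_trans (ltnW nL))// leq_exp2r// expnS expn1; nia.
rewrite ler_pdivrMr// mulrC mulr_natl -lnXn ?ltr0n//; last by lia.
by rewrite ler_ln ?posrE ?exprn_gt0 ?ltr0n//; [rewrite -natrX ler_nat|lia|lia].
Qed.

Lemma size_bounds k n (r := (k.-2.-1 %/ 3)%N) : (1000 <= k)%N -> (k ^ 19 <= n)%N ->
  [/\ k = k.-2.+2, (24 * k <= n)%N, (r.*2.+1 + r <= k.-2)%N, (k <= 4 * r)%N & (24 <= n)%N].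
Proof.
move=> k1000 kn.
have kn24 : (24 * k <= n)%N.
  rewrite (leq_trans _ kn)// expnS mulnC leq_mul2l; apply/orP; right.
  have k0 : (0 < k)%N by exact: leq_trans k1000.
  by rewrite expnS (leq_trans (leq_trans _ k1000))// leq_pmulr// expn_gt0 k0.
have k24 : (24 <= n)%N by move: kn24 k1000; clear; lia.
by split=> //; rewrite /r; move: k1000; clear; lia.
Qed.

End arithmetic.

Section regret.
Context {d} {X : measurableType d} {R : realType} (q n : nat).
Variables (Q : set (probability X R)) (E0 : probability X R)
  (K : R.-pker (n.-tuple X) ~> X) (rho : R).
Hypotheses (QE0 : Q E0) (n0 : (0 < n)%N)
  (Krho : forall P, HMM n q.+2 Q P -> (cond_KL P K <= rho%:E)%E).

Definition regret : R := 48 * ((n.*2)%:R * rho + ln n.+1%:R + 2 * ln (24 * n%:R * q.+1%:R)).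

Lemma forecast_regret m E' (M' : 'M[R]_q.+1) (h : seq X -> R) B : (m <= n)%N ->
  (forall i, Q (E' i)) -> row_stochastic M' -> nice h -> (forall s, `|h s| <= B) ->
  run E' M' m ord0 (fun _ => h) - ln (forecast E0 K m (fun s => expR (h s))) <= regret.
Proof.
move=> mn QE' hM' nh hB.
(* the test function [0] shows that the bound is nonnegative *)
have core h' B' := @nonneg_regret_le _ _ _ q n Q E0 E' M' K rho m QE0 QE' hM' n0 mn Krho h' B'.
have r0 : 0 <= regret.
  have := core (fun=> 0) 0 (nice_cst 0).
  rewrite run_cst// (_ : (fun s => _) = fun=> 1); last by apply/funext => s; rewrite expR0.
  rewrite forecast_cst ln1 subrr; apply => //.
  by move=> s; rewrite normr0.
have [g0|g0] := leP 0 (run E' M' m ord0 (fun _ => h) - ln (forecast E0 K m (fun s => expR (h s)))).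
  exact: (core h B nh hB g0).
exact: le_trans (ltW g0) r0.
Qed.

Lemma regret_le : (24 <= n)%N -> (q.+2 <= n)%N ->
  regret <= 96 * (n%:R * rho) + 384 * ln n%:R.
Proof.
move=> n24 qn; have nn : 0 < n%:R :> R by rewrite ltr0n.
have l1 : ln n.+1%:R <= 2 * ln n%:R :> R.
  rewrite mulr_natl -lnXn// ler_ln ?posrE ?exprn_gt0 ?ltr0n//.
  by rewrite -natrX ler_nat; nia.
have l2 : ln (24 * n%:R * q.+1%:R) <= 3 * ln n%:R :> R.
  rewrite [leRHS]mulr_natl -lnXn// ler_ln ?posrE ?exprn_gt0 ?mulr_gt0 ?ltr0n//.
  rewrite !exprS expr0 mulr1 mulrA ler_pM ?mulr_ge0 ?ler_nat//; last by lia.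
  by rewrite ler_pM2r// ler_nat.
by rewrite /regret -addnn natrD; lra.
Qed.

Lemma red_regret l : (q.+1 * l <= n)%N ->
  ((q.+1%:R)%:E * Red (prod_class Q l) <= regret%:E)%E.
Proof.
move=> ln; apply: (@red_le_regret _ _ _ q n l Q E0 K) => E' M' h B QE' hM' nh hB.
exact: forecast_regret.
Qed.

End regret.

Section rate.
Context {R : realType}.
Variable G : R.
Hypothesis G1 : 1 <= G.

Definition sample_cost : R := 24 * (6 * 16 ^+ 2 * 32 ^+ 2 * G ^+ 12).

(** The blocks needed for decoding are polynomially many in [r] and quadratically
many in the number of levels, so at most a power of [r] times [sqrt n], while
[n %/ block_size r] of them are available. *)
Lemma enough_blocks n r Lv : (0 < r)%N -> (0 < Lv)%N -> (Lv ^ 4 <= n)%N ->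
  sample_cost ^+ 2 * r%:R ^+ 18 <= n%:R -> (24 * r <= n)%N ->
  6 * r%:R ^+ 2 * (16 * r%:R * G ^+ 6) ^+ 2 * (32 * r%:R ^+ 2 * Lv%:R) ^+ 2 <=
    (n %/ block_size r)%:R.
Proof.
move=> r0 L0 Ln cn rn; have rr : 0 < r%:R :> R by rewrite ltr0n.
have L4 : Lv%:R ^+ 4 <= n%:R :> R by rewrite -natrX ler_nat.
have nN : (n <= 24 * r * (n %/ block_size r))%N.
  have := divn_eq n (block_size r).
  have : (n %% block_size r < block_size r)%N by rewrite ltn_mod /block_size addn_gt0 orbT.
  rewrite /block_size; nia.
have {}nN : n%:R <= 24 * r%:R * (n %/ block_size r)%:R :> R.
  by rewrite -!natrM ler_nat.
set N := (n %/ _)%:R in nN *.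
have GG : 0 < G ^+ 12 by rewrite exprn_gt0// (lt_le_trans ltr01).
have S0 : 0 < sample_cost by rewrite /sample_cost; do ?apply: mulr_gt0 => //; rewrite exprn_gt0.
suff : sample_cost * r%:R ^+ 9 * Lv%:R ^+ 2 <= n%:R :> R.
  move=> H; have := le_trans H nN; rewrite /sample_cost => H2.
  rewrite -(ler_pM2l (_ : 0 < 24 * r%:R)); last by rewrite mulr_gt0.
  apply: le_trans H2; rewrite le_eqVlt; apply/orP; left; apply/eqP.
  by ring.
rewrite -(ler_pXn2r (_ : (0 < 2)%N)) ?nnegrE//; last first.
  by apply: mulr_ge0; [apply: mulr_ge0; [exact: ltW|exact: exprn_ge0]|exact: exprn_ge0].
have -> : (sample_cost * r%:R ^+ 9 * Lv%:R ^+ 2) ^+ 2 =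
  (sample_cost ^+ 2 * r%:R ^+ 18) * Lv%:R ^+ 4 by ring.
by rewrite [leRHS]expr2 ler_pM// mulr_ge0 ?exprn_ge0// ltW.
Qed.

(** The lower bound [r^2 x / 2] of the regret is at least twice the logarithmic
terms on its other side once [k >= 1000], so it is bounded by [t = n rho]
alone. *)
Lemma learning_rate (k r y x B t z : R) : 1000 <= k -> k <= 4 * r -> 0 <= y ->
  y / 8 <= x -> z <= y -> 2^-1 * (r ^+ 2 * x) - z <= B -> B <= 96 * t + 384 * y ->
  k ^+ 2 * y <= 240 * (205 * t) /\ B <= 192 * t.
Proof.
move=> k1 kr y0 yx zy lo hi.
have h1 : k ^+ 2 / 16 * (y / 8) <= r ^+ 2 * x.
  apply: ler_pM => //; [|lra|nra].
  by rewrite mulr_ge0 ?exprn_even_ge0.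
have h2 : 385 * y <= k ^+ 2 / 512 * y by apply: ler_wpM2r => //; nra.
have h3 : 0 <= k ^+ 2 * y by rewrite mulr_ge0 ?exprn_even_ge0.
have t0 : k ^+ 2 * y <= 512 * (96 * t) by move: lo hi zy h1 h2; clear; lra.
by move: t0 h2 h3 hi y0; clear; split; lra.
Qed.

Lemma class_rate (k x B t : R) : 1000 <= k -> 0 <= t -> B <= 192 * t ->
  (k - 1) * x <= B -> k * x <= 400 * t.
Proof. by move=> k1 t0 Bt kx; have [x0|x0] := leP 0 x; nra. Qed.

End rate.

Theorem corollary2 (R : realType) (c1 c2 : R)
    (hc1 : 0 <= c1) (hc12 : c1 < c2) (hc2 : c2 <= 1) :
  exists (C D : nat) (a : R), 0 < a /\
    forall (d : measure_display) (X : measurableType d)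
      (Q : set (probability X R)) (f : X -> bool),
      measurable_fun [set: X] f ->
      (forall c : R, c1 <= c <= c2 ->
         exists2 Qc : probability X R, Q Qc &
           forall B : set bool, pushforward Qc f B = bernoulli_prob c B) ->
      forall k n : nat, (C <= k)%N -> (k ^ D <= n)%N ->
        (a%:E * ((k%:R ^+ 2 * ln n%:R / n%:R)%:E
                 + (k%:R / n%:R)%:E * Red (prod_class Q (n %/ k)))
         <= Risk (HMM n k Q))%E.
Proof.
pose G := (c2 - c1)^-1.
have d0 : 0 < c2 - c1 by rewrite subr_gt0.
have G1 : 1 <= G by rewrite /G invf_ge1//; lra.
have [C0 CC0] : exists C0 : nat, sample_cost G ^+ 2 <= C0%:R.
  exists (Num.bound (sample_cost G ^+ 2)); apply: ltW.
  by apply: archi_boundP; rewrite exprn_even_ge0.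
(* [enough_blocks] asks for the 18-th power of [r <= k], up to a constant that
   depends on [c1] and [c2] and is absorbed by one more factor [k]. *)
exists (maxn 1000 C0), 19%N, (250 * 200)^-1; split; first by rewrite invr_gt0 mulr_gt0 ?ltr0n.
move=> d X Q f mf Qex k n; rewrite geq_max => /andP[k1000 kC0] kn.
have k0 : (0 < k)%N by lia.
have k_n : (k <= n)%N by rewrite (leq_trans _ kn)// expnS leq_pmulr// expn_gt0 k0.
have [Q1 QQ1 Q1c] := Qex c1 (ltac:(by rewrite lexx ltW)).
have [Q2 QQ2 Q2c] := Qex c2 (ltac:(by rewrite lexx ltW)).
have Q1g : mean Q1 (mark c1 c2 f) = 0.
  rewrite (mean_mark _ _ _ _ Q1c) ?subrr ?mul0r//; apply/andP; split => //; lra.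
have Q2g : mean Q2 (mark c1 c2 f) = 1.
  rewrite (mean_mark _ _ _ _ Q2c) ?mulfV ?gt_eqF//; apply/andP; split => //; lra.
have nn : 0 < n%:R :> R by rewrite ltr0n; exact: leq_trans k_n.
have kk : 1000 <= k%:R :> R by rewrite ler_nat.
have main rho : forall K : R.-pker (n.-tuple X) ~> X,
   (forall P, HMM n k Q P -> (cond_KL P K <= rho%:E)%E) ->
   (((250 * 200)^-1)%:E * ((k%:R ^+ 2 * ln n%:R / n%:R)%:E
      + (k%:R / n%:R)%:E * Red (prod_class Q (n %/ k))) <= rho%:E)%E.
  move=> K Krho.
  (* [k] states: a waiting one and the [q.+1] active ones, which include the
     [3 r + 2] states of the decodable chain. *)
  have [kq kn24 rq rk n24] := size_bounds k1000 kn.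
  move: rq rk; set r := (_ %/ 3)%N => rq rk.
  pose q := k.-2; rewrite -/q in kq rq.
  rewrite kq in Krho.
  have n0 : (0 < n)%N by exact: leq_trans n24.
  pose Bd := regret q n rho.
  have Bdle : Bd <= 96 * (n%:R * rho) + 384 * ln n%:R.
    by apply: regret_le => //; rewrite -kq.
  have r0 : (0 < r)%N by move: rk k0; case: (r) => [|//]; rewrite muln0 leqn0 => /eqP ->.
  have [Lv [L0 Ln lnL]] := @fourth_root R n (leq_trans (isT : 16 <= 24)%N n24).
  have cn : sample_cost G ^+ 2 * r%:R ^+ 18 <= n%:R.
    apply: (@le_trans _ _ (k%:R * k%:R ^+ 18)); last by rewrite -exprS -natrX ler_nat.
    apply: ler_pM; rewrite ?exprn_even_ge0//.
      by rewrite (le_trans CC0)// ler_nat.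
    rewrite -!natrX ler_nat leq_exp2r// (leq_trans _ (leq_trans rq _))//; first exact: leq_addl.
    exact: leq_trans (leq_pred _) (leq_pred _).
  have rk2 : (r <= k)%N.
    by rewrite kq (leq_trans _ (leq_trans rq _))// ?leq_addl// -addn2 leq_addr.
  have r24n : (24 * r <= n)%N by rewrite (leq_trans _ kn24)// leq_mul2l.
  have NG := enough_blocks G1 r0 L0 Ln cn r24n.
  have N0 : (0 < n %/ block_size r)%N by rewrite divn_gt0 /block_size ?addn_gt0 ?orbT//; move: r24n r0; clear; lia.
  have term1 : 2^-1 * ((r ^ 2)%:R * ln Lv%:R) - ln 2 <= Bd.
    apply: (@bits_regret _ _ _ q n r Lv (n %/ block_size r) Q Q1 K Bd G Q1 Q2 (mark c1 c2 f)) => //.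
    - move=> E' M' h B QE' hM' nh hB; apply: (forecast_regret QQ1 n0 Krho _ QE' hM' nh hB).
      by rewrite mulnC leq_trunc_div.
    - exact: bm_mark.
    - exact: letter_mark.
  have term2 : ((q.+1%:R)%:E * Red (prod_class Q (n %/ k)) <= Bd%:E)%E.
    apply: (red_regret QQ1 n0 Krho).
    by rewrite (leq_trans _ (leq_trunc_div n k))// mulnC leq_mul2l; by rewrite kq leqnSn orbT.
  have l2 : ln 2 <= ln n%:R :> R by rewrite ler_ln ?posrE// ler_nat; exact: leq_trans n24.
  have ln0 : 0 <= ln n%:R :> R by rewrite ln_ge0// ler1n.
  have rk' : k%:R <= 4 * r%:R :> R by rewrite -natrM ler_nat.
  have [T1 T3] : k%:R ^+ 2 * ln n%:R <= 240 * (205 * (n%:R * rho)) /\ Bd <= 192 * (n%:R * rho).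
    apply: (learning_rate kk rk' ln0 lnL l2 _ Bdle).
    by rewrite -natrX.
  case E1 : (Red _) term2 => [x| |] term2.
  - have {}term2 : q.+1%:R * x <= Bd by move: term2; rewrite -EFinM lee_fin.
    rewrite -(EFinM (k%:R / n%:R)) -EFinD -EFinM lee_fin.
    have qk : q.+1%:R = k%:R - 1 :> R by rewrite kq -[in RHS]natr1 addrK.
    have t0 : 0 <= n%:R * rho.
      have := le_trans (mulr_ge0 (exprn_even_ge0 k%:R (isT : ~~ odd 2)) ln0) T1.
      by clear; lra.
    have T4 : k%:R * x <= 400 * (n%:R * rho).
      by apply: (class_rate kk t0 T3); rewrite -qk.
    rewrite ler_pdivrMl; last by rewrite mulr_gt0 ?ltr0n.
    rewrite -(ler_pM2l nn).
    have -> : n%:R * (k%:R ^+ 2 * ln n%:R / n%:R + k%:R / n%:R * x) =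
      k%:R ^+ 2 * ln n%:R + k%:R * x by field; rewrite gt_eqF.
    by move: T1 T4 t0; clear; lra.
  - by move: term2; rewrite gt0_muley// lte_fin.
  - rewrite gt0_muleNy; last by rewrite lte_fin divr_gt0// ltr0n.
    rewrite addeNy gt0_muleNy; first exact: leNye.
    by rewrite lte_fin invr_gt0 mulr_gt0 ?ltr0n.
apply/ereal_infP => _ [K _ <-].
case E2 : (ereal_sup _) => [rho| |]; last 2 first.
- exact: leey.
- have lt rho : (ereal_sup [set cond_KL P K | P in HMM n k Q] <= rho%:E)%E by rewrite E2 leNye.
  have main' rho := main rho K (fun P HP => le_trans (ereal_sup_ubound (ex_intro2 _ _ P HP erefl)) (lt rho)).
  case E3 : (_ * _)%E main' => [x| |] main'; last by [].
    by exfalso; have := main' (x - 1)%R; rewrite lee_fin; clear; lra.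
  by have := main' 0%R.
apply: (main rho K) => P HP; rewrite -E2; apply: ereal_sup_ubound; by exists P.
Qed.
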